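(* Let $\lambda\in S_{b,\pi/4}=\{\lambda\in\mathbb{C}:\ \tfrac{\pi}{4}\le|\arg(\lambda-b)|\le\pi\}$, $\lambda\neq b$, and let $\beta<1$, $0\le s<1$. Then $$\|(A_\epsilon-\lambda)^{-1}-(A-\lambda)^{-1}\|_{\mathcal{L}(H^{-\beta}(\Omega),H^{s}(\Omega))}\to 0\quad\text{as }\epsilon\to0 .$$ The convergence is uniform for $\lambda$ in compact subsets of the sector $S_{b,\pi/4}$ (with $\lambda\ne b$).
   Context: Let $\Omega=(0,1)^2\subset\mathbb{R}^2$, $a>0$, and let $\epsilon_0>0$ be sufficiently small. For $0<\epsilon\le\epsilon_0$ let $h_\epsilon(x_1,x_2)=(x_1,\,x_2+\varphi(x_2,\epsilon)\sin(x_1/\epsilon))$, a diffeomorphism of $\Omega$ onto $\Omega_\epsilon=h_\epsilon(\Omega)$, where $\varphi$ is of class $C^2$ and (i) $\varphi(0,\epsilon)=0$; (ii) $\varphi(1,\epsilon)=\epsilon$; (iii) $\partial\varphi/\partial x_2\to0$ uniformly as $\epsilon\to0$; (iv) $\|\varphi(x_2,\epsilon)^2/\epsilon^2\|_{L^2(\Omega)}\to0$ as $\epsilon\to0$; moreover $\varphi(x_2,\epsilon)/\epsilon$ is bounded uniformly in $x_2,\epsilon$ (i.e. $h_\epsilon-\mathrm{id}$ is uniformly Lipschitz). Let $Jh_\epsilon=\det Dh_\epsilon=1+\frac{\partial\varphi}{\partial x_2}(x_2,\epsilon)\sin(x_1/\epsilon)$, $h_0=\mathrm{id}$, $Jh_0=1$,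 and $\nabla_\epsilon u=(Dh_\epsilon)^{-T}\nabla u$ (the pull-back to $\Omega$ of the gradient in $\Omega_\epsilon$). $H^{-s}(\Omega)$ denotes the dual of $H^s(\Omega)$. For $0\le\epsilon\le\epsilon_0$, $A_\epsilon:H^1(\Omega)\to H^{-1}(\Omega)$ is $\langle A_\epsilon u,\phi\rangle=\int_\Omega\nabla_\epsilon u\cdot\nabla_\epsilon\phi\,|Jh_\epsilon|\,dx+a\int_\Omega u\phi\,|Jh_\epsilon|\,dx$ for $u,\phi\in H^1(\Omega)$; $A=A_0$. It is viewed as an unbounded operator in $H^{-1}(\Omega)$ with domain $H^1(\Omega)$, where for given $\epsilon$ a function $u\in L^2(\Omega)$ is identified with the functional $\phi\mapsto\int_\Omega u\phi\,|Jh_\epsilon|\,dx$. The constant $b>0$ is independent of $\epsilon$ and such that $S_{b,\pi/4}\subset\rho(A_\epsilon)$ and $\|(A_\epsilon-\lambda)^{-1}\|_{\mathcal{L}(H^{-1}(\Omega))}\le M/|\lambda-b|$ for all $\lambda\in S_{b,\pi/4}$ and $0\le\epsilon\le\epsilon_0$, with $M$ independent of $\epsilon$ (spaces are complexified as usual). *)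

(* Defs.v *)
From HB Require Import structures.
From mathcomp Require Import all_boot all_order all_algebra.
From mathcomp Require Import complex.
From mathcomp Require Import all_classical all_reals all_analysis.

Set Implicit Arguments.
Unset Strict Implicit.
Unset Printing Implicit Defensive.

Import Order.TTheory GRing.Theory Num.Theory.
Import numFieldNormedType.Exports.
Local Open Scope classical_set_scope.
Local Open Scope ring_scope.
Local Open Scope complex_scope.

Notation leb2 := (@lebesgue_measure _ \x @lebesgue_measure _)%E.

Definition Omega {R : realType} : set (R * R) :=
  `]0%R, 1%R[%classic `*` `]0%R, 1%R[%classic.

(* Functions are total on the plane; only their values on Omega matter. *)

Definition cintegral {R : realType} (f : R * R -> R[i]) : R[i] :=
  (\int[leb2]_(x in Omega) complex.Re (f x))%R +i*
  (\int[leb2]_(x in Omega) complex.Im (f x))%R.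

(* The plane carries the sigma-algebra for which [leb2] is defined. *)
Definition cmeasurable {R : realType} (f : R * R -> R[i]) : Prop :=
  let plane := (measurableTypeR R * measurableTypeR R)%type in
  measurable_fun (Omega : set plane) (fun x : plane => complex.Re (f x)) /\
  measurable_fun (Omega : set plane) (fun x : plane => complex.Im (f x)).

Definition L2norm {R : realType} (u : R * R -> R[i]) : \bar R :=
  sqrte (\int[leb2]_(x in Omega) ((Normc.normc (u x)) ^+ 2)%:E)%E.

Definition inL2 {R : realType} (u : R * R -> R[i]) : Prop :=
  cmeasurable u /\ (L2norm u < +oo)%E.

Definition unit_vec {R : realType} (j : 'I_2) : R * R :=
  if j == ord0 then (1, 0) else (0, 1).

Definition pderiv {R : realType} (j : 'I_2) (f : R * R -> R) : R * R -> R :=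
  fun x => 'D_(unit_vec j) f x.

Definition mpderiv {R : realType} (al : nat * nat) (f : R * R -> R) :
    R * R -> R :=
  iter al.1 (pderiv ord0) (iter al.2 (pderiv ord_max) f).

Definition smooth {R : realType} (f : R * R -> R) : Prop :=
  forall w : seq 'I_2,
    continuous (foldr pderiv f w) /\
    forall j x, derivable (foldr pderiv f w) x (unit_vec j).

Definition test_function {R : realType} (f : R * R -> R) : Prop :=
  smooth f /\
  exists K : set (R * R),
    [/\ compact K, K `<=` Omega & forall x, ~ K x -> f x = 0].

Definition is_wderiv {R : realType} (al : nat * nat)
    (u v : R * R -> R[i]) : Prop :=
  inL2 v /\
  forall f : R * R -> R, test_function f ->
    cintegral (fun x => u x * (mpderiv al f x)%:C) =
    (-1) ^+ (al.1 + al.2) * cintegral (fun x => v x * (f x)%:C).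

(* Determined up to a null set when it exists; 0 otherwise. *)
Definition wderiv {R : realType} (al : nat * nat) (u : R * R -> R[i]) :
    R * R -> R[i] :=
  xget (fun=> 0) [set v | is_wderiv al u v].

Definition eucl_dist {R : realType} (x y : R * R) : R :=
  Num.sqrt ((x.1 - y.1) ^+ 2 + (x.2 - y.2) ^+ 2).

(* Square of the Sobolev-Slobodeckij seminorm of order sg, 0 < sg < 1; the
   value of the kernel on the diagonal (a null set) is irrelevant. *)
Definition slobodeckij {R : realType} (sg : R) (u : R * R -> R[i]) : \bar R :=
  (\int[leb2]_(x in Omega) \int[leb2]_(y in Omega)
     ((Normc.normc (u x - u y)) ^+ 2 /
        (eucl_dist x y) `^ (2 + 2 * sg))%:E)%E.

(* For r = k + sg with k = floor r: the sum of ||D^al u||^2 over |al| <= k,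
   plus, when sg > 0, the seminorms of the derivatives of order k. *)
Definition Hnorm_sq {R : realType} (r : R) (u : R * R -> R[i]) : \bar R :=
  let k := Num.truncn r in
  let sg := r - k%:R in
  (\sum_(i < k.+1) \sum_(j < k.+1 | (i + j <= k)%N)
      L2norm (wderiv (nat_of_ord i, nat_of_ord j) u) ^+ 2
   + (if (0 < sg)%R then
        \sum_(i < k.+1)
          slobodeckij sg (wderiv (nat_of_ord i, (k - i)%N) u)
      else 0))%E.

Definition inH {R : realType} (r : R) (u : R * R -> R[i]) : Prop :=
  [/\ inL2 u,
      forall i j : nat, (i + j <= Num.truncn r)%N ->
        exists v, is_wderiv (i, j) u v
    & (Hnorm_sq r u < +oo)%E].

Definition Hnorm {R : realType} (r : R) (u : R * R -> R[i]) : \bar R :=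
  if `[< inH r u >] then sqrte (Hnorm_sq r u) else +oo%E.

Definition H_ball {R : realType} (r : R) : set (R * R -> R[i]) :=
  [set u | inH r u /\ (Hnorm r u <= 1)%E].

(* An element of H^{-r} is a bounded linear functional on H^r; its values
   outside H^r are irrelevant, so that for r <= 1 the inclusion of H^{-r} in
   H^{-1} (restriction of functionals) is the identity on representatives.
   Boundedness makes F insensitive to a.e. modifications on Omega. *)
Definition functional (R : realType) := (R * R -> R[i]) -> R[i].

Definition in_dual {R : realType} (r : R) (F : functional R) : Prop :=
  (forall (c : R[i]) u v, inH r u -> inH r v ->
     F (fun x => c * u x + v x) = c * F u + F v) /\
  exists C : R, forall u, inH r u ->
    ((Normc.normc (F u))%:E <= C%:E * Hnorm r u)%E.

Definition dual_norm {R : realType} (r : R) (F : functional R) : \bar R :=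
  ereal_sup [set (Normc.normc (F u))%:E | u in H_ball r].

Definition dual_ball {R : realType} (r : R) : set (functional R) :=
  [set F | in_dual r F /\ (dual_norm r F <= 1)%E].

(* Norm of an operator L whose source has closed unit ball B and whose target
   has norm N. *)
Definition op_norm {R : realType} {T U : Type} (B : set T) (N : U -> \bar R)
    (L : T -> U) : \bar R :=
  ereal_sup [set N (L f) | f in B].

Definition comp2 {R : realType} (j : 'I_2) (x : R * R) : R :=
  if j == ord0 then x.1 else x.2.

Definition h {R : realType} (phi : R -> R -> R) (eps : R) (x : R * R) : R * R :=
  if eps == 0 then x else (x.1, x.2 + phi x.2 eps * sin (x.1 / eps)).

Definition Dh {R : realType} (phi : R -> R -> R) (eps : R) (x : R * R) :
    'M[R]_2 :=
  \matrix_(i < 2, j < 2) pderiv j (fun y => comp2 i (h phi eps y)) x.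

Definition Jh {R : realType} (phi : R -> R -> R) (eps : R) (x : R * R) : R :=
  \det (Dh phi eps x).

Definition C1_on {R : realType} (U : set (R * R)) (g : R * R -> R * R) : Prop :=
  forall i j : 'I_2, forall x, U x ->
    derivable (fun y => comp2 i (g y)) x (unit_vec j) /\
    {for x, continuous (pderiv j (fun y => comp2 i (g y)))}.

Definition diffeo_on {R : realType} (U : set (R * R)) (g : R * R -> R * R) :
    Prop :=
  [/\ open (g @` U), C1_on U g
    & exists g' : R * R -> R * R,
        C1_on (g @` U) g' /\ forall x, U x -> g' (g x) = x].

(* Class C^2 on the closed interval: the derivatives on the interior extend
   continuously up to the endpoints. *)
Definition C2_01 {R : realType} (f : R -> R) : Prop :=
  {within `[0%R, 1%R], continuous f} /\
  exists f1 f2 : R -> R,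
    [/\ {within `[0%R, 1%R], continuous f1},
        {within `[0%R, 1%R], continuous f2}
      & forall x : R, 0 < x < 1 -> is_derive x (1 : R) f (f1 x) /\
                               is_derive x (1 : R) f1 (f2 x)].

(* In [phi t eps] the first argument is the space variable x_2. *)
Definition admissible {R : realType} (phi : R -> R -> R) (eps0 : R) : Prop :=
  (forall eps : R, 0 < eps <= eps0 ->
     [/\ C2_01 (phi ^~ eps), phi 0 eps = 0, phi 1 eps = eps
       & diffeo_on Omega (h phi eps)]) /\
  [/\ forall eta : R, 0 < eta ->
        \forall eps \near 0^'+, forall t : R, 0 < t < 1 ->
          `| derive1 (phi ^~ eps) t | <= eta,
      L2norm (fun x => (phi x.2 eps ^+ 2 / eps ^+ 2)%:C)
        @[eps --> 0^'+] --> 0%E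
    & exists C : R, forall eps t : R, 0 < eps <= eps0 -> 0 <= t <= 1 ->
        `| phi t eps / eps | <= C].

Definition wgrad {R : realType} (u : R * R -> R[i]) (x : R * R) : 'cV[R[i]]_2 :=
  \col_(j < 2) wderiv (if j == ord0 then (1, 0)%N else (0, 1)%N) u x.

Definition grad_eps {R : realType} (phi : R -> R -> R) (eps : R)
    (u : R * R -> R[i]) (x : R * R) : 'cV[R[i]]_2 :=
  map_mx (real_complex R) (invmx (Dh phi eps x))^T *m wgrad u x.

(* The pairings are bilinear (no conjugation): the operators are the
   complexifications of the real ones. *)
Definition A_op {R : realType} (a : R) (phi : R -> R -> R) (eps : R)
    (u : R * R -> R[i]) : functional R :=
  fun psi =>
    cintegral (fun x =>
      (\sum_(j < 2) grad_eps phi eps u x j ord0 * grad_eps phi eps psi x j ord0)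
      * `| Jh phi eps x |%:C)
    + a%:C * cintegral (fun x => u x * psi x * `| Jh phi eps x |%:C).

(* The eps-dependent identification of a function with a functional. *)
Definition embed {R : realType} (phi : R -> R -> R) (eps : R)
    (u : R * R -> R[i]) : functional R :=
  fun psi => cintegral (fun x => u x * psi x * `| Jh phi eps x |%:C).

Definition solves {R : realType} (a : R) (phi : R -> R -> R) (eps : R)
    (lam : R[i]) (F : functional R) (u : R * R -> R[i]) : Prop :=
  inH 1 u /\
  forall psi, inH 1 psi ->
    A_op a phi eps u psi - lam * embed phi eps u psi = F psi.

(* (A_eps - lam)^{-1} F, as an element of H^1 (determined a.e. on Omega when
   lam is in the resolvent set); [embed phi eps] turns it into an element
   of H^{-1}. *)
Definition resolvent {R : realType} (a : R) (phi : R -> R -> R) (eps : R)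
    (lam : R[i]) (F : functional R) : R * R -> R[i] :=
  xget (fun=> 0) [set u | solves a phi eps lam F u].

Definition resolvent_norm {R : realType} (a : R) (phi : R -> R -> R) (eps : R)
    (lam : R[i]) : \bar R :=
  op_norm (dual_ball 1) (dual_norm 1)
    (fun F => embed phi eps (resolvent a phi eps lam F)).

Definition resolvent_set {R : realType} (a : R) (phi : R -> R -> R) (eps : R) :
    set R[i] :=
  [set lam |
    [/\ forall F, in_dual 1 F -> exists u, solves a phi eps lam F u,
        forall u, solves a phi eps lam (fun=> 0) u ->
          {ae leb2, forall x, Omega x -> u x = 0}
      & (resolvent_norm a phi eps lam < +oo)%E]].

(* [th] is a value of arg (lam - b); the vertex b is removed. *)
Definition sector {R : realType} (b : R) : set R[i] :=
  [set lam | lam != b%:C /\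
    exists th : R, (pi / 4 <= `|th| <= pi) /\
      lam - b%:C = (Normc.normc (lam - b%:C))%:C * (cos th +i* sin th)].

Definition sectorial {R : realType} (a : R) (phi : R -> R -> R)
    (eps0 b M : R) : Prop :=
  forall (eps : R) (lam : R[i]), 0 <= eps <= eps0 -> sector b lam ->
    resolvent_set a phi eps lam /\
    (resolvent_norm a phi eps lam <=
       (M / Normc.normc (lam - b%:C))%:E)%E.

(* For beta >= 0, H^{-beta} is the dual of H^beta and a functional F is sent to
   R_eps F - R_0 F.  For beta <= 0, H^{-beta} = H^{|beta|} is a space of
   functions, and f enters each resolvent through the identification of
   functions with functionals attached to the same value of eps. *)

Definition resolvent_dist_dual {R : realType} (a : R) (phi : R -> R -> R)
    (beta s eps : R) (lam : R[i]) : \bar R :=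
  op_norm (dual_ball beta) (Hnorm s)
    (fun F x => resolvent a phi eps lam F x - resolvent a phi 0 lam F x).

Definition resolvent_dist_fun {R : realType} (a : R) (phi : R -> R -> R)
    (beta s eps : R) (lam : R[i]) : \bar R :=
  op_norm (H_ball (- beta)) (Hnorm s)
    (fun f x => resolvent a phi eps lam (embed phi eps f) x -
                resolvent a phi 0 lam (embed phi 0 f) x).

Definition vanishes_on {R : realType} (S : set R[i])
    (dist : R -> R[i] -> \bar R) : Prop :=
  (forall lam, S lam -> dist eps lam @[eps --> 0^'+] --> 0%E) /\
  (forall K : set R[i], compact (K : set R[i]^o) -> K `<=` S ->
     forall eta : R, 0 < eta ->
       \forall eps \near 0^'+, forall lam, K lam ->
         (dist eps lam <= eta%:E)%E).

(* Main.v *)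
Require Import Defs.
From HB Require Import structures.
From mathcomp Require Import all_boot all_order all_algebra.
From mathcomp Require Import complex.
From mathcomp Require Import all_classical all_reals all_analysis.
From mathcomp Require Import unstable measurable_realfun ring lra.

Set Implicit Arguments.
Unset Strict Implicit.
Unset Printing Implicit Defensive.

Import Order.TTheory GRing.Theory Num.Theory.
Import numFieldNormedType.Exports.
Local Open Scope classical_set_scope.
Local Open Scope ring_scope.

(** The theorem compares [u], the solution for [eps], with [v], the solution
    for the unperturbed square.  The difference is bounded in H^1 uniformly in
    [eps] and in the data, and it tends to zero in L^2 uniformly in the data;
    since [s < 1], interpolating between the two gives H^s.

    The pulled-back form has the coefficient matrix
    [(Dh)^-1 (Dh)^-T |Jh| = [[q, p], [p, r]]], where [q] is the Jacobian,
    [p = - (phi / eps) cos (x1 / eps)] and [q r = 1 + p^2] ([DhE], [A_opE]).  As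
    [p] is bounded and [q - 1] is uniformly small, the forms are coercive with
    a common constant ([coercive]).  Testing the equation with the conjugate of
    its solution, and using the given resolvent bound for the term with
    [lam], one gets the H^1 bound ([apriori]).

    The forms do not converge in norm, because [p] is small only in an
    integral sense ([small_geometry]).  What saves the argument is duality.
    Let [z = u - v], let [g] be the conjugate of [z], and let [w] solve the
    unperturbed problem with datum [g].  Symmetry of the forms turns the
    square of the L^2 norm of [z] into the difference of the two forms at
    [(u, w)] plus the difference of the data at [w]; the dangerous part of it
    is at most the norm of the gradient of [u] times the norm of [p grad w]
    ([aform_diff], [L2_difference]).

    So [p grad w] has to be small uniformly in [g].  Since 0 belongs to the
    sector, [w = A^-1 (g + lam w)], and the data [g + lam w] are bounded in
    L^2 by a multiple of the norm of [z].  The operator sending such data to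
    the gradient of the solution is compact.  Replacing the datum by its means over
    the cells of a grid costs little energy ([energy_residual], by the
    Poincare inequality on cells); what is left depends on finitely many fixed
    gradients, and for those the multiplier [p] is harmless
    ([small_multiplier]).  This is [compact_resolvent].

    The Poincare inequality and the interpolation inequality both follow from
    the bound of the Slobodeckij seminorm by the gradient ([slobodeckij2]): a
    function with a weak gradient is absolutely continuous on almost every
    line ([acl1]), which reduces that bound to a one-dimensional one
    ([slobodeckij1]). *)

(** * Integration over products of sets and over the unit square *)

Notation plane R := (measurableTypeR R * measurableTypeR R)%type.
Definition unitI {R : realType} : set R := `]0%R, 1%R[%classic.

Lemma unitIE (R : realType) (x : R) : unitI x = (0 < x < 1) :> Prop.
Proof. by rewrite /unitI /= in_itv. Qed.

Section Tonelli.
Local Open Scope ereal_scope.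
Context d1 d2 (T1 : measurableType d1) (T2 : measurableType d2) (R : realType).
Variable m1 : {sigma_finite_measure set T1 -> \bar R}.
Variable m2 : {sigma_finite_measure set T2 -> \bar R}.
Variables (A : set T1) (B : set T2).
Hypotheses (mA : measurable A) (mB : measurable B).
Variable f : T1 * T2 -> \bar R.
Hypothesis mf : measurable_fun setT f.
Hypothesis f0 : forall x, 0 <= f x.

Let g := f \_ (A `*` B).

Let mg : measurable_fun setT g.
Proof.
by apply/(measurable_restrictT _ _).1 => //; [exact: measurableX|exact: measurable_funTS].
Qed.

Let g0 x : 0 <= g x.
Proof. by rewrite /g patchE; case: ifP. Qed.

Lemma tonelliD1 :
  \int[m1 \x m2]_(z in A `*` B) f z = \int[m1]_(x in A) \int[m2]_(y in B) f (x, y).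
Proof.
rewrite integral_mkcond fubini_tonelli1// [RHS]integral_mkcond.
apply: eq_integral => x _; rewrite /fubini_F patchE; case: ifPn => xA.
- rewrite [RHS]integral_mkcond; apply: eq_integral => y _.
  by rewrite !patchE in_setX xA.
- rewrite integral0_eq// => y _; rewrite patchE in_setX.
  by rewrite (negbTE xA).
Qed.

Lemma tonelliD2 :
  \int[m1 \x m2]_(z in A `*` B) f z = \int[m2]_(y in B) \int[m1]_(x in A) f (x, y).
Proof.
rewrite integral_mkcond fubini_tonelli2// [RHS]integral_mkcond.
apply: eq_integral => x _; rewrite /fubini_G patchE; case: ifPn => xA.
- rewrite [RHS]integral_mkcond; apply: eq_integral => y _.
  by rewrite !patchE in_setX xA andbT.
- rewrite integral0_eq// => y _; rewrite patchE in_setX.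
  by rewrite (negbTE xA) andbF.
Qed.

Lemma tonelliD_swap :
  \int[m1]_(x in A) \int[m2]_(y in B) f (x, y) =
  \int[m2]_(y in B) \int[m1]_(x in A) f (x, y).
Proof. by rewrite -tonelliD1 tonelliD2. Qed.

Lemma measurable_tonelliF :
  measurable_fun setT (fun x => \int[m2]_(y in B) f (x, y)).
Proof.
have mh : measurable_fun setT (f \_ (setT `*` B)).
  by apply/(measurable_restrictT _ _).1 => //; [exact: measurableX|exact: measurable_funTS].
apply: eq_measurable_fun (measurable_fun_fubini_tonelli_F (m2:=m2) _ mh _) => [x _|x].
- rewrite [RHS]integral_mkcond; apply: eq_integral => y _.
  by rewrite !patchE in_setX in_setT.
- by rewrite patchE; case: ifP.
Qed.

Lemma measurable_tonelliG :
  measurable_fun setT (fun y => \int[m1]_(x in A) f (x, y)).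
Proof.
have mh : measurable_fun setT (f \_ (A `*` setT)).
  by apply/(measurable_restrictT _ _).1 => //; [exact: measurableX|exact: measurable_funTS].
apply: eq_measurable_fun (measurable_fun_fubini_tonelli_G (m1:=m1) _ mh _) => [x _|x].
- rewrite [RHS]integral_mkcond; apply: eq_integral => y _.
  by rewrite !patchE in_setX in_setT andbT.
- by rewrite patchE; case: ifP.
Qed.

End Tonelli.

Section Fubini.
Local Open Scope ereal_scope.
Context d1 d2 (T1 : measurableType d1) (T2 : measurableType d2) (R : realType).
Variable m1 : {sigma_finite_measure set T1 -> \bar R}.
Variable m2 : {sigma_finite_measure set T2 -> \bar R}.
Variables (A : set T1) (B : set T2).
Hypotheses (mA : measurable A) (mB : measurable B).
Variable f : T1 * T2 -> \bar R.
Hypothesis fi : (m1 \x m2).-integrable (A `*` B) f.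

Let g := f \_ (A `*` B).

Let gi : (m1 \x m2).-integrable setT g.
Proof. by apply/integrable_restrict => //; rewrite ?setTI//; exact: measurableX. Qed.

Lemma fubiniD1 :
  \int[m1 \x m2]_(z in A `*` B) f z = \int[m1]_(x in A) \int[m2]_(y in B) f (x, y).
Proof.
rewrite integral_mkcond -(integral12_prod_meas1 gi) [RHS]integral_mkcond.
apply: eq_integral => x _; rewrite /fubini_F patchE; case: ifPn => xA.
- rewrite [RHS]integral_mkcond; apply: eq_integral => y _.
  by rewrite /g !patchE in_setX xA.
- rewrite integral0_eq// => y _; rewrite /g patchE in_setX.
  by rewrite (negbTE xA).
Qed.

Lemma fubiniD2 :
  \int[m1 \x m2]_(z in A `*` B) f z = \int[m2]_(y in B) \int[m1]_(x in A) f (x, y).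
Proof.
rewrite integral_mkcond -(integral21_prod_meas1 gi) [RHS]integral_mkcond.
apply: eq_integral => x _; rewrite /fubini_G patchE; case: ifPn => xA.
- rewrite [RHS]integral_mkcond; apply: eq_integral => y _.
  by rewrite /g !patchE in_setX xA andbT.
- rewrite integral0_eq// => y _; rewrite /g patchE in_setX.
  by rewrite (negbTE xA) andbF.
Qed.

End Fubini.

Section CauchySchwarz.
Local Open Scope ereal_scope.
Context d (T : measurableType d) (R : realType).
Variable mu : {measure set T -> \bar R}.

(** Hoelder's inequality with both exponents equal to 2, put in a form in
    which no norm has to be extracted from the integrals. *)
Lemma cauchy_schwarz (D : set T) (f g : T -> R) (a b : R) :
  measurable D -> measurable_fun D f -> measurable_fun D g ->
  (0 <= a)%R -> (0 <= b)%R ->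
  \int[mu]_(x in D) ((f x) ^+ 2)%:E <= (a ^+ 2)%:E ->
  \int[mu]_(x in D) ((g x) ^+ 2)%:E <= (b ^+ 2)%:E ->
  \int[mu]_(x in D) (`|f x * g x|)%:E <= (a * b)%:E.
Proof.
move=> mD mf mg a0 b0 Hf Hg.
have key (h : T -> R) (c : R) : (0 <= c)%R ->
    \int[mu]_(x in D) ((h x) ^+ 2)%:E <= (c ^+ 2)%:E ->
    Lnorm mu 2%:E (EFin \o (h \_ D)) <= c%:E.
  move=> c0 H.
  rewrite unlock.
  have -> : \int[mu]_x `|(EFin \o h \_ D) x| `^ 2 = \int[mu]_(x in D) ((h x) ^+ 2)%:E.
    rewrite [RHS]integral_mkcond; apply: eq_integral => x _ /=.
    rewrite !patchE; case: ifP => _.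
      by rewrite powR_mulrn// real_normK ?num_real.
    by rewrite normr0 powR0 ?pnatr_eq0.
  rewrite -[leRHS](_ : ((c ^+ 2)%:E `^ 2^-1) = _); last first.
    by rewrite poweR_EFin -powR_mulrn// -powRrM mulfV ?pnatr_eq0// powRr1.
  by apply: gt0_ler_poweR => //; rewrite ?in_itv/= ?leey ?andbT ?integral_ge0 ?lee_fin ?invr_ge0 ?sqr_ge0// => x _; rewrite lee_fin sqr_ge0.
have Df := key f a a0 Hf; have Dg := key g b b0 Hg.
have := @hoelder _ _ _ mu (f \_ D) (g \_ D) 2 2.
rewrite Lnorm1.
have -> : \int[mu]_x `|(EFin \o (f \_ D \* g \_ D)%R) x| =
   \int[mu]_(x in D) (`|f x * g x|)%:E.
  rewrite [RHS]integral_mkcond; apply: eq_integral => x _ /=.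
  by rewrite !patchE; case: ifP => _ //; rewrite mul0r normr0.
move=> H; apply: le_trans (H _ _ _ _ _) _ => //.
- by apply/(measurable_restrictT _ _).1.
- by apply/(measurable_restrictT _ _).1.
- by rewrite [RHS]splitr !div1r.
- by rewrite EFinM lee_pmul ?Lnorm_ge0.
Qed.

End CauchySchwarz.

Section Plane.
Variable R : realType.

(** The plane has a countable base of open rectangles with rational corners,
    so its open sets lie in the product sigma-algebra. *)
Lemma open_plane_measurable (U : set (R * R)) :
  open U -> measurable (U : set (plane R)).
Proof.
move=> oU.
pose B (q : rat * rat * (rat * rat)) : set (R * R) :=
  `]ratr q.1.1, ratr q.1.2[%classic `*` `]ratr q.2.1, ratr q.2.2[%classic.
have -> : U = \bigcup_(q in [set q | B q `<=` U]) B q.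
  apply/seteqP; split => [x Ux|x [q] /= ]; last by move=> /[apply].
  have : nbhs x U by exact: open_nbhs_nbhs.
  move=> /nbhs_ballP[e /= e0 He].
  have [q1 /andP[]] := @rat_in_itvoo R (x.1 - e) x.1 ltac:(by rewrite ltrBlDr ltrDl).
  rewrite !bnd_simp => q11 q12.
  have [q2 /andP[]] := @rat_in_itvoo R x.1 (x.1 + e) ltac:(by rewrite ltrDl).
  rewrite !bnd_simp => q21 q22.
  have [q3 /andP[]] := @rat_in_itvoo R (x.2 - e) x.2 ltac:(by rewrite ltrBlDr ltrDl).
  rewrite !bnd_simp => q31 q32.
  have [q4 /andP[]] := @rat_in_itvoo R x.2 (x.2 + e) ltac:(by rewrite ltrDl).
  rewrite !bnd_simp => q41 q42.
  exists ((q1, q2), (q3, q4)).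
    move=> y [/=]; rewrite !in_itv/= => /andP[y1 y2] /andP[y3 y4].
    by apply: He; split; rewrite /ball/= ltr_norml; lra.
  by split; rewrite /= in_itv/= ?q12 ?q21 ?q32 ?q41.
rewrite bigcup_mkcond; apply: countable_bigcupT_measurable => // q.
case: ifP => // _; apply: measurableX; exact: measurable_itv.
Qed.

Lemma continuous_plane_measurable (f : R * R -> R) :
  continuous f -> measurable_fun setT (f : plane R -> R).
Proof.
move=> /continuousP cf; apply: (measurability _ (RGenOpens.measurableE R)).
move=> _ [_ [a [b ->] <-]]; rewrite setTI; apply: open_plane_measurable.
exact/cf/interval_open.
Qed.

Lemma measurable_unitI : measurable (@unitI R : set (measurableTypeR R)).
Proof. exact: measurable_itv. Qed.

Lemma measurable_Omega : measurable (Omega : set (plane R)).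
Proof. by apply: measurableX; exact: measurable_itv. Qed.

Lemma leb_unitI : (@lebesgue_measure R (@unitI R) = 1)%E.
Proof. by rewrite lebesgue_measure_itv/= lte_fin ltr01 oppr0 adde0. Qed.

Lemma leb2_Omega : (leb2 (Omega : set (plane R)) = 1)%E.
Proof.
have := product_measure1E (@lebesgue_measure R) (@lebesgue_measure R) measurable_unitI measurable_unitI.
rewrite /Omega -/unitI => ->; rewrite -[RHS]mule1; congr (_ * _)%E; exact: leb_unitI.
Qed.

End Plane.
#[global] Hint Extern 0 (measurable unitI) => exact: measurable_unitI : core.
#[global] Hint Extern 0 (measurable Omega) => exact: measurable_Omega : core.

(** * Smooth compactly supported functions *)

Section Smooth1.
Variable R : realType.
Implicit Types (f g : R -> R) (n : nat).

(** Iterated differentiability, with the derivatives as existential data: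
    closure under products and affine changes of variable is then a plain
    induction, whereas iterating [derive1] would require rewriting under it. *)
Fixpoint Cn n f : Prop :=
  if n is n'.+1 then
    exists2 f' : R -> R, (forall x : R, is_derive x (1 : R) f (f' x)) & Cn n' f'
  else True.

Lemma CnS n f : Cn n.+1 f -> Cn n f.
Proof.
elim: n f => [//|n IH] f [f' df' Cf']; exists f' => //; exact: IH.
Qed.

Lemma Cn_cst n (c : R) : Cn n (fun=> c).
Proof.
elim: n c => [//|n IH] c; exists (fun=> 0) => // x; exact: is_derive_cst.
Qed.

Lemma CnD n f g : Cn n f -> Cn n g -> Cn n (fun x => f x + g x).
Proof.
elim: n f g => [//|n IH] f g [f' df' Cf'] [g' dg' Cg'].
exists (fun x => f' x + g' x); last exact: IH.
by move=> x; exact: is_deriveD.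
Qed.

Lemma CnM n f g : Cn n f -> Cn n g -> Cn n (fun x => f x * g x).
Proof.
elim: n f g => [//|n IH] f g Cf Cg.
case: (Cf) => f' df' Cf'; case: (Cg) => g' dg' Cg'.
exists (fun x => f x * g' x + g x * f' x).
  by move=> x; exact: is_deriveM.
by apply: CnD; apply: IH => //; exact: CnS.
Qed.

Lemma Cn_affine n f (k c : R) : Cn n f -> Cn n (fun x => f (k * x + c)).
Proof.
elim: n f => [//|n IH] f [f' df' Cf'].
exists (fun x => f' (k * x + c) * k).
  move=> x; apply: is_derive1_comp.
  have := is_deriveD (is_deriveZ k (is_derive_id x (1 : R))) (is_derive_cst c x 1).
  by move=> /is_derive_eq; apply; rewrite addr0 [LHS]mulr1.
by apply: CnM; [exact: IH|exact: Cn_cst].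
Qed.

Definition smooth1 f := forall n, Cn n f.

Lemma smooth1_derive f : smooth1 f ->
  (forall x : R, is_derive x (1 : R) f (derive1 f x)) /\ smooth1 (derive1 f).
Proof.
move=> sf; split.
  move=> x; have [f' df' _] := sf 1%N.
  have -> : derive1 f x = f' x by rewrite derive1E; apply: derive_val.
  exact: df'.
move=> n; have [f' df' Cf'] := sf n.+1.
suff -> : (derive1 f) = f' by [].
by apply/funext => x; rewrite derive1E; apply: derive_val.
Qed.

Lemma smooth1_continuous f : smooth1 f -> continuous f.
Proof.
move=> sf x; apply: differentiable_continuous; apply/derivable1_diffP.
by case: ((smooth1_derive sf).1 x).
Qed.

(** Flat function at the origin, the source of compactly supported smooth
    functions: the derivatives of [expR (- x^-1)] are combinations of its
    products with powers of [x^-1], hence the exponent [k]. *)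
Definition flat k (x : R) : R := if 0 < x then x^-1 ^+ k * expR (- x^-1) else 0.

Lemma flat_ge0 k x : 0 <= flat k x.
Proof. by rewrite /flat; case: ifPn => // x0; rewrite mulr_ge0 ?expR_ge0 ?exprn_ge0 ?invr_ge0 ?ltW. Qed.

Lemma flat_le k (x : R) : flat k x <= (k.+2)`!%:R * x ^+ 2.
Proof.
rewrite /flat; case: ifPn => x0; last by rewrite mulr_ge0 ?sqr_ge0.
have y0 : 0 < x^-1 by rewrite invr_gt0.
have := expR_ge1Dxn k.+1 (ltW y0).
have -> : x = x^-1^-1 by rewrite invrK.
rewrite invrK; move: x^-1 y0 => y y0.
move=> H.
have {}H : y ^+ k.+2 / (k.+2)`!%:R <= expR y by lra.
rewrite expRN ler_pdivrMr ?expR_gt0// exprVn mulrAC ler_pdivlMr ?exprn_gt0//.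
by rewrite -exprD addn2 mulrC -ler_pdivrMr ?ltr0n ?fact_gt0.
Qed.

Lemma is_derive_flat0 f (C : R) : (forall h, `|f h| <= C * h ^+ 2) ->
  is_derive (0 : R) (1 : R) f 0.
Proof.
move=> Hf.
have f0 : f 0 = 0.
  by apply/eqP; rewrite -normr_le0; have := Hf 0; rewrite expr0n/= mulr0.
have C0 : 0 <= C by have := Hf 1; rewrite expr1n mulr1; apply: le_trans.
have H : h^-1 *: (f (h *: (1 : R) + 0) - f 0) @[h --> 0^'] --> (0 : R).
  apply/cvgrPdist_le => e e0; near=> h.
  have h0 : h != 0 by near: h; exact: nbhs_dnbhs_neq.
  rewrite f0 subr0 addr0 sub0r normrN [h *: 1]mulr1 normrM normfV.
  rewrite ler_pdivrMl ?normr_gt0//; apply: (le_trans (Hf h)).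
  rewrite -[h ^+ 2]real_normK ?num_real// expr2 mulrA mulrC ler_wpM2l//.
  have : `|h| <= e / (C + 1).
    near: h; apply: nbhs_dnbhs.
    have : 0 < e / (C + 1) by rewrite divr_gt0// ltr_wpDl.
    by move=> ?; exact: (@nbhs0_le R R^o).
  rewrite ler_pdivlMr ?ltr_wpDl// => He.
  by apply: le_trans He; rewrite mulrC ler_wpM2l// lerDl.
apply: DeriveDef; first by apply/cvg_ex; exists 0.
exact/cvg_lim.
Unshelve. all: by end_near. Qed.

Lemma is_derive_flat k (x : R) :
  is_derive x (1 : R) (flat k) (- (k%:R) * flat k.+1 x + flat k.+2 x).
Proof.
have [x0|x0|->] := ltgtP x 0.
- apply: (@near_eq_is_derive _ _ _ (fun=> 0)).
    near=> y; rewrite /flat ltNge.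
    have -> // : y <= 0.
    by near: y; exact: lt_le_nbhsl.
  by rewrite /flat ltNge (ltW x0)/= mulr0 add0r; exact: is_derive_cst.
- apply: (@near_eq_is_derive R R^o R^o (fun y : R => y^-1 ^+ k * expR (- y^-1))).
    near=> y; rewrite /flat.
    have -> // : 0 < y.
    by near: y; exact: lt_nbhsr.
  have xn0 : x != 0 by rewrite gt_eqF.
  have dV : is_derive x (1 : R) (fun y : R => y^-1) (- x^-2).
    have := @is_deriveV _ (id : R -> R) x 1 1 xn0 (is_derive_id _ _).
    by move=> /is_derive_eq; apply; rewrite [LHS]mulr1.
  have := is_deriveX k dV; rewrite exprfctE => dX.
  have dE : is_derive x (1 : R) (fun y => expR (- y^-1)) (expR (- x^-1) * (x^-2)).
    apply: (@is_derive1_comp _ expR (fun y => - y^-1)).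
    by rewrite -[X in is_derive _ _ _ X]opprK; apply: is_deriveN.
  have H : is_derive x (1 : R) (fun y : R => y^-1 ^+ k * expR (- y^-1))
      (x^-1 ^+ k *: (expR (- x^-1) * x^-2) +
       expR (- x^-1) *: ((k%:R * x^-1 ^+ k.-1) *: - x^-2)).
    exact: is_deriveM dX dE.
  rewrite [X in is_derive _ _ _ X](_ : _ = x^-1 ^+ k *: (expR (- x^-1) * x^-2) +
    expR (- x^-1) *: ((k%:R * x^-1 ^+ k.-1) *: - x^-2)); first exact: H.
  rewrite /flat x0 /GRing.scale/= -!exprVn.
  by case: k {dX H} => [|k]; rewrite ?mulr0n ?mul0r /= ?exprS; ring.
- have -> : - k%:R * flat k.+1 0 + flat k.+2 0 = 0 by rewrite /flat ltxx mulr0 addr0.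
  by apply: (@is_derive_flat0 _ (k.+2)`!%:R) => h; rewrite ger0_norm ?flat_ge0 ?flat_le.
Unshelve. all: by end_near. Qed.

Lemma smooth1_flat k : smooth1 (flat k).
Proof.
move=> n; elim: n k => [//|n IH] k.
exists (fun x => - (k%:R) * flat k.+1 x + flat k.+2 x); first exact: is_derive_flat.
by apply: CnD => //; apply: CnM => //; exact: Cn_cst.
Qed.

Lemma flat0_le1 x : flat 0 x <= 1.
Proof.
rewrite /flat; case: ifPn => // x0; rewrite expr0 mul1r -expR0 ler_expR.
by rewrite oppr_le0 invr_ge0 ltW.
Qed.

(** A mollified indicator of [`]a, b[]: it tends to 1 inside the
    interval, while its support keeps the distance [1 / (n + 1)] from the
    endpoints. *)
Definition bump (a b : R) (n : nat) (x : R) : R :=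
  flat 0 (n.+1%:R * (x - a) - 1) * flat 0 (n.+1%:R * (b - x) - 1).

Lemma smooth1_bump a b n : smooth1 (bump a b n).
Proof.
move=> m; apply: CnM.
- have := @Cn_affine m (flat 0) n.+1%:R (- n.+1%:R * a - 1) (smooth1_flat 0 m).
  by congr Cn; apply/funext => x; congr flat; ring.
- have := @Cn_affine m (flat 0) (- n.+1%:R) (n.+1%:R * b - 1) (smooth1_flat 0 m).
  by congr Cn; apply/funext => x; congr flat; ring.
Qed.

Lemma bump_ge0 a b n x : 0 <= bump a b n x.
Proof. by rewrite mulr_ge0 ?flat_ge0. Qed.

Lemma bump_le1 a b n x : bump a b n x <= 1.
Proof. by rewrite mulr_ile1 ?flat_ge0 ?flat0_le1. Qed.

Lemma bump_support (a b : R) n (x : R) :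
  ~ (a + n.+1%:R^-1 <= x <= b - n.+1%:R^-1) -> bump a b n x = 0.
Proof.
have n0 : (0 : R) < n.+1%:R by [].
move=> /negP; rewrite negb_and -!ltNge => /orP[H|H]; rewrite /bump /flat.
- rewrite ltNge (_ : _ <= 0) ?mul0r// subr_le0 mulrC -ler_pdivlMr// div1r.
  by move: (n.+1%:R^-1) H => t H; lra.
- rewrite [X in _ * (if X then _ else _)]ltNge (_ : _ <= 0) ?mulr0//.
  rewrite subr_le0 mulrC -ler_pdivlMr// div1r.
  by move: (n.+1%:R^-1) H => t H; lra.
Qed.

Lemma cvg_flat_lin (d : R) : 0 < d ->
  flat 0 (n.+1%:R * d - 1) @[n --> \oo] --> (1 : R).
Proof.
move=> d0.
have H : n.+1%:R * d - 1 @[n --> \oo] --> +oo.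
  apply/cvgryPge => A; near=> n.
  rewrite lerBrDr -ler_pdivrMr//.
  apply: (@le_trans _ _ n%:R); last by rewrite ler_nat.
  near: n; exact: nbhs_infty_ger.
have H3 : - (n.+1%:R * d - 1)^-1 @[n --> \oo] --> (0 : R).
  rewrite -oppr0; apply: cvgN; apply/gtr0_cvgV0 => //.
  by near=> n; near: n; move/cvgryPgt : H; apply.
have H2 := continuous_cvg _ (@continuous_expR R 0) H3.
rewrite -[X in _ --> X](@expR0 R).
apply: cvg_trans (H2 _); apply: near_eq_cvg; near=> n.
rewrite /flat expr0 mul1r.
have -> // : 0 < n.+1%:R * d - 1.
by near: n; move/cvgryPgt : H; apply.
Unshelve. all: by end_near. Qed.

Lemma cvg_bump (a b x : R) :
  bump a b n x @[n --> \oo] --> (\1_(`]a, b[%classic) x : R).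
Proof.
rewrite indicE; have [] := boolP (x \in `]a, b[%classic).
  rewrite inE/= in_itv/= => /andP[ax xb]; rewrite -[true%:R]mulr1.
  by apply: cvgM; apply: cvg_flat_lin; rewrite subr_gt0.
rewrite notin_setE/= in_itv/= => /negP H.
apply: cvg_near_cst; near=> n; apply: bump_support.
move=> /andP[H1 H2]; move: H; apply/negP; rewrite negbK.
have n0 : (0 : R) < n.+1%:R^-1 by rewrite invr_gt0.
by rewrite (lt_le_trans _ H1) ?ltrDl// (le_lt_trans H2)// ltrBlDr ltrDl.
Unshelve. all: by end_near. Qed.

End Smooth1.

Section TestFunctions.
Variable R : realType.

(** One-dimensional test functions on the unit interval; the bounds [a], [b]
    are those of an interval containing the support. *)
Definition test1 (g : R -> R) : Prop :=
  smooth1 g /\ exists a b : R, [/\ 0 < a, b < 1 & forall x, ~ (a <= x <= b) -> g x = 0].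

Lemma test1_bump (a b : R) n : 0 <= a -> b <= 1 -> test1 (bump a b n).
Proof.
move=> a0 b1; split; first exact: smooth1_bump.
have n0 : 0 < (n.+1%:R : R)^-1 by rewrite invr_gt0.
exists (a + n.+1%:R^-1), (b - n.+1%:R^-1); split.
- by rewrite ltr_wpDl.
- by rewrite ltrBlDr (le_lt_trans b1)// ltrDl.
- by move=> x; exact: bump_support.
Qed.

(** A directional derivative along a coordinate axis only sees the restriction
    to a line, which reduces partial derivatives to one variable. *)
Lemma is_derive_section1 (F : R * R -> R) (x : R * R) (d : R) :
  is_derive x.1 (1 : R) (fun t => F (t, x.2)) d -> is_derive x (1, 0) F d.
Proof.
have E : (fun h : R => h^-1 *: ((F \o shift x) (h *: ((1, 0) : R * R)) - F x)) =
   (fun h : R => h^-1 *: (((fun t => F (t, x.2)) \o shift x.1) (h *: (1 : R)) - F (x.1, x.2))).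
  apply/funext => h; case: x => x1 x2 /=; congr (_ *: (F _ - _)).
  by congr pair; rewrite /= scaler0 add0r.
move=> [df vf]; apply: DeriveDef; first by rewrite /derivable E.
by rewrite -vf /derive E.
Qed.

Lemma is_derive_section2 (F : R * R -> R) (x : R * R) (d : R) :
  is_derive x.2 (1 : R) (fun t => F (x.1, t)) d -> is_derive x (0, 1) F d.
Proof.
have E : (fun h : R => h^-1 *: ((F \o shift x) (h *: ((0, 1) : R * R)) - F x)) =
   (fun h : R => h^-1 *: (((fun t => F (x.1, t)) \o shift x.2) (h *: (1 : R)) - F (x.1, x.2))).
  apply/funext => h; case: x => x1 x2 /=; congr (_ *: (F _ - _)).
  by congr pair; rewrite /= scaler0 add0r.
move=> [df vf]; apply: DeriveDef; first by rewrite /derivable E.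
by rewrite -vf /derive E.
Qed.

(** Products of one-variable test functions are the only test functions that
    the analysis of weak gradients below needs. *)
Definition tensor (g1 g2 : R -> R) (x : R * R) : R := g1 x.1 * g2 x.2.

Lemma is_derive_tensor1 (g1 g2 : R -> R) (x : R * R) : smooth1 g1 ->
  is_derive x (unit_vec ord0) (tensor g1 g2) (tensor (derive1 g1) g2 x).
Proof.
move=> s1; rewrite /unit_vec eqxx; apply: is_derive_section1.
have := is_deriveM ((smooth1_derive s1).1 x.1) (is_derive_cst (g2 x.2) x.1 (1 : R)).
move=> H; rewrite [X in is_derive _ _ _ X](_ : _ =
  g1 x.1 *: 0 + cst (g2 x.2) x.1 *: (derive1 g1) x.1); first exact: H.
by rewrite scaler0 add0r /tensor [RHS]mulrC.
Qed.

Lemma is_derive_tensor2 (g1 g2 : R -> R) (x : R * R) : smooth1 g2 ->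
  is_derive x (unit_vec (ord_max : 'I_2)) (tensor g1 g2) (tensor g1 (derive1 g2) x).
Proof.
move=> s1; rewrite /unit_vec /=; apply: is_derive_section2.
have := is_deriveM (is_derive_cst (g1 x.1) x.2 (1 : R)) ((smooth1_derive s1).1 x.2).
move=> H; rewrite [X in is_derive _ _ _ X](_ : _ =
  cst (g1 x.1) x.2 *: (derive1 g2) x.2 + g2 x.2 *: 0); first exact: H.
by rewrite scaler0 addr0.
Qed.

Lemma pderiv_tensor (j : 'I_2) (g1 g2 : R -> R) : smooth1 g1 -> smooth1 g2 ->
  pderiv j (tensor g1 g2) =
  if j == ord0 then tensor (derive1 g1) g2 else tensor g1 (derive1 g2).
Proof.
move=> s1 s2; apply/funext => x; rewrite /pderiv.
have [->|] := eqVneq j ord0.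
  by have := is_derive_tensor1 g2 x s1 => H; apply: derive_val.
case: j => -[//|[|//]] i _ /=.
have -> : Ordinal i = ord_max by apply/val_inj.
by have := is_derive_tensor2 g1 x s2 => H; apply: derive_val.
Qed.

Lemma continuous_tensor (g1 g2 : R -> R) : smooth1 g1 -> smooth1 g2 ->
  continuous (tensor g1 g2).
Proof.
move=> s1 s2 x; apply: continuousM.
- apply: (@continuous_comp _ _ _ fst g1); first exact: cvg_fst.
  exact: smooth1_continuous.
- apply: (@continuous_comp _ _ _ snd g2); first exact: cvg_snd.
  exact: smooth1_continuous.
Qed.

Lemma smooth_tensor (g1 g2 : R -> R) : smooth1 g1 -> smooth1 g2 ->
  smooth (tensor g1 g2).
Proof.
move=> s1 s2 w.
have [g1' [g2' [s1' s2' ->]]] : exists g1' g2', [/\ smooth1 g1', smooth1 g2' &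
    foldr pderiv (tensor g1 g2) w = tensor g1' g2'].
  elim: w => [|j w [g1' [g2' [s1' s2' E]]]]; first by exists g1, g2.
  rewrite /= E pderiv_tensor//; case: ifP => _.
    by exists (derive1 g1'), g2'; split => //; exact: (smooth1_derive s1').2.
  by exists g1', (derive1 g2'); split => //; exact: (smooth1_derive s2').2.
split; first exact: continuous_tensor.
move=> j x; have [->|] := eqVneq j ord0.
  by case: (is_derive_tensor1 g2' x s1').
case: j => -[//|[|//]] i _.
have -> : Ordinal i = ord_max by apply/val_inj.
by case: (is_derive_tensor2 g1' x s2').
Qed.

Lemma test_tensor (g1 g2 : R -> R) : test1 g1 -> test1 g2 ->
  test_function (tensor g1 g2).
Proof.
move=> [s1 [a1 [b1 [a10 b11 H1]]]] [s2 [a2 [b2 [a20 b21 H2]]]].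
split; first exact: smooth_tensor.
exists (`[a1, b1]%classic `*` `[a2, b2]%classic); split.
- by apply: compact_setX; exact: segment_compact.
- move=> x [/=]; rewrite !in_itv/= => /andP[x1 x2] /andP[x3 x4].
  by split; rewrite /= in_itv/=; apply/andP; split; lra.
- move=> x H; rewrite /tensor.
  have [h1|h1] := boolP (a1 <= x.1 <= b1); last by rewrite H1 ?mul0r//; exact/negP.
  have [h2|h2] := boolP (a2 <= x.2 <= b2); last by rewrite H2 ?mulr0//; exact/negP.
  by exfalso; apply: H; split; rewrite /= in_itv.
Qed.

End TestFunctions.

(** * The fundamental lemma of the calculus of variations *)

Section Integrability.
Context d (T : measurableType d) (R : realType).
Variable mu : {measure set T -> \bar R}.

Lemma integrable_measurable (D : set T) (f : T -> R) :
  mu.-integrable D (EFin \o f) -> measurable_fun D f.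
Proof. by move=> /integrableP[/measurable_EFinP]. Qed.

Lemma integrable_mulb (D : set T) (f k : T -> R) (C : R) :
  measurable D -> mu.-integrable D (EFin \o f) -> measurable_fun D k ->
  (forall x, D x -> `|k x| <= C) ->
  mu.-integrable D (EFin \o (fun x => f x * k x)).
Proof.
move=> mD fi mk kC.
have mf := integrable_measurable fi.
have Cfi : mu.-integrable D (EFin \o (fun x => C * f x)).
  rewrite (_ : _ \o _ = fun x => (C%:E * (EFin \o f) x)%E); last by apply/funext.
  exact: integrableZl.
apply: le_integrable Cfi => //.
  by apply/measurable_EFinP; exact: measurable_funM.
move=> x Dx /=; rewrite lee_fin !normrM mulrC ler_wpM2r//.
by apply: (le_trans (kC x Dx)); exact: ler_norm.
Qed.

Lemma ae_eq_Rintegral (D : set T) (f g : T -> R) : measurable D ->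
  measurable_fun D f -> measurable_fun D g ->
  {ae mu, forall x, D x -> f x = g x} ->
  (\int[mu]_(x in D) f x = \int[mu]_(x in D) g x)%R.
Proof.
move=> mD mf mg f0; rewrite /Rintegral; congr fine.
apply: ae_eq_integral => //; try exact/measurable_EFinP.
by apply: filterS f0 => x + Dx => /(_ Dx) /= ->.
Qed.

End Integrability.

Section FundamentalLemma.
Variable R : realType.
Notation mu := (@lebesgue_measure R).
Implicit Type g : R -> R.

(** A countable family of test functions already separates integrable
    functions; countability lets an almost-everywhere statement be quantified
    over the family. *)
Definition fam (k : nat) : R -> R :=
  if unpickle k is Some q then
    if (0 <= (ratr q.1.1 : R)) && ((ratr q.1.2 : R) <= 1)
    then bump (ratr q.1.1) (ratr q.1.2) q.2 else fun=> 0
  else fun=> 0.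

Lemma test1_0 : test1 (fun=> 0 : R).
Proof.
split; first by move=> n; exact: Cn_cst.
by exists (2^-1), (2^-1); split => //; lra.
Qed.

Lemma test1_fam k : test1 (fam k).
Proof.
rewrite /fam; case: unpickle => [q|]; last exact: test1_0.
by case: ifPn => [/andP[]|_]; [exact: test1_bump|exact: test1_0].
Qed.

Lemma fam_bound k x : `|fam k x| <= 1.
Proof.
rewrite /fam; case: unpickle => [q|]; last by rewrite normr0.
by case: ifPn => [_|_]; rewrite ?normr0// ger0_norm ?bump_ge0 ?bump_le1.
Qed.

Lemma fam_rat (a b : rat) n : 0 <= (ratr a : R) -> (ratr b : R) <= 1 ->
  exists k, fam k = bump (ratr a) (ratr b) n.
Proof. by move=> a0 b1; exists (pickle (a, b, n)); rewrite /fam pickleK /= a0 b1. Qed.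

Lemma measurable_smooth1 g (D : set (measurableTypeR R)) : measurable D -> smooth1 g -> measurable_fun D g.
Proof.
by move=> mD sg; apply: measurable_funTS; apply: continuous_measurable_fun; exact: smooth1_continuous.
Qed.

Lemma cvg_integral_bump g (a b : R) : mu.-integrable unitI (EFin \o g) ->
  0 <= a -> b <= 1 ->
  (\int[mu]_(x in unitI) (g x * bump a b n x)%R%:E)%E @[n --> \oo] -->
  (\int[mu]_(x in `]a, b[) (g x)%:E)%E.
Proof.
move=> gi a0 b1.
have mg := integrable_measurable gi.
pose f_ (n : nat) := EFin \o (fun x => g x * bump a b n x).
pose f := EFin \o (fun x => g x * \1_(`]a, b[%classic) x).
have mf_ n : measurable_fun unitI (f_ n).
  apply/measurable_EFinP/measurable_funM => //.
  by apply: measurable_smooth1 => //; exact: smooth1_bump.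
have mf : measurable_fun unitI f.
  by apply/measurable_EFinP/measurable_funM => //; exact: measurable_indic.
have f_f : {ae mu, forall x, unitI x -> f_ ^~ x @ \oo --> f x}.
  apply: aeW => x _; apply/fine_cvgP; split; first by near=> n.
  by apply: (@cvgM R^o) => //; [exact: cvg_cst|exact: cvg_bump].
have ig : mu.-integrable unitI (fun x => `|(g x)%:E|%E) by exact: integrable_abse.
have f_g : {ae mu, forall x n, unitI x -> (`|f_ n x| <= `|(g x)%:E|)%E}.
  apply: aeW => x n _; rewrite /= lee_fin normrM ler_piMr//.
  by rewrite ger0_norm ?bump_ge0 ?bump_le1.
have [_ _ L] := dominated_convergence (@measurable_unitI R) mf_ mf f_f ig f_g.
apply: cvg_trans L _; rewrite (_ : (\int[mu]_(x in unitI) f x)%E =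
   (\int[mu]_(x in `]a, b[) (g x)%:E)%E) //.
rewrite [LHS]integral_mkcond [RHS]integral_mkcond; apply: eq_integral => x _ /=.
rewrite !patchE /f /= indicE.
have [xab|xab] := boolP (x \in `]a, b[%classic).
  rewrite ifT ?mulr1//; move: xab; rewrite !inE unitIE /= in_itv/= => /andP[ax xb].
  by rewrite (le_lt_trans a0)// (lt_le_trans xb).
by rewrite mulr0; case: ifP.
Unshelve. all: by end_near. Qed.

(** The integrals of [g] over intervals with rational endpoints are limits of
    integrals against the family, hence vanish; the primitive of [g] is then
    zero on the rationals, zero by continuity, and its derivative is [g]
    almost everywhere. *)
Lemma fundamental_lemma1 g : mu.-integrable unitI (EFin \o g) ->
  (forall k, \int[mu]_(x in unitI) (g x * fam k x) = 0)%R ->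
  {ae mu, forall x, unitI x -> g x = 0}.
Proof.
move=> gi H.
have mg := integrable_measurable gi.
have zero_rat (q : rat) : ratr q <= (1 : R) -> (\int[mu]_(x in `]0%R, ratr q[) (g x)%:E = 0)%E.
  move=> q1.
  have := @cvg_integral_bump g 0 (ratr q) gi (lexx _) q1.
  rewrite (_ : (fun n => _) = fun=> 0%E).
    by move=> /cvg_unique; move=> /(_ _ _ (cvg_cst _)) <-.
  apply/funext => n; have [|k Ek] := @fam_rat 0%Q q n _ q1; first by rewrite rmorph0.
  have := H k; rewrite Ek rmorph0 /Rintegral => /eqP.
  rewrite fine_eq0; first by move=> /eqP.
  apply: integrable_fin_num => //; apply: (integrable_mulb (C := 1)) => //.
    by apply: measurable_smooth1 => //; exact: smooth1_bump.
  by move=> x _; rewrite ger0_norm ?bump_ge0 ?bump_le1.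
pose f := g \_ unitI.
have fi : mu.-integrable setT (EFin \o f).
  by rewrite /f -restrict_EFin; apply/integrable_restrict => //; rewrite setTI.
pose F (x : R) := (\int[mu]_(t in `]-oo, x]) f t)%R.
have FE (x : R) : F x = parameterized_integral mu 0 x f.
  rewrite /F /parameterized_integral Rintegral_mkcond [RHS]Rintegral_mkcond.
  apply: eq_Rintegral => t _; rewrite /f !patchE !mem_setE !in_itv/=.
  by case: (t <= x); rewrite ?andbT ?andbF//; case: (leP 0 t) => //= t0; rewrite ltNge (ltW t0).
have F0rat (q : rat) : 0 < (ratr q : R) < 1 -> F (ratr q) = 0.
  move=> /andP[q0 q1]; rewrite FE /parameterized_integral.
  rewrite -Rintegral_itv_obnd_cbnd; last by exact: integrableS fi.
  rewrite -Rintegral_itv_bndo_bndc; last by exact: integrableS fi.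
  transitivity (\int[mu]_(t in `]0, (ratr q)[) g t); last by rewrite /Rintegral zero_rat// ltW.
  apply: eq_Rintegral => t; rewrite inE/= in_itv/= => /andP[t0 tq].
  by rewrite /f patchE mem_set// unitIE t0 (lt_trans tq).
have F0 (x : R) : 0 < x < 1 -> F x = 0.
  move=> /andP[x0 x1].
  have fi01 : mu.-integrable `[0, 1] (EFin \o f) by exact: integrableS fi.
  have := @parameterized_integral_continuous R 0 1 f ler01 fi01.
  move=> /(continuous_within_itvP _ ltr01)[cF _ _].
  have {}cF : {for x, continuous F}.
    rewrite (_ : F = (fun x => parameterized_integral mu 0 x f)); last exact/funext.
    by apply: cF; rewrite in_itv/= x0.
  apply: contrapT => /eqP Fx0.
  have : \forall y \near x, F y != 0 /\ 0 < y < 1.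
    near=> y; split; first by near: y; exact: (cvgr_neq0 _ cF Fx0).
    by apply/andP; split; near: y; [exact: lt_nbhsr|exact: lt_nbhsl].
  move=> /nbhs_ballP[e /= e0 He].
  have [q /andP[]] := @rat_in_itvoo R x (x + e) ltac:(by rewrite ltrDl).
  rewrite !bnd_simp => q1 q2.
  have [|Fq q01] := He (ratr q); first by rewrite /ball/= ltr_norml; apply/andP; split; lra.
  by rewrite F0rat ?eqxx in Fq.
have fiy (y : R) : mu.-integrable `]-oo, y] (EFin \o f) by exact: integrableS fi.
have lf : locally_integrable [set: R] f.
  by apply: open_integrable_locally => //; exact: openT.
have := @FTC1Ny R f fiy lf; apply: filterS; first exact: (ae_filter_ringOfSetsType mu).
move=> x [_ Fx] x01.
move: (x01); rewrite unitIE => /andP[x0 x1].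
have <- : f x = g x by rewrite /f patchE mem_set.
rewrite -Fx derive1E.
rewrite (@near_eq_derive R R^o R^o _ (cst 0)) ?derive_cst ?oner_neq0//.
near=> y; apply: F0; apply/andP; split; near: y.
  exact: lt_nbhsr.
exact: lt_nbhsl.
Unshelve. all: by end_near. Qed.
End FundamentalLemma.

Section AeImp.
Context d (T : measurableType d) (R : realType).
Variable mu : {measure set T -> \bar R}.

Lemma ae_imp (P Q : T -> Prop) : {ae mu, forall x, P x} ->
  (forall x, P x -> Q x) -> {ae mu, forall x, Q x}.
Proof.
move=> [N [mN N0 PN]] PQ; exists N; split => //.
by apply: subset_trans PN => x /= nQ Px; apply: nQ; exact: PQ.
Qed.

Lemma ae_imp2 (P P' Q : T -> Prop) : {ae mu, forall x, P x} ->
  {ae mu, forall x, P' x} ->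
  (forall x, P x -> P' x -> Q x) -> {ae mu, forall x, Q x}.
Proof.
move=> H H' PQ; have : {ae mu, forall x, P x /\ P' x} by exact: filterI.
by move=> /ae_imp; apply => x []; exact: PQ.
Qed.

End AeImp.

Section TonelliOmega.
Variable R : realType.
Notation mu := (@lebesgue_measure R).
Local Open Scope ereal_scope.

Lemma tonelliO1 (f : plane R -> \bar R) : measurable_fun setT f -> (forall x, 0 <= f x) ->
  \int[leb2]_(x in Omega) f x =
  \int[mu]_(x1 in unitI) \int[mu]_(x2 in unitI) f (x1, x2).
Proof. by move=> mf f0; exact: tonelliD1. Qed.

Lemma tonelliO2 (f : plane R -> \bar R) : measurable_fun setT f -> (forall x, 0 <= f x) ->
  \int[leb2]_(x in Omega) f x =
  \int[mu]_(x2 in unitI) \int[mu]_(x1 in unitI) f (x1, x2).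
Proof. by move=> mf f0; exact: tonelliD2. Qed.

Lemma fubiniO1 (f : plane R -> \bar R) : leb2.-integrable (Omega : set (plane R)) f ->
  \int[leb2]_(x in Omega) f x =
  \int[mu]_(x1 in unitI) \int[mu]_(x2 in unitI) f (x1, x2).
Proof. by move=> fi; exact: fubiniD1. Qed.

Lemma fubiniO2 (f : plane R -> \bar R) : leb2.-integrable (Omega : set (plane R)) f ->
  \int[leb2]_(x in Omega) f x =
  \int[mu]_(x2 in unitI) \int[mu]_(x1 in unitI) f (x1, x2).
Proof. by move=> fi; exact: fubiniD2. Qed.

Lemma measurable_tonelliO1 (f : plane R -> \bar R) : measurable_fun setT f ->
  (forall x, 0 <= f x) ->
  measurable_fun setT (fun x1 : measurableTypeR R => \int[mu]_(x2 in unitI) f (x1, x2)).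
Proof. by move=> mf f0; exact: measurable_tonelliF. Qed.

Lemma measurable_tonelliO2 (f : plane R -> \bar R) : measurable_fun setT f ->
  (forall x, 0 <= f x) ->
  measurable_fun setT (fun x2 : measurableTypeR R => \int[mu]_(x1 in unitI) f (x1, x2)).
Proof. by move=> mf f0; exact: measurable_tonelliG. Qed.

End TonelliOmega.

Section Swap.
Variable R : realType.
Notation mu := (@lebesgue_measure R).

Lemma Omega_swap (x : R * R) : Omega (swap x) = Omega x.
Proof. by case: x => a b; apply/propext; split => -[/=]. Qed.

Lemma measurable_swapO (f : R * R -> R) :
  measurable_fun (Omega : set (plane R)) f ->
  measurable_fun (Omega : set (plane R)) (f \o swap).
Proof.
move=> mf; apply: (measurable_comp (F := Omega : set (plane R))) => //.
- by move=> _ [x Ox <-]; rewrite Omega_swap.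
- by apply: measurable_funTS; exact: measurable_swap.
Qed.

Lemma integral_swap_ge0 (f : R * R -> \bar R) :
  (forall x, 0 <= f x)%E -> measurable_fun (Omega : set (plane R)) f ->
  (\int[leb2]_(x in Omega) f (swap x) = \int[leb2]_(x in Omega) f x)%E.
Proof.
move=> f0 mf; pose w : plane R -> \bar R := f \_ Omega.
have mw : measurable_fun setT w by apply/(measurable_restrictT _ _).1.
have w0 x : (0 <= w x)%E by rewrite /w patchE; case: ifP.
transitivity (\int[leb2]_(x in Omega) w (swap x))%E.
  by apply: eq_integral => x; rewrite inE => xO; rewrite /w patchE mem_set// Omega_swap.
transitivity (\int[leb2]_(x in Omega) w x)%E; last first.
  by apply: eq_integral => x xO; rewrite /w patchE xO.
rewrite (tonelliO1 (f := fun x => w (swap x)))//.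
  by rewrite (tonelliO2).
by apply: measurableT_comp => //; exact: measurable_swap.
Qed.

Variable f : R * R -> R.
Hypothesis fi : leb2.-integrable (Omega : set (plane R)) (EFin \o f).

Lemma integrable_swap : leb2.-integrable (Omega : set (plane R)) (EFin \o (f \o swap)).
Proof.
case/integrableP: (fi) => mf foo.
apply/integrableP; split.
  by apply/measurable_EFinP; apply: measurable_swapO; exact/measurable_EFinP.
by have := integral_swap_ge0 (f := abse \o (EFin \o f)) => /= ->//; exact: measurableT_comp.
Qed.

Lemma Rintegral_swap :
  (\int[leb2]_(x in Omega) f (swap x) = \int[leb2]_(x in Omega) f x)%R.
Proof.
congr fine.
have := integrable_swap => fsi.
rewrite (fubiniO1 fsi).
by rewrite (fubiniO2 fi).
Qed.

End Swap.

Section FubiniR.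
Variable R : realType.
Notation mu := (@lebesgue_measure R).

Variable f : R * R -> R.
Hypothesis fi : leb2.-integrable (Omega : set (plane R)) (EFin \o f).

Let g : plane R -> \bar R := (EFin \o f) \_ Omega.

Let gi : leb2.-integrable (setT : set (plane R)) g.
Proof. by apply/integrable_restrict => //; rewrite ?setTI. Qed.

Let gE1 x1 : unitI x1 -> (fun x2 => g (x1, x2)) = (fun x2 => (f (x1, x2))%:E) \_ unitI.
Proof.
move=> Ix1; apply/funext => x2; rewrite /g !patchE.
have -> // : ((x1, x2) \in Omega) = (x2 \in unitI).
by apply/idP/idP; rewrite !inE; [case|split].
Qed.

Lemma section_integrable1 : {ae mu, forall x1, unitI x1 ->
  mu.-integrable unitI (EFin \o (fun x2 => f (x1, x2)))}.
Proof.
have := ae_integrable1 gi; apply: filterS => x1 H Ix1.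
by rewrite -[X in _.-integrable X _]setTI; apply/integrable_restrict => //; move: H; rewrite gE1.
Qed.

Lemma inner_integrable1 :
  mu.-integrable unitI (EFin \o (fun x1 => \int[mu]_(x2 in unitI) f (x1, x2)))%R.
Proof.
have := integrable_fubini_F gi => H.
have {}H : mu.-integrable unitI (fubini_F mu g) by exact: integrableS H.
have mH := measurable_int _ H.
have E x1 : unitI x1 ->
    fubini_F mu g x1 = (\int[mu]_(x2 in unitI) (f (x1, x2))%:E)%E.
  by move=> Ix1; rewrite /fubini_F gE1// -integral_mkcond.
apply: le_integrable H => //.
  apply/measurable_EFinP; rewrite /Rintegral.
  apply: (eq_measurable_fun (fine \o fubini_F mu g)).
    by move=> x1 /[!inE] Ix1 /=; rewrite E.
  exact: measurableT_comp.
move=> x1 Ix1 /=; rewrite /Rintegral -E//.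
by case: (fubini_F mu g x1) => [r|//|//]; rewrite /= ?normr0 ?leey.
Qed.

Lemma fubiniR1 : (\int[leb2]_(x in Omega) f x =
  \int[mu]_(x1 in unitI) \int[mu]_(x2 in unitI) f (x1, x2))%R.
Proof.
rewrite {1}/Rintegral (fubiniO1)//.
rewrite [RHS]/Rintegral; congr fine.
apply: ae_eq_integral => //.
- have := integrable_fubini_F gi => H.
  have {}H : mu.-integrable unitI (fubini_F mu g) by exact: integrableS H.
  apply: eq_measurable_fun (measurable_int _ H) => x1 /[!inE] Ix1.
  by rewrite /fubini_F gE1// -integral_mkcond.
- exact: measurable_int inner_integrable1.
- apply: (ae_imp section_integrable1) => x1 H Ix1.
  have /fineK : (\int[mu]_(x2 in unitI) (f (x1, x2))%:E)%E \is a fin_num.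
    by apply: integrable_fin_num => //; exact: H.
  by rewrite /Rintegral => ->.
Qed.

End FubiniR.

Section Fubini2.
Variable R : realType.
Notation mu := (@lebesgue_measure R).
Variable f : R * R -> R.
Hypothesis fi : leb2.-integrable (Omega : set (plane R)) (EFin \o f).

Lemma section_integrable2 : {ae mu, forall x2, unitI x2 ->
  mu.-integrable unitI (EFin \o (fun x1 => f (x1, x2)))}.
Proof. exact: section_integrable1 (integrable_swap fi). Qed.

Lemma inner_integrable2 :
  mu.-integrable unitI (EFin \o (fun x2 => \int[mu]_(x1 in unitI) f (x1, x2)))%R.
Proof. exact: inner_integrable1 (integrable_swap fi). Qed.

Lemma fubiniR2 : (\int[leb2]_(x in Omega) f x =
  \int[mu]_(x2 in unitI) \int[mu]_(x1 in unitI) f (x1, x2))%R.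
Proof.
by rewrite -(Rintegral_swap fi) (fubiniR1 (integrable_swap fi)).
Qed.

End Fubini2.

Lemma measurable_tensor (R : realType) (g1 g2 : R -> R) (D : set (plane R)) :
  measurable D -> smooth1 g1 -> smooth1 g2 -> measurable_fun D (tensor g1 g2).
Proof.
move=> mD s1 s2; apply: measurable_funTS.
by apply: continuous_plane_measurable; exact: continuous_tensor.
Qed.

Lemma test1_bounded (R : realType) (g : R -> R) : test1 g ->
  exists2 C, 0 <= C & forall x, `|g x| <= C.
Proof.
move=> [sg [a [b [a0 b1 gz]]]].
have cg : {within `[a, b], continuous g}.
  by apply: continuous_subspaceT => x; exact: smooth1_continuous.
have [M [_ HM]] := compact_bounded (continuous_compact cg (@segment_compact _ a b)).
exists (`|M| + 1) => [|x]; first by rewrite addr_ge0.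
have [xab|xab] := boolP (a <= x <= b).
  apply: HM; first by rewrite (le_lt_trans (ler_norm _))// ltrDl.
  by exists x => //; rewrite /= in_itv.
by rewrite gz ?normr0 ?addr_ge0//; exact/negP.
Qed.

Section FundamentalLemma2.
Variable R : realType.
Notation mu := (@lebesgue_measure R).

Lemma tensor_integrable (v : R * R -> R) (g1 g2 : R -> R) :
  leb2.-integrable (Omega : set (plane R)) (EFin \o v) -> test1 g1 -> test1 g2 ->
  leb2.-integrable (Omega : set (plane R)) (EFin \o (fun x => v x * tensor g1 g2 x)).
Proof.
move=> vi t1 t2; have [C1 C10 H1] := test1_bounded t1; have [C2 C20 H2] := test1_bounded t2.
apply: (integrable_mulb (C := C1 * C2)) => //.
  by apply: measurable_tensor => //; [exact: t1.1|exact: t2.1].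
by move=> x _; rewrite normrM ler_pM.
Qed.

(** The one-dimensional lemma is applied twice.  Integrating out one variable
    first gives, for every member of the countable family, a function of the
    other variable that vanishes almost everywhere; countability makes the
    exceptional set common to the family. *)
Lemma fundamental_lemma2 (v : R * R -> R) :
  leb2.-integrable (Omega : set (plane R)) (EFin \o v) ->
  (forall g1 g2, test1 g1 -> test1 g2 ->
     \int[leb2]_(x in Omega) (v x * tensor g1 g2 x) = 0)%R ->
  {ae leb2, forall x, Omega x -> v x = 0}.
Proof.
move=> vi H.
pose K k x1 := (\int[mu]_(x2 in unitI) (v (x1, x2) * fam k x2))%R.
have vki k : leb2.-integrable (Omega : set (plane R)) (EFin \o (fun x => v x * fam k x.2)).
  apply: (integrable_mulb (C := 1)) => //.
    apply: (measurableT_comp (f := @fam R k)).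
      by apply: measurable_smooth1 => //; exact: (test1_fam R k).1.
    by apply: measurable_funTS; exact: measurable_snd.
  by move=> x _; exact: fam_bound.
have Ki k : mu.-integrable unitI (EFin \o K k).
  by have := inner_integrable1 (vki k).
have K0 k : {ae mu, forall x1, unitI x1 -> K k x1 = 0}.
  apply: fundamental_lemma1 => // j.
  rewrite -[RHS](H (fam j) (fam k)); [|exact: test1_fam|exact: test1_fam].
  rewrite fubiniR1; last by apply: tensor_integrable => //; exact: test1_fam.
  apply: ae_eq_Rintegral => //.
  - apply: measurable_funM; first exact: integrable_measurable.
    by apply: measurable_smooth1 => //; exact: (test1_fam R j).1.
  - apply: integrable_measurable (inner_integrable1 (f := fun x => v x * tensor (fam j) (fam k) x) _).
    by apply: tensor_integrable => //; exact: test1_fam.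
  - apply: (ae_imp (section_integrable1 (vki k))) => x1 H1 Ix1.
    rewrite /K -RintegralZr//; last exact: H1.
    by apply: eq_Rintegral => x2 _; rewrite /tensor /=; ring.
have : {ae mu, forall x1, forall k, unitI x1 -> K k x1 = 0} by exact/ae_foralln.
have := section_integrable1 vi; move=> H1 H2.
have : {ae mu, forall x1, unitI x1 -> {ae mu, forall x2, unitI x2 -> v (x1, x2) = 0}}.
  apply: (ae_imp2 H1 H2) => {}x1 {}H1 {}H2 Ix1.
  by apply: fundamental_lemma1 => [|k]; [exact: H1|exact: H2].
move=> {}H1.
have mv : measurable_fun (Omega : set (plane R)) v by exact: integrable_measurable vi.
pose w : plane R -> R := v \_ Omega.
have mw : measurable_fun setT w by apply/(measurable_restrictT _ _).1.
have : (\int[leb2]_(x in Omega) `|(EFin \o v) x| = 0)%E.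
  transitivity (\int[leb2]_(x in Omega) `|(EFin \o w) x|)%E.
    by apply: eq_integral => x xO /=; rewrite /w patchE xO.
  rewrite (tonelliO1 (f := fun x => `|(EFin \o w) x|%E))//; last first.
    by apply: measurableT_comp => //; exact/measurable_EFinP.
  rewrite (ae_eq_integral (cst 0%E)) ?integral0//.
  - apply: measurable_funTS.
    apply: (measurable_tonelliO1 (f := fun x => `|(EFin \o w) x|%E)) => //.
    by apply: measurableT_comp => //; exact/measurable_EFinP.
  - apply: (ae_imp H1) => x1 {}H2 Ix1.
    rewrite (ae_eq_integral (cst 0%E)) ?integral0//.
      apply: measurable_funTS; apply: measurableT_comp => //; apply/measurable_EFinP.
      exact: measurableT_comp.
    apply: (ae_imp (H2 Ix1)) => x2 H3 Ix2 /=.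
    by rewrite /w patchE mem_set ?H3 ?normr0.
have mvE : measurable_fun (Omega : set (plane R)) (EFin \o v) by exact/measurable_EFinP.
move=> /(ae_eq_integral_abs leb2 (@measurable_Omega R) mvE).1 {}H.
by apply: (ae_imp H) => x Hx Ox; have [] := Hx Ox.
Qed.

End FundamentalLemma2.

(** * Weak derivatives and absolute continuity on lines *)

Lemma integral_unitI_cst (R : realType) (c : \bar R) :
  (\int[@lebesgue_measure R]_(x in unitI) c = c)%E.
Proof.
rewrite integral_cst; last exact: measurable_unitI.
by rewrite -[RHS]mule1; congr (_ * _)%E; exact: leb_unitI.
Qed.

Lemma measurable_sec2 (R : realType) d (T : measurableType d) (f : plane R -> T) (x : R) :
  measurable_fun setT f ->
  measurable_fun setT (fun t : measurableTypeR R => f (x, t)).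
Proof. by move=> mf; apply: measurableT_comp => //; exact: pair1_measurable. Qed.

Lemma measurable_sec1 (R : realType) d (T : measurableType d) (f : plane R -> T) (y : R) :
  measurable_fun setT f ->
  measurable_fun setT (fun t : measurableTypeR R => f (t, y)).
Proof. by move=> mf; apply: measurableT_comp => //; exact: pair2_measurable. Qed.

Section Primitive.
Variable R : realType.
Notation mu := (@lebesgue_measure R).

Lemma test1_zero (g : R -> R) x : test1 g -> ~ unitI x -> g x = 0.
Proof.
move=> [_ [a [b [a0 b1 gz]]]]; rewrite unitIE => H; apply: gz => /andP[ax xb].
by apply: H; apply/andP; split; lra.
Qed.

Lemma test1_integrable (g : R -> R) (D : set (measurableTypeR R)) :
  measurable D -> test1 g -> mu.-integrable D (EFin \o g).
Proof.
move=> mD tg; suff H : mu.-integrable setT (EFin \o g) by exact: integrableS H.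
rewrite (_ : g = g \_ `[0, 1]).
  rewrite -restrict_EFin; apply/integrable_restrict => //; rewrite setTI.
  apply: continuous_compact_integrable; first exact: segment_compact.
  by apply: continuous_subspaceT; exact: smooth1_continuous tg.1.
apply/funext => x; rewrite patchE; case: ifPn => //; rewrite notin_setE/= in_itv/= => xab.
apply: (test1_zero tg); rewrite unitIE => /andP[x0 x1]; apply: xab.
by rewrite !ltW.
Qed.

(** Taken from [-oo], so that it vanishes to the left of the support. *)
Definition primitive (g : R -> R) (x : R) : R := (\int[mu]_(t in `]-oo, x]) g t)%R.

Lemma primitiveE (g : R -> R) x : test1 g ->
  primitive g x = (\int[mu]_(t in unitI) (g t * (t <= x)%R%:R))%R.
Proof.
move=> tg; rewrite /primitive Rintegral_mkcond [RHS]Rintegral_mkcond.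
apply: eq_Rintegral => t _; rewrite !patchE mem_setE in_itv/=.
have [tI|tI] := boolP (t \in unitI).
  by case: (t <= x); rewrite ?mulr1 ?mulr0.
case: (t <= x) => //; apply: (test1_zero tg).
by move: tI; rewrite notin_setE.
Qed.

Lemma derive_primitive (g : R -> R) : test1 g ->
  forall x : R, is_derive x (1 : R) (primitive g) (g x).
Proof.
move=> tg x.
have xu : x < x + 1 by rewrite ltrDl.
have ig : mu.-integrable [set` Interval -oo%O (BRight (x + 1))] (EFin \o g).
  by apply: test1_integrable => //; exact: measurable_itv.
have [] := continuous_FTC1 xu ig (ltNyr _) (smooth1_continuous tg.1 (x := x)).
by rewrite derive1E => H1 H2; apply: DeriveDef.
Qed.

(** Mean zero is exactly what makes the primitive vanish to the right of the
    support as well. *)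
Lemma test1_primitive (g : R -> R) : test1 g -> (\int[mu]_(t in unitI) g t = 0)%R ->
  test1 (primitive g).
Proof.
move=> tg g0; split.
  case=> [//|n]; exists g; first exact: derive_primitive.
  exact: tg.1.
case: (tg) => _ [a [b [a0 b1 gz]]]; exists a, b; split => // x xab.
rewrite primitiveE//.
have [xa|ax] := ltP x a.
  rewrite (@eq_Rintegral _ _ _ _ _ (cst 0)) ?Rintegral_cst ?mul0r// => t _ /=.
  case: (leP t x) => tx; rewrite ?mulr0// gz ?mul0r//.
  by move=> /andP[ta _]; lra.
have bx : b < x by rewrite ltNge; apply/negP => xb; apply: xab; rewrite ax.
rewrite -[RHS]g0; apply: eq_Rintegral => t _.
case: (leP t x) => tx; rewrite ?mulr1// gz ?mul0r//.
by move=> /andP[ta tb]; lra.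
Qed.

End Primitive.

Section DuBoisReymond.
Variable R : realType.
Notation mu := (@lebesgue_measure R).

Definition mean (g : R -> R) : R := (\int[mu]_(t in unitI) g t)%R.

Lemma exists_mean_neq0 : exists n, mean (bump 0 1 n) != 0.
Proof.
apply: contrapT => /forallNP H.
have i1 : mu.-integrable unitI (EFin \o (cst 1 : R -> R)).
  apply: measurable_bounded_integrable => //; last exact: bounded_cst.
  by rewrite [X in (X < _)%E](leb_unitI R) ltry.
have := cvg_integral_bump i1 (lexx 0) (lexx 1).
rewrite (_ : (fun n => _) = fun=> 0%E).
  move=> /(cvg_unique _ (cvg_cst _)) /=.
  rewrite integral_cst// mul1e => H1.
  by have /eqP := etrans (H1 (@ereal_hausdorff R)) (leb_unitI R); rewrite eq_sym onee_eq0.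
apply/funext => n; have /negP := H n; rewrite negbK /mean /Rintegral.
rewrite fine_eq0; first by move=> /eqP <-; apply: eq_integral => x _ /=; rewrite mul1r.
apply: integrable_fin_num => //; apply: test1_integrable => //.
exact: test1_bump.
Qed.

Definition rho : R -> R := bump 0 1 (xchoose exists_mean_neq0).

Lemma mean_rho : mean rho != 0.
Proof. exact: (xchooseP exists_mean_neq0). Qed.

Lemma test1_rho : test1 rho.
Proof. exact: test1_bump. Qed.

(** Each member of the countable family, corrected by a multiple of [rho] so
    that its primitive is again a test function. *)
Definition bal k (x : R) : R := mean rho * fam k x - mean (fam k) * rho x.

Lemma Rint_lin (h g1 g2 : R -> R) (a b : R) : mu.-integrable unitI (EFin \o h) ->
  test1 g1 -> test1 g2 ->
  (\int[mu]_(t in unitI) (h t * (a * g1 t - b * g2 t)) =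
   a * \int[mu]_(t in unitI) (h t * g1 t) - b * \int[mu]_(t in unitI) (h t * g2 t))%R.
Proof.
move=> ih t1 t2.
have I (g : R -> R) c : test1 g -> mu.-integrable unitI (EFin \o (fun t => h t * g t)) /\
   mu.-integrable unitI (EFin \o (fun t => c * (h t * g t))).
  move=> tg; have H : mu.-integrable unitI (EFin \o (fun t => h t * g t)).
    have [C _ HC] := test1_bounded tg.
    by apply: (integrable_mulb (C := C)) => //; apply: measurable_smooth1 => //; exact: tg.1.
  split => //; rewrite (_ : _ \o _ = fun x => (c%:E * (EFin \o (fun t => (h t * g t)%R)) x)%E); last by apply/funext.
  exact: integrableZl.
rewrite -RintegralZl//; last exact: (I g1 0 t1).1.
rewrite -RintegralZl//; last exact: (I g2 0 t2).1.
rewrite -RintegralB//; [|exact: (I _ _ t1).2|exact: (I _ _ t2).2].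
by apply: eq_Rintegral => t _; ring.
Qed.

Lemma test1_bal k : test1 (bal k).
Proof.
have [s1 [a1 [b1 [a10 b11 z1]]]] := test1_fam R k.
have [s2 [a2 [b2 [a20 b21 z2]]]] := test1_rho.
split.
  have -> : bal k = (fun x => mean rho * fam k x + (- mean (fam k)) * rho x).
    by apply/funext => x; rewrite /bal mulNr.
  by move=> n; apply: CnD; apply: CnM; rewrite ?s1 ?s2//; exact: Cn_cst.
exists (Num.min a1 a2), (Num.max b1 b2); split.
- by rewrite lt_min a10.
- by rewrite gt_max b11.
move=> x /negP; rewrite ge_min le_max negb_and => H.
rewrite /bal z1 ?z2 ?mulr0 ?subrr//; apply/negP; move: H; case: (leP a1 x) => //=; case: (leP a2 x) => //=; case: (leP x b1) => //=; case: (leP x b2) => //=.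
Qed.

Lemma mean_bal k : (\int[mu]_(t in unitI) bal k t = 0)%R.
Proof.
have i1 : mu.-integrable unitI (EFin \o (cst 1 : R -> R)).
  apply: measurable_bounded_integrable => //; last exact: bounded_cst.
  by rewrite [X in (X < _)%E](leb_unitI R) ltry.
have one (g : R -> R) :
    (\int[mu]_(t in unitI) g t = \int[mu]_(t in unitI) (cst (1 : R) t * g t))%R.
  by apply: eq_Rintegral => t _; rewrite /= mul1r.
rewrite one /bal (Rint_lin (mean rho) (mean (fam k)) i1 (test1_fam R k) test1_rho).
by rewrite -!one -/(mean _) -/(mean _) mulrC subrr.
Qed.

(** Fubini's theorem on the triangle below the diagonal: an integration by
    parts that asks of [g] nothing but integrability. *)
Lemma triangle_fubini (g th : R -> R) :
  measurable_fun setT (g : measurableTypeR R -> R) ->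
  mu.-integrable unitI (EFin \o g) -> test1 th ->
  mu.-integrable unitI (EFin \o (fun t => \int[mu]_(x in unitI) (g x * (t <= x)%R%:R)))%R /\
  (\int[mu]_(x in unitI) (g x * primitive th x) =
   \int[mu]_(t in unitI) ((\int[mu]_(x in unitI) (g x * (t <= x)%R%:R)) * th t))%R.
Proof.
move=> mg ig tt.
have [C C0 HC] := test1_bounded tt.
have mI : measurable_fun setT (fun z : plane R => (z.2 <= z.1)%R%:R : R).
  pose A : set (plane R) := [set z | z.2 <= z.1].
  have mA : measurable A.
    have mB : measurable_fun setT (fun z : plane R => (z.1 - z.2 : measurableTypeR R)).
      exact: measurable_funB measurable_fst measurable_snd.
    rewrite (_ : A = setT `&` (fun z : plane R => z.1 - z.2) @^-1` `[0, +oo[%classic).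
      by apply: mB => //; exact: measurable_itv.
    by apply/seteqP; split => z; rewrite /A/= in_itv/= andbT subr_ge0; [move=> ?; split|move=> []].
  rewrite (_ : (fun z => _) = \1_A); first exact: measurable_indic.
  by apply/funext => z; rewrite indicE mem_setE.
have gi : leb2.-integrable (Omega : set (plane R)) (EFin \o (fun z => g z.1)).
  apply/integrableP; split.
    by apply/measurable_EFinP/measurable_funTS; exact: measurableT_comp.
  rewrite tonelliO1//; last by apply: measurableT_comp => //; apply/measurable_EFinP; exact: measurableT_comp.
  case/integrableP : (ig) => _; apply: le_lt_trans; rewrite le_eqVlt; apply/orP; left.
  apply/eqP; apply: eq_integral => x1 _ /=.
  by rewrite integral_unitI_cst.
have gii : leb2.-integrable (Omega : set (plane R)) (EFin \o (fun z => g z.1 * (z.2 <= z.1)%R%:R)).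
  apply: (integrable_mulb (C := 1)) => //; first exact: measurable_funTS.
  by move=> x _; case: (x.2 <= x.1)%R; rewrite ?normr1 ?normr0.
have giii : leb2.-integrable (Omega : set (plane R)) (EFin \o (fun z => g z.1 * (z.2 <= z.1)%R%:R * th z.2)).
  apply: (integrable_mulb (C := C)) => //.
  apply: measurable_funTS; apply: measurableT_comp => //.
  by apply: measurable_smooth1 => //; exact: tt.1.
split; first exact: (inner_integrable2 gii).
transitivity (\int[leb2]_(z in Omega) (g z.1 * (z.2 <= z.1)%R%:R * th z.2))%R.
  rewrite fubiniR1//=; apply: eq_Rintegral => x _.
  rewrite primitiveE// -RintegralZl//.
    by apply: eq_Rintegral => t _; rewrite mulrAC mulrA.
  apply: (integrable_mulb (C := 1)) => //; first exact: test1_integrable.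
    apply: measurable_funTS.
    exact: (measurable_sec2 x mI).
  by move=> t _; case: (t <= x)%R; rewrite ?normr1 ?normr0.
rewrite fubiniR2//=; apply: ae_eq_Rintegral => //.
- exact: integrable_measurable (inner_integrable2 giii).
- apply: measurable_funM; first exact: integrable_measurable (inner_integrable2 gii).
  by apply: measurable_smooth1 => //; exact: tt.1.
- apply: (ae_imp (section_integrable2 gii)) => t H It.
  by rewrite RintegralZr//; exact: H.
Qed.

(** By [triangle_fubini] the hypothesis says that [f] plus the tail integral
    of [g] is orthogonal to every [bal k].  Undoing the correction by [rho],
    that sum minus a constant is orthogonal to the whole family, hence zero. *)
Lemma du_bois_reymond (f g : R -> R) :
  measurable_fun setT (g : measurableTypeR R -> R) ->
  mu.-integrable unitI (EFin \o f) -> mu.-integrable unitI (EFin \o g) ->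
  (forall k, \int[mu]_(x in unitI) (f x * bal k x) =
     - \int[mu]_(x in unitI) (g x * primitive (bal k) x))%R ->
  exists c, {ae mu, forall t, unitI t ->
    f t = c - (\int[mu]_(x in unitI) (g x * (t <= x)%R%:R))%R}.
Proof.
move=> mg fi gi H.
pose T t := (\int[mu]_(x in unitI) (g x * (t <= x)%R%:R))%R.
have iT : mu.-integrable unitI (EFin \o T) by exact: (triangle_fubini mg gi test1_rho).1.
(* [w] is the function that has to be shown constant *)
pose w t := f t + T t.
have iw : mu.-integrable unitI (EFin \o w).
  rewrite (_ : EFin \o w = (EFin \o f) \+ (EFin \o T))%E; last by apply/funext.
  exact: integrableD.
have Ith (h th : R -> R) : mu.-integrable unitI (EFin \o h) -> test1 th -> mu.-integrable unitI (EFin \o (fun x => h x * th x)).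
  move=> ih tt; have [C C0 HC] := test1_bounded tt.
  by apply: (integrable_mulb (C := C)) => //; apply: measurable_smooth1 => //; exact: tt.1.
have w0 k : (\int[mu]_(t in unitI) (w t * bal k t) = 0)%R.
  transitivity (\int[mu]_(t in unitI) (f t * bal k t) + \int[mu]_(t in unitI) (T t * bal k t))%R.
    rewrite -RintegralD//; [|exact/Ith/test1_bal|exact/Ith/test1_bal].
    by apply: eq_Rintegral => t _; rewrite mulrDl.
  by rewrite H (triangle_fubini mg gi (test1_bal k)).2 addNr.
(* the constant is the mean of [w] against the normalised bump [rho] *)
pose c := (\int[mu]_(t in unitI) (w t * rho t))%R / mean rho.
have ic : mu.-integrable unitI (EFin \o (cst c : R -> R)).
  apply: measurable_bounded_integrable => //; last exact: bounded_cst.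
  by rewrite [X in (X < _)%E](leb_unitI R) ltry.
have iwc : mu.-integrable unitI (EFin \o (fun t => w t - c)).
  rewrite (_ : EFin \o _ = (EFin \o w) \- (EFin \o (cst c : R -> R)))%E; last by apply/funext.
  exact: integrableB.
exists c.
have := fundamental_lemma1 iwc _ => H1.
apply: (ae_imp (H1 _)) => [k|t + It]; last first.
  by move=> /(_ It); rewrite /w -/(T t) => E; lra.
have := w0 k; rewrite /bal Rint_lin//; [|exact: test1_fam|exact: test1_rho].
move=> E.
transitivity (\int[mu]_(t in unitI) (w t * fam k t) - c * mean (fam k))%R.
  rewrite /mean -RintegralZl//; last exact/test1_integrable/test1_fam.
  rewrite -RintegralB//; [|exact/Ith/test1_fam|exact: (Ith (cst c) _ ic (test1_fam R k))].
  by apply: eq_Rintegral => t _; rewrite mulrBl.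
apply: (mulfI mean_rho); rewrite mulr0 -[RHS]E mulrBr; congr (_ - _).
by rewrite /c mulrCA mulrA mulrC; congr (_ * _); field; exact: mean_rho.
Qed.

End DuBoisReymond.

Section AbsoluteContinuity.
Variable R : realType.
Notation mu := (@lebesgue_measure R).

(** For each [bal k], testing against a product and integrating out the first
    variable yields the hypothesis of [du_bois_reymond] on almost every line;
    the family being countable, the exceptional lines do not depend on [k]. *)
Lemma acl1 (u v : R * R -> R) :
  measurable_fun setT (v : plane R -> R) ->
  leb2.-integrable (Omega : set (plane R)) (EFin \o u) ->
  leb2.-integrable (Omega : set (plane R)) (EFin \o v) ->
  (forall g1 g2, test1 g1 -> test1 g2 ->
     \int[leb2]_(x in Omega) (u x * tensor (derive1 g1) g2 x) =
     - \int[leb2]_(x in Omega) (v x * tensor g1 g2 x))%R ->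
  {ae mu, forall x2, unitI x2 -> exists c, {ae mu, forall x1, unitI x1 ->
     u (x1, x2) = c - (\int[mu]_(t in unitI) (v (t, x2) * (x1 <= t)%R%:R))%R}}.
Proof.
move=> mv ui vi H.
pose K k x2 := (\int[mu]_(x1 in unitI) (u (x1, x2) * bal k x1 + v (x1, x2) * primitive (bal k) x1))%R.
have tb k : test1 (@bal R k) := test1_bal R k.
have tp k : test1 (primitive (@bal R k)) := test1_primitive (tb k) (mean_bal R k).
have Ib (w : R * R -> R) (g : R -> R) : test1 g -> leb2.-integrable (Omega : set (plane R)) (EFin \o w) ->
    leb2.-integrable (Omega : set (plane R)) (EFin \o (fun x => w x * g x.1)).
  move=> tg wi; have [C C0 HC] := test1_bounded tg.
  apply: (integrable_mulb (C := C)) => //.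
  apply: measurable_funTS; apply: measurableT_comp => //.
  by apply: measurable_smooth1 => //; exact: tg.1.
have iK k : leb2.-integrable (Omega : set (plane R)) (EFin \o (fun x => u x * bal k x.1 + v x * primitive (bal k) x.1)).
  rewrite (_ : EFin \o _ = (EFin \o (fun x => (u x * bal k x.1)%R)) \+ (EFin \o (fun x => (v x * primitive (bal k) x.1)%R)))%E; last by apply/funext.
  by apply: integrableD => //; exact: Ib.
have K0 k : {ae mu, forall x2, unitI x2 -> K k x2 = 0}.
  apply: fundamental_lemma1 => [|j]; first exact: (inner_integrable2 (iK k)).
  have tf := test1_fam R j.
  transitivity (\int[leb2]_(x in Omega) (u x * tensor (bal k) (fam j) x + v x * tensor (primitive (bal k)) (fam j) x))%R.
    have iL : leb2.-integrable (Omega : set (plane R)) (EFin \o (fun x => u x * tensor (bal k) (fam j) x + v x * tensor (primitive (bal k)) (fam j) x)).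
      rewrite (_ : EFin \o _ = (EFin \o (fun x => (u x * tensor (bal k) (fam j) x)%R)) \+ (EFin \o (fun x => (v x * tensor (primitive (bal k)) (fam j) x)%R)))%E; last by apply/funext.
      by apply: integrableD => //; exact: tensor_integrable.
    rewrite fubiniR2//.
    apply: ae_eq_Rintegral => //.
    - apply: measurable_funM; first exact: integrable_measurable (inner_integrable2 (iK k)).
      by apply: measurable_smooth1 => //; exact: tf.1.
    - exact: integrable_measurable (inner_integrable2 iL).
    - apply: (ae_imp (section_integrable2 (iK k))) => x2 H1 Ix2.
      rewrite /K -RintegralZr//; last exact: H1.
      by apply: eq_Rintegral => x1 _; rewrite /tensor /=; ring.
  rewrite RintegralD//; [|exact: tensor_integrable|exact: tensor_integrable].
  have := H (primitive (bal k)) (fam j) (tp k) tf.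
  have -> : derive1 (primitive (@bal R k)) = bal k.
    by apply/funext => x; rewrite derive1E; have E := derive_primitive (tb k) x; apply: derive_val.
  by move=> ->; rewrite addNr.
have K0' : {ae mu, forall x2, forall k, unitI x2 -> K k x2 = 0} by exact/ae_foralln.
apply: (ae_imp2 K0' (ae_imp2 (section_integrable2 ui) (section_integrable2 vi) (fun x a b => conj a b))) => x2 {}K0 [ui2 vi2] Ix2.
apply: du_bois_reymond; [|exact: ui2|exact: vi2|].
  exact: (measurable_sec1 x2 mv).
move=> k; have := K0 k Ix2; rewrite /K RintegralD//.
- by move=> /eqP; rewrite addr_eq0 => /eqP.
- have [C C0 HC] := test1_bounded (tb k).
  by apply: (integrable_mulb (C := C)) => //; [exact: ui2|apply: measurable_smooth1 => //; exact: (tb k).1].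
- have [C C0 HC] := test1_bounded (tp k).
  by apply: (integrable_mulb (C := C)) => //; [exact: vi2|apply: measurable_smooth1 => //; exact: (tp k).1].
Qed.

End AbsoluteContinuity.

(** * Fractional seminorms in one dimension *)

Section KernelBound.
Variable R : realType.
Notation mu := (@lebesgue_measure R).

(** The integral of a nonnegative derivative is bounded by the oscillation of
    a primitive, even when the derivative is unbounded near the endpoints. *)
Lemma integral_le_primitive (f F : R -> R) (a b M : R) : a < b ->
  (forall x, a < x < b -> 0 <= f x) ->
  (forall x, a < x < b -> {for x, continuous f}) ->
  (forall x, a < x < b -> is_derive x (1 : R) F (f x)) ->
  (forall x, a < x < b -> 0 <= F x <= M) ->
  (\int[mu]_(x in `]a, b[) (f x)%:E <= M%:E)%E.
Proof.
move=> ab f0 cf dF FM.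
have mf : measurable_fun `]a, b[ f.
  apply: open_continuous_measurable_fun; first exact: interval_open.
  by move=> x; rewrite inE/= in_itv/= => xab; exact: cf.
pose A (n : nat) := a + n.+1%:R^-1; pose B (n : nat) := b - n.+1%:R^-1.
pose D n : set R := `[A n, B n]%classic.
have Dab n x : D n x -> a < x < b.
  rewrite /D/= in_itv/= => /andP[h1 h2]; apply/andP; split.
    by apply: lt_le_trans h1; rewrite ltrDl invr_gt0.
  by apply: le_lt_trans h2 _; rewrite gtrBl invr_gt0.
have nD : nondecreasing_seq D.
  move=> n m nm; rewrite subsetEset => x; rewrite /D/= !in_itv/= => /andP[h1 h2].
  have : m.+1%:R^-1 <= n.+1%:R^-1 :> R by rewrite lef_pV2 ?posrE// ler_nat.
  move: h1 h2; rewrite /A /B; move: (n.+1%:R^-1 : R) (m.+1%:R^-1 : R) => p r h1 h2 pr.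
  by apply/andP; split; lra.
have mD n : measurable (D n : set (measurableTypeR R)) by exact: measurable_itv.
have mfD n : measurable_fun (D n) (EFin \o f).
  apply/measurable_EFinP; apply: (@measurable_funS _ _ (measurableTypeR R) _ `]a, b[) => //.
  by move=> x /Dab; rewrite /= in_itv.
have f0D n x : D n x -> (0 <= (EFin \o f) x)%E by move=> /Dab xab; rewrite lee_fin f0.
have bigD : \bigcup_n D n = `]a, b[%classic.
  apply/seteqP; split => [x [n _ /Dab]|x]; rewrite /= in_itv//= => /andP[ax xb].
  have [n Hn] : exists n : nat, n.+1%:R^-1 < Num.min (x - a) (b - x).
    have m0 : 0 < Num.min (x - a) (b - x) by rewrite lt_min !subr_gt0 ax.
    have := near_infty_natSinv_lt (PosNum m0) => -[n _ /(_ n (leqnn n)) H].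
    by exists n.
  move: Hn; rewrite lt_min => /andP[h1 h2].
  exists n => //; rewrite /D/= in_itv/= /A /B.
  by move: (n.+1%:R^-1 : R) h1 h2 => p h1 h2; apply/andP; split; lra.
have := ge0_nondecreasing_set_cvg_integral (mu := mu) nD mD mfD f0D.
rewrite bigD => L; rewrite -(cvg_lim (@ereal_hausdorff R) L).
apply: lime_le; first by apply: cvgP L.
near=> n.
have [AB|BA] := ltP (A n) (B n); last first.
  have M0 : 0 <= M.
    have /FM/andP[h1 h2] : a < (a + b) / 2 < b by apply/andP; split; lra.
    exact: le_trans h2.
  have [AB|AB] := eqVneq (A n) (B n).
    by rewrite /D AB set_itv1 integral_set1 lee_fin.
  have lt : B n < A n by rewrite lt_neqAle eq_sym AB.
  by rewrite /D set_itv_ge ?integral_set0 ?lee_fin// bnd_simp -ltNge.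
have cF (x : R) : a < x < b -> {for x, continuous F}.
  move=> xab; apply: differentiable_continuous; apply/derivable1_diffP.
  by have [] := dF x xab.
have An : a < A n < b.
  by apply: (Dab n); rewrite /D/= in_itv/= lexx ltW.
have Bn : a < B n < b.
  by apply: (Dab n); rewrite /D/= in_itv/= lexx ltW.
rewrite /D (continuous_FTC2 (F := F))//.
- rewrite -EFinB lee_fin.
  by have := FM _ An; have := FM _ Bn; move=> /andP[? ?] /andP[? ?]; lra.
- apply: continuous_in_subspaceT => x; rewrite inE/= in_itv/= => xAB.
  by apply: cf; apply: (Dab n); rewrite /D/= in_itv.
- split.
  + move=> x; rewrite in_itv/= => /andP[h1 h2].
    have xab : a < x < b by apply: (Dab n); rewrite /D/= in_itv/= !ltW.
    by have [] := dF x xab.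
  + exact/cvg_at_right_filter/cF.
  + exact/cvg_at_left_filter/cF.
- move=> x; rewrite in_itv/= => /andP[h1 h2].
  have xab : a < x < b by apply: (Dab n); rewrite /D/= in_itv/= !ltW.
  by rewrite derive1E; have E := dF x xab; apply: derive_val.
Unshelve. all: by end_near. Qed.

(** The singular kernel of the one-dimensional fractional seminorms. *)
Definition ker (q x y : R) : R := `|x - y| `^ (- q).

Lemma ker_ge0 q x y : 0 <= ker q x y.
Proof. exact: powR_ge0. Qed.

Lemma kerC q x y : ker q x y = ker q y x.
Proof. by rewrite /ker distrC. Qed.

Lemma measurable_ker (q : R) : measurable_fun setT (fun z : plane R => ker q z.1 z.2).
Proof.
apply: (measurableT_comp (measurable_powR _)); apply: measurableT_comp => //.
exact: measurable_funB measurable_fst measurable_snd.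
Qed.

Lemma is_derive_powR_shift (q x y : R) : 0 < q < 1 -> x < y ->
  is_derive y (1 : R) (fun t => (t - x) `^ (1 - q) / (1 - q)) ((y - x) `^ (- q)).
Proof.
move=> /andP[q0 q1] xy.
have xy0 : 0 < y - x by rewrite subr_gt0.
have dS : is_derive y (1 : R) (fun t => t - x) 1.
  have := is_deriveB (is_derive_id y (1 : R)) (is_derive_cst x y 1).
  by move=> /is_derive_eq; apply; rewrite subr0.
have dP := @is_derive1_comp R (fun t : R => t `^ (1 - q)) (fun t => t - x) y _ _ (is_derive1_powR (1 - q) xy0) dS.
have := is_deriveM dP (is_derive_cst ((1 - q)^-1) y (1 : R)).
move=> H; rewrite [X in is_derive _ _ _ X](_ : _ = ((fun t : R => t `^ (1 - q)) \o (fun t => t - x)) y *: 0 +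
   cst (1 - q)^-1 y *: ((1 - q) * (y - x) `^ (1 - q - 1) * 1)); first exact: H.
rewrite scaler0 add0r mulr1 /GRing.scale/= mulrA mulVf ?mul1r; last by rewrite subr_eq0 eq_sym lt_eqF.
by congr (_ `^ _); ring.
Qed.

Lemma is_derive_powR_shiftN (q x y : R) : 0 < q < 1 -> y < x ->
  is_derive y (1 : R) (fun t => (1 - q)^-1 - (x - t) `^ (1 - q) / (1 - q)) ((x - y) `^ (- q)).
Proof.
move=> q01 yx.
have H1 : is_derive (- y) (1 : R) (fun t => (t - - x) `^ (1 - q) / (1 - q)) ((- y - - x) `^ (- q)).
  by apply: is_derive_powR_shift => //; rewrite ltrN2.
have dN : is_derive y (1 : R) (fun t : R => - t) (- 1) by exact: is_deriveNid.
have H2 := is_derive1_comp H1 dN.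
have H3 := is_deriveB (is_derive_cst ((1 - q)^-1) y (1 : R)) H2.
rewrite [X in is_derive _ _ _ X](_ : _ = 0 - ((- y - - x) `^ (- q) * -1)); last first.
  by rewrite sub0r mulrN1 opprK; congr (_ `^ _); ring.
rewrite (_ : (fun t => _) = (cst (1 - q)^-1 - ((fun t : R => (t - - x) `^ (1 - q) / (1 - q)) \o (fun t => - t)))); first exact: H3.
apply/funext => t; rewrite /= !fctE /=; congr (_ - _ `^ _ / _); ring.
Qed.

Lemma powR_continuous_at (q x : R) : 0 < x -> {for x, continuous (fun t : R => t `^ q)}.
Proof.
move=> x0; apply: differentiable_continuous; apply/derivable1_diffP.
by have [] := is_derive1_powR q x0.
Qed.

(** The exponent is below 1, so on either side of [x] the kernel has the
    bounded primitive [|t - x|^(1 - q) / (1 - q)]. *)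
Lemma kernel_bound (q : R) : 0 < q < 1 -> exists2 C : R, 0 <= C &
  forall x, unitI x -> (\int[mu]_(y in unitI) (ker q x y)%:E <= C%:E)%E.
Proof.
move=> q01; have /andP[q0 q1] := q01.
have q1' : 0 < 1 - q by lra.
have M0 : 0 <= (1 - q)^-1 by rewrite invr_ge0 ltW.
exists ((1 - q)^-1 + (1 - q)^-1) => [|x]; first exact: addr_ge0.
rewrite unitIE => /andP[x0 x1].
have mk (D : set (measurableTypeR R)) : measurable D -> measurable_fun D (fun y => (ker q x y)%:E).
  move=> mD; apply/measurable_EFinP/measurable_funTS.
  exact: (measurable_sec2 x (measurable_ker q)).
have le1 (t : R) : 0 < t < 1 -> 0 <= t `^ (1 - q) / (1 - q) <= (1 - q)^-1.
  move=> /andP[t0 t1]; rewrite divr_ge0 ?powR_ge0 ?(ltW q1')//= ler_piMl//.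
  rewrite -[X in _ <= X](powRr0 t); apply: ger_powR; first by rewrite t0 ltW.
  exact: ltW.
have -> : unitI = `]0, x] `|` `]x, 1[ :> set (measurableTypeR R).
  apply/seteqP; split => [y|y [|]]; rewrite /unitI/= !in_itv/=.
  - by move=> /andP[-> ->]; case: (leP y x); [left|right].
  - by move=> /andP[-> yx]/=; rewrite (le_lt_trans yx).
  - by move=> /andP[xy ->]; rewrite (lt_trans x0).
have dj : [disjoint (`]0, x] : set (measurableTypeR R)) & `]x, 1[]%classic.
  apply/disj_set2P; apply/seteqP; split => // y []/=; rewrite !in_itv/= => /andP[_ yx] /andP[xy _].
  by move: (le_lt_trans yx xy); rewrite ltxx.
rewrite ge0_integral_setU//; last 2 first.
- by apply: mk; apply: measurableU; exact: measurable_itv.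
- by move=> y _; rewrite lee_fin ker_ge0.
rewrite EFinD; apply: leeD.
- rewrite -integral_itv_bndo_bndc; last by apply: mk; exact: measurable_itv.
  rewrite (eq_integral (fun y : measurableTypeR R => ((x - y : R) `^ (- q))%:E)); last first.
    move=> y; rewrite inE/= in_itv/= => /andP[_ yx]; rewrite /ker ger0_norm//.
    by rewrite subr_ge0 ltW.
  apply: (@integral_le_primitive _ (fun t => (1 - q)^-1 - (x - t) `^ (1 - q) / (1 - q))) => //.
  + by move=> y _; exact: powR_ge0.
  + move=> y /andP[y0 yx].
    apply: (@continuous_comp _ _ _ (fun t => x - t) (fun t => t `^ (- q))).
      by apply: continuousB; [exact: cst_continuous|exact: cvg_id].
    by apply: powR_continuous_at; rewrite subr_gt0.
  + by move=> y /andP[y0 yx]; exact: is_derive_powR_shiftN.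
  + move=> y /andP[y0 yx]; have /le1/andP[h1 h2] : 0 < x - y < 1 by apply/andP; split; lra.
    by rewrite subr_ge0 h2/= gerBl.
- rewrite (eq_integral (fun y : measurableTypeR R => ((y - x : R) `^ (- q))%:E)); last first.
    move=> y; rewrite inE/= in_itv/= => /andP[xy _]; rewrite /ker distrC ger0_norm//.
    by rewrite subr_ge0 ltW.
  apply: (@integral_le_primitive _ (fun t => (t - x) `^ (1 - q) / (1 - q))) => //.
  + by move=> y _; exact: powR_ge0.
  + move=> y /andP[y0 yx].
    apply: (@continuous_comp _ _ _ (fun t => t - x) (fun t => t `^ (- q))).
      by apply: continuousB; [exact: cvg_id|exact: cst_continuous].
    by apply: powR_continuous_at; rewrite subr_gt0.
  + by move=> y /andP[y0 yx]; exact: is_derive_powR_shift.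
  + by move=> y /andP[xy y1]; apply: le1; apply/andP; split; lra.
Qed.

End KernelBound.

Section Slobodeckij1.
Variable R : realType.
Notation mu := (@lebesgue_measure R).

(** A point between [x] and [y] is closer to each of them than they are to each
    other; one power of the distance is spent in front, and the rest is split
    evenly between the two kernels. *)
Lemma ker_split (p r x y s : R) : 0 <= r -> p = 1 + (r + r) -> x < s < y ->
  (y - x) * ker p x y <= ker r x s * ker r y s.
Proof.
move=> r0 -> /andP[xs sy]; have xy := lt_trans xs sy.
have yx0 : 0 < y - x by rewrite subr_gt0.
have yxn0 : y - x != 0 by rewrite gt_eqF.
rewrite /ker distrC [`|x - s|]distrC !gtr0_norm ?subr_gt0//.
rewrite !opprD !powRD ?yxn0 ?implybT// powR_inv1; last exact: ltW.
rewrite mulrA mulfV// mul1r.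
have H z : 0 < z <= y - x -> (y - x) `^ (- r) <= z `^ (- r).
  move=> /andP[z0 zy]; rewrite !powRN lef_pV2 ?posrE ?powR_gt0//.
  by apply: ge0_ler_powR => //; rewrite nnegrE ltW.
by apply: ler_pM; rewrite ?powR_ge0//; apply: H; apply/andP; split; lra.
Qed.

(** Cauchy-Schwarz bounds the squared increment by [y - x] times the integral
    of [g^2] between the points; [ker_split] then distributes the singularity
    over the point of integration, where it is integrable in [x] and in [y]. *)
Lemma increment_bound (f g : R -> R) (c r x y : R) : 0 < r ->
  measurable_fun setT (g : measurableTypeR R -> R) ->
  mu.-integrable unitI (EFin \o g) ->
  (\int[mu]_(s in unitI) ((g s) ^+ 2)%:E < +oo)%E ->
  unitI x -> unitI y -> x < y ->
  f x = c - (\int[mu]_(s in unitI) (g s * (x <= s)%R%:R))%R ->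
  f y = c - (\int[mu]_(s in unitI) (g s * (y <= s)%R%:R))%R ->
  (((f x - f y) ^+ 2 * ker (1 + (r + r)) x y)%:E <=
   \int[mu]_(s in unitI) ((g s) ^+ 2 * (ker r x s * ker r y s))%:E)%E.
Proof.
move=> r0 mg gi g2 Ix Iy xy fx fy.
pose D : set (measurableTypeR R) := `]x, y[%classic.
have mD : measurable D by exact: measurable_itv.
have DI : D `<=` unitI.
  move=> s; rewrite /D/= in_itv/= => /andP[xs sy].
  by move: Ix Iy; rewrite !unitIE => /andP[h1 h2] /andP[h3 h4]; apply/andP; split; lra.
have mg2 (E : set (measurableTypeR R)) : measurable E -> measurable_fun E (fun s => ((g s) ^+ 2)%:E).
  by move=> mE; apply/measurable_EFinP/measurable_funX/measurable_funTS.
have A2 : (\int[mu]_(s in D) ((g s) ^+ 2)%:E < +oo)%E.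
  apply: le_lt_trans g2; apply: ge0_subset_integral => //; first exact: mg2.
  by move=> s _; rewrite lee_fin sqr_ge0.
have A0 : (0 <= \int[mu]_(s in D) ((g s) ^+ 2)%:E)%E.
  by apply: integral_ge0 => s _; rewrite lee_fin sqr_ge0.
pose A := fine (\int[mu]_(s in D) ((g s) ^+ 2)%:E)%E.
have AE : (\int[mu]_(s in D) ((g s) ^+ 2)%:E = A%:E)%E.
  by rewrite /A fineK// ge0_fin_numE.
have A0' : 0 <= A by rewrite /A fine_ge0.
have msel z : measurable_fun setT (fun s : measurableTypeR R => (z <= s)%R%:R : R).
  rewrite (_ : (fun _ => _) = \1_(`[z, +oo[%classic : set (measurableTypeR R))).
    by apply: measurable_indic; exact: measurable_itv.
  by apply/funext => s; rewrite indicE mem_setE in_itv/= andbT.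
have isel z : mu.-integrable unitI (EFin \o (fun s => g s * (z <= s)%R%:R)).
  apply: (integrable_mulb (C := 1)) => //; first exact: measurable_funTS.
  by move=> s _; case: (z <= s)%R; rewrite ?normr1 ?normr0.
have bnd : `|f x - f y| <= Num.sqrt A * Num.sqrt (y - x).
  rewrite -lee_fin.
  have sq (t : R) : 0 <= t -> (Num.sqrt t) ^+ 2 = t by exact: sqr_sqrtr.
  have mgD : measurable_fun D g by exact: measurable_funTS.
  have CS : (\int[mu]_(s in D) (`|g s * (cst (1 : R) s)|)%:E <= (Num.sqrt A * Num.sqrt (y - x))%:E)%E.
    apply: cauchy_schwarz => //.
    - by rewrite sq// AE.
    - rewrite sq; last by rewrite subr_ge0 ltW.
      under eq_integral do rewrite /= expr1n.
      rewrite integral_cst// mul1e /D.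
      by have := lebesgue_measure_itv (`]x, y[); rewrite /= lte_fin xy => ->.
  apply: le_trans CS.
  have -> : f x - f y = (\int[mu]_(s in unitI) (g s * (y <= s)%R%:R - g s * (x <= s)%R%:R))%R.
    by rewrite RintegralB//; lra.
  have isub : mu.-integrable unitI (EFin \o (fun s => g s * (y <= s)%R%:R - g s * (x <= s)%R%:R)).
    rewrite (_ : EFin \o _ = (EFin \o (fun s => g s * (y <= s)%R%:R)%R) \- (EFin \o (fun s => g s * (x <= s)%R%:R)%R))%E; last by apply/funext.
    exact: integrableB.
  have := le_normr_Rintegral (mu := mu) (@measurable_unitI R) isub.
  rewrite -lee_fin => /le_trans; apply.
  rewrite /Rintegral fineK; last first.
    apply: integrable_fin_num => //; have := integrable_abse isub.
    by apply: eq_integrable.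
  rewrite le_eqVlt; apply/orP; left; apply/eqP.
  rewrite /D integral_itv_obnd_cbnd; last first.
    by apply/measurable_EFinP/measurable_funTS; apply: measurableT_comp => //; apply: measurable_funM.
  rewrite [LHS]integral_mkcond [RHS]integral_mkcond; apply: eq_integral => s _.
  rewrite !patchE /cst mulr1.
  have -> : (s \in `[x, y[%classic) = (x <= s < y) by rewrite mem_setE in_itv.
  have [sI|sI] := boolP (s \in unitI).
    have [xs|sx] := leP x s => /=.
      by have [ys|sy] := leP y s; rewrite ?mulr1 ?mulr0 ?subrr ?normr0// sub0r normrN.
    by rewrite leNgt (lt_trans sx xy)/= mulr0 subrr normr0.
  case: ifP => // xsy; exfalso; move: sI; rewrite notin_setE; apply.
  move: Ix Iy; rewrite !unitIE => /andP[h1 h2] /andP[h3 h4].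
  by move/andP: xsy => [h5 h6]; apply/andP; split; [exact: lt_le_trans h5|exact: lt_trans h4].
have sqb : (f x - f y) ^+ 2 <= A * (y - x).
  rewrite -real_normK ?num_real//.
  have -> : A * (y - x) = (Num.sqrt A * Num.sqrt (y - x)) ^+ 2.
    by rewrite exprMn !sqr_sqrtr// subr_ge0 ltW.
  by rewrite lerXn2r ?nnegrE ?mulr_ge0 ?sqrtr_ge0.
have k0 : 0 <= (y - x) * ker (1 + (r + r)) x y.
  by rewrite mulr_ge0 ?ker_ge0 ?subr_ge0 ?ltW.
apply: (@le_trans _ _ (((y - x) * ker (1 + (r + r)) x y)%:E * \int[mu]_(s in D) ((g s) ^+ 2)%:E)%E).
  rewrite AE -EFinM lee_fin [leRHS](_ : _ = (A * (y - x)) * ker (1 + (r + r)) x y); last by ring.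
  by rewrite ler_wpM2r ?ker_ge0.
have mk (z : R) (E : set (measurableTypeR R)) : measurable E -> measurable_fun E (fun s => ker r z s).
  by move=> mE; apply: measurable_funTS; exact: (measurable_sec2 z (measurable_ker r)).
have mR (E : set (measurableTypeR R)) : measurable E -> measurable_fun E (fun s => ((g s) ^+ 2 * (ker r x s * ker r y s))%:E).
  move=> mE; apply/measurable_EFinP/measurable_funM; last by apply: measurable_funM; exact: mk.
  by apply/measurable_funX/measurable_funTS.
rewrite -ge0_integralZl//; last 2 first.
- exact: mg2.
- by move=> s _; rewrite lee_fin sqr_ge0.
apply: (@le_trans _ _ (\int[mu]_(s in D) ((g s) ^+ 2 * (ker r x s * ker r y s))%:E)%E).
  apply: ge0_le_integral => //.
  - by move=> s _; rewrite -EFinM lee_fin mulr_ge0 ?sqr_ge0.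
  - by apply: measurable_funeM; exact: mg2.
  - exact: mR.
  - move=> s; rewrite /D/= in_itv/= => xsy; rewrite -EFinM lee_fin mulrC ler_wpM2l ?sqr_ge0//.
    by apply: ker_split => //; exact: ltW.
apply: ge0_subset_integral => //; first exact: mR.
by move=> s _; rewrite lee_fin mulr_ge0 ?sqr_ge0 ?mulr_ge0 ?ker_ge0.
Qed.

(** The one-dimensional fractional estimate: after [increment_bound] the triple
    integral factors through the two kernels. *)
Lemma slobodeckij1 (r : R) : 0 < r < 1 -> exists2 C : R, 0 <= C &
  forall (f g : R -> R) (c : R),
  measurable_fun setT (f : measurableTypeR R -> R) ->
  measurable_fun setT (g : measurableTypeR R -> R) ->
  mu.-integrable unitI (EFin \o g) ->
  (\int[mu]_(s in unitI) ((g s) ^+ 2)%:E < +oo)%E ->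
  {ae mu, forall t, unitI t ->
     f t = c - (\int[mu]_(s in unitI) (g s * (t <= s)%R%:R))%R} ->
  (\int[mu]_(x in unitI) \int[mu]_(y in unitI)
     ((f x - f y) ^+ 2 * ker (1 + (r + r)) x y)%:E <=
   C%:E * \int[mu]_(s in unitI) ((g s) ^+ 2)%:E)%E.
Proof.
move=> r01; have /andP[r0 r1] := r01; have [C C0 HC] := kernel_bound r01.
exists (C * C) => [|f g c mf mg gi g2 fE]; first exact: mulr_ge0.
have mP : measurable_fun setT (fun z : plane R => ((f z.1 - f z.2) ^+ 2 * ker (1 + (r + r)) z.1 z.2)%:E).
  apply/measurable_EFinP/measurable_funM; last exact: measurable_ker.
  apply: measurable_funX; apply: measurable_funB.
    exact: (measurableT_comp mf measurable_fst).
  exact: (measurableT_comp mf measurable_snd).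
have P0 (z : plane R) : (0 <= ((f z.1 - f z.2) ^+ 2 * ker (1 + (r + r)) z.1 z.2)%:E)%E.
  by rewrite lee_fin mulr_ge0 ?sqr_ge0 ?ker_ge0.
have Ker0 s : 0 <= (g s) ^+ 2 by exact: sqr_ge0.
have mg2 : measurable_fun setT (fun s : measurableTypeR R => (g s) ^+ 2) by exact: measurable_funX.
have mQ (x : R) : measurable_fun setT (fun z : plane R => ((g z.2) ^+ 2 * (ker r x z.2 * ker r z.1 z.2))%:E).
  apply/measurable_EFinP; apply: measurable_funM.
    exact: (measurableT_comp mg2 measurable_snd).
  apply: measurable_funM; last exact: measurable_ker.
  exact: (measurableT_comp (measurable_sec2 x (measurable_ker r)) measurable_snd).
have Q0 (x : R) (z : plane R) : (0 <= ((g z.2) ^+ 2 * (ker r x z.2 * ker r z.1 z.2))%:E)%E.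
  by rewrite lee_fin mulr_ge0 ?sqr_ge0 ?mulr_ge0 ?ker_ge0.
have mS : measurable_fun setT (fun z : plane R => ((g z.2) ^+ 2 * ker r z.1 z.2)%:E).
  apply/measurable_EFinP; apply: measurable_funM; last exact: measurable_ker.
  exact: (measurableT_comp mg2 measurable_snd).
have S0 (z : plane R) : (0 <= ((g z.2) ^+ 2 * ker r z.1 z.2)%:E)%E.
  by rewrite lee_fin mulr_ge0 ?sqr_ge0 ?mulr_ge0 ?ker_ge0.
have mk1 (x : R) : measurable_fun unitI (fun s : measurableTypeR R => ker r x s).
  by apply: measurable_funTS; exact: (measurable_sec2 x (measurable_ker r)).
have step1 : (\int[mu]_(x in unitI) \int[mu]_(y in unitI) ((f x - f y) ^+ 2 * ker (1 + (r + r)) x y)%:E <=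
   \int[mu]_(x in unitI) (C%:E * \int[mu]_(s in unitI) ((g s) ^+ 2 * ker r x s)%:E))%E.
  apply: ae_ge0_le_integral => //.
  - by move=> x _; apply: integral_ge0 => y _; exact: (P0 (x, y)).
  - by apply: measurable_funTS; exact: (measurable_tonelliO1 mP P0).
  - by move=> x _; rewrite mule_ge0// integral_ge0// => y _; exact: (S0 (x, y)).
  - by apply: measurable_funTS; apply: measurable_funeM; exact: (measurable_tonelliO1 mS S0).
  apply: (ae_imp fE) => x fxE Ix.
  apply: (@le_trans _ _ (\int[mu]_(y in unitI) \int[mu]_(s in unitI) ((g s) ^+ 2 * (ker r x s * ker r y s))%:E)%E).
    apply: ae_ge0_le_integral => //.
    - by move=> y _; exact: (P0 (x, y)).
    - by apply: measurable_funTS; exact: (measurable_sec2 x mP).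
    - by move=> y _; apply: integral_ge0 => s _; exact: (Q0 x (y, s)).
    - by apply: measurable_funTS; exact: (measurable_tonelliO1 (mQ x) (Q0 x)).
    apply: (ae_imp fE) => y fyE Iy.
    have [xy|yx|->] := ltgtP x y.
    - by apply: increment_bound => //; [exact: fxE|exact: fyE].
    - have := increment_bound r0 mg gi g2 Iy Ix yx (fyE Iy) (fxE Ix).
      rewrite kerC (_ : (f y - f x) ^+ 2 = (f x - f y) ^+ 2); last by ring.
      by under eq_integral do rewrite [ker r y _ * _]mulrC.
    - rewrite subrr expr0n/= mul0r.
      by apply: integral_ge0 => s _; exact: (Q0 y (y, s)).
  rewrite (tonelliD_swap mu mu (@measurable_unitI R) (@measurable_unitI R) (mQ x) (Q0 x)).
  rewrite -ge0_integralZl//; last 2 first.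
  - by apply: measurable_funTS; exact: (measurable_sec2 x mS).
  - by move=> s _; exact: (S0 (x, s)).
  apply: ge0_le_integral => //.
  - by move=> s _; apply: integral_ge0 => y _; exact: (Q0 x (y, s)).
  - by apply: measurable_funTS; exact: (measurable_tonelliO2 (mQ x) (Q0 x)).
  - by apply: measurable_funeM; apply: measurable_funTS; exact: (measurable_sec2 x mS).
  move=> s Is.
  under eq_integral do rewrite mulrA EFinM /=.
  rewrite ge0_integralZl//.
  - rewrite muleC lee_wpmul2r//; first exact: (S0 (x, s)).
    by under eq_integral do rewrite kerC; exact: HC.
  - by apply/measurable_EFinP/measurable_funTS; exact: (measurable_sec1 s (measurable_ker r)).
  - by move=> y _; rewrite lee_fin ker_ge0.
  - exact: (S0 (x, s)).
apply: (le_trans step1).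
rewrite ge0_integralZl//; last 2 first.
- by apply: measurable_funTS; exact: (measurable_tonelliO1 mS S0).
- by move=> x _; apply: integral_ge0 => y _; exact: (S0 (x, y)).
rewrite EFinM -muleA lee_wpmul2l//.
rewrite (tonelliD_swap mu mu (@measurable_unitI R) (@measurable_unitI R) mS S0).
rewrite -ge0_integralZl//; last 2 first.
- by apply/measurable_EFinP/measurable_funTS.
- by move=> s _; rewrite lee_fin.
apply: ge0_le_integral => //.
- by move=> s _; apply: integral_ge0 => y _; exact: (S0 (y, s)).
- by apply: measurable_funTS; exact: (measurable_tonelliO2 mS S0).
- by apply: measurable_funeM; apply/measurable_EFinP/measurable_funTS.
move=> s Is.
under eq_integral do rewrite EFinM /=.
rewrite ge0_integralZl//.
- rewrite muleC lee_wpmul2r//; first by rewrite lee_fin.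
  by under eq_integral do rewrite kerC; exact: HC.
- by apply/measurable_EFinP/measurable_funTS; exact: (measurable_sec1 s (measurable_ker r)).
- by move=> y _; rewrite lee_fin ker_ge0.
- by rewrite lee_fin.
Qed.

End Slobodeckij1.

(** * Fractional seminorms on the square *)

Section PlaneMeasure.
Variable R : realType.

(** A copy of the plane measure under a name of its own, to which the
    sigma-finite structure required by Tonelli's theorem can be attached. *)
Definition planeM : set (plane R) -> \bar R := (@lebesgue_measure R \x @lebesgue_measure R)%E.

HB.instance Definition _ := Measure.copy planeM (@lebesgue_measure R \x @lebesgue_measure R)%E.

Lemma planeM_sigma_finite : sigma_finite setT planeM.
Proof.
have /sigma_finiteP[F [TF ndF Foo]] := sigma_finiteT (@lebesgue_measure R).
exists (fun n => F n `*` F n).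
  rewrite -setXTT {1 2}TF predeqE => -[x y]; split.
    move=> [/= [n _ Fnx] [k _ Gky]]; exists (maxn n k) => //; split.
    - by move: x Fnx; exact/subsetPset/ndF/leq_maxl.
    - by move: y Gky; exact/subsetPset/ndF/leq_maxr.
  by move=> [n _ []/= ? ?]; split; exists n.
move=> k; have [? ?] := Foo k.
split; first exact: measurableX.
by rewrite /planeM product_measure1E// lte_mul_pinfty// ge0_fin_numE.
Qed.

HB.instance Definition _ := Measure_isSigmaFinite.Build _ _ _ planeM planeM_sigma_finite.

Variable H : (plane R * plane R)%type -> \bar R.
Hypothesis mH : measurable_fun setT H.
Hypothesis H0 : forall z, (0 <= H z)%E.

Lemma tonelli_plane_swap :
  (\int[leb2]_(x in Omega) \int[leb2]_(y in Omega) H (x, y) =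
   \int[leb2]_(y in Omega) \int[leb2]_(x in Omega) H (x, y))%E.
Proof. exact: (tonelliD_swap planeM planeM (@measurable_Omega R) (@measurable_Omega R) mH H0). Qed.

Lemma measurable_tonelli_plane :
  measurable_fun setT (fun x : plane R => \int[leb2]_(y in Omega) H (x, y))%E.
Proof. exact: (measurable_tonelliF planeM (@measurable_Omega R) mH H0). Qed.

Lemma measurable_tonelli_planeO :
  measurable_fun (Omega : set (plane R)) (fun x : plane R => \int[leb2]_(y in Omega) H (x, y))%E.
Proof. by apply: measurable_funTS; exact: measurable_tonelli_plane. Qed.

Lemma integral_swap2 :
  (\int[leb2]_(y in Omega) \int[leb2]_(x in Omega) H (swap y, swap x) =
   \int[leb2]_(y in Omega) \int[leb2]_(x in Omega) H (y, x))%E.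
Proof.
pose F (y : R * R) := (\int[leb2]_(x in Omega) H (y, x))%E.
have F0 y : (0 <= F y)%E by apply: integral_ge0.
rewrite -[RHS](integral_swap_ge0 F0 measurable_tonelli_planeO).
apply: eq_integral => y _; rewrite /F.
pose h (x : R * R) := H (swap y, x).
have h0 x : (0 <= h x)%E by exact: H0.
have mh : measurable_fun (Omega : set (plane R)) h.
  by apply: measurable_funTS; apply: (measurableT_comp mH); exact: pair1_measurable.
exact: (integral_swap_ge0 h0 mh).
Qed.

End PlaneMeasure.

Lemma le_twice_add (R : realType) (a b x y : \bar R) (C : R) : (0 <= C)%R ->
  (0 <= x)%E -> (0 <= y)%E -> (a <= C%:E * x)%E -> (b <= C%:E * y)%E ->
  (2%:E * a + 2%:E * b <= (2 * C)%:E * (x + y))%E.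
Proof.
move=> C0 x0 y0 ax bY; rewrite ge0_muleDr// EFinM -!muleA.
by apply: leeD; rewrite lee_wpmul2l// lee_fin.
Qed.

Lemma ge0_integral_lin d (T : measurableType d) (R : realType)
    (mu : {measure set T -> \bar R}) (D : set T) (c : R) (f g : T -> \bar R) :
  measurable D -> (0 <= c)%R -> measurable_fun D f -> measurable_fun D g ->
  (forall x, D x -> 0 <= f x)%E -> (forall x, D x -> 0 <= g x)%E ->
  measurable_fun D (fun x => c%:E * f x + c%:E * g x)%E /\
  (\int[mu]_(x in D) (c%:E * f x + c%:E * g x) =
   c%:E * \int[mu]_(x in D) f x + c%:E * \int[mu]_(x in D) g x)%E.
Proof.
move=> mD c0 mf mg f0 g0.
have mcf : measurable_fun D (fun x => c%:E * f x)%E by exact: measurable_funeM.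
have mcg : measurable_fun D (fun x => c%:E * g x)%E by exact: measurable_funeM.
split; first exact: emeasurable_funD.
rewrite ge0_integralD//; last 2 first.
- by move=> x Dx; rewrite mule_ge0// f0.
- by move=> x Dx; rewrite mule_ge0// g0.
by rewrite !ge0_integralZl.
Qed.

Section Slobodeckij2.
Variable R : realType.
Notation mu := (@lebesgue_measure R).

(** Absolute continuity on almost every horizontal line, the form in which weak
    differentiability enters the fractional estimates. *)
Definition acl (u v : R * R -> R) : Prop :=
  {ae mu, forall x2, unitI x2 -> exists c, {ae mu, forall x1, unitI x1 ->
     u (x1, x2) = c - (\int[mu]_(t in unitI) (v (t, x2) * (x1 <= t)%R%:R))%R}}.

(** The part of a seminorm on the square that only sees horizontal increments;
    [p] is the exponent along the increment, [q] the transversal one. *)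
Definition horiz (u : R * R -> R) (p q : R) (z : (plane R * plane R)%type) : R :=
  (u (z.1.1, z.1.2) - u (z.2.1, z.1.2)) ^+ 2 * ker p z.1.1 z.2.1 * ker q z.1.2 z.2.2.

Lemma horiz_ge0 u p q z : 0 <= horiz u p q z.
Proof. by rewrite /horiz mulr_ge0 ?ker_ge0// mulr_ge0 ?ker_ge0 ?sqr_ge0. Qed.

Lemma measurable_horiz u p q : measurable_fun setT (u : plane R -> R) ->
  measurable_fun setT (horiz u p q).
Proof.
move=> mu_.
have m11 : measurable_fun setT (fun z : (plane R * plane R)%type => z.1.1).
  exact: (measurableT_comp measurable_fst measurable_fst).
have m12 : measurable_fun setT (fun z : (plane R * plane R)%type => z.1.2).
  exact: (measurableT_comp measurable_snd measurable_fst).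
have m21 : measurable_fun setT (fun z : (plane R * plane R)%type => z.2.1).
  exact: (measurableT_comp measurable_fst measurable_snd).
have m22 : measurable_fun setT (fun z : (plane R * plane R)%type => z.2.2).
  exact: (measurableT_comp measurable_snd measurable_snd).
apply: measurable_funM; first apply: measurable_funM.
- apply: measurable_funX; apply: measurable_funB.
    exact: (measurableT_comp mu_ (measurable_fun_pair m11 m12)).
  exact: (measurableT_comp mu_ (measurable_fun_pair m21 m12)).
- exact: (measurableT_comp (measurable_ker p) (measurable_fun_pair m11 m21)).
- exact: (measurableT_comp (measurable_ker q) (measurable_fun_pair m12 m22)).
Qed.

(** For fixed vertical coordinates the inner integral is that of
    [slobodeckij1]; the vertical kernel has exponent below 1 and integrates to
    a constant. *)
Lemma horiz_bound (r q : R) : 0 < r < 1 -> 0 < q < 1 -> exists2 C : R, 0 <= C &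
  forall (u v : R * R -> R),
  measurable_fun setT (u : plane R -> R) ->
  measurable_fun setT (v : plane R -> R) ->
  leb2.-integrable (Omega : set (plane R)) (EFin \o v) ->
  leb2.-integrable (Omega : set (plane R)) (EFin \o (fun x => v x ^+ 2)) ->
  acl u v ->
  (\int[leb2]_(x in Omega) \int[leb2]_(y in Omega) (horiz u (1 + (r + r)) q (x, y))%:E <=
   C%:E * \int[leb2]_(x in Omega) (v x ^+ 2)%:E)%E.
Proof.
move=> r01 q01.
have [Cq Cq0 HCq] := kernel_bound q01.
have [C1 C10 HC1] := slobodeckij1 r01.
exists (Cq * C1) => [|u v mu_ mv vi v2i Huv]; first exact: mulr_ge0.
set p := 1 + (r + r).
pose G (z : (plane R * measurableTypeR R)%type) : \bar R :=
  ((u (z.1.1, z.1.2) - u (z.2, z.1.2)) ^+ 2 * ker p z.1.1 z.2)%:E.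
have m11 : measurable_fun setT (fun z : (plane R * measurableTypeR R)%type => z.1.1).
  exact: (measurableT_comp measurable_fst measurable_fst).
have m12 : measurable_fun setT (fun z : (plane R * measurableTypeR R)%type => z.1.2).
  exact: (measurableT_comp measurable_snd measurable_fst).
have m2 : measurable_fun setT (fun z : (plane R * measurableTypeR R)%type => z.2).
  exact: measurable_snd.
have mG : measurable_fun setT G.
  apply/measurable_EFinP; apply: measurable_funM.
    apply: measurable_funX; apply: measurable_funB.
      exact: (measurableT_comp mu_ (measurable_fun_pair m11 m12)).
    exact: (measurableT_comp mu_ (measurable_fun_pair m2 m12)).
  exact: (measurableT_comp (measurable_ker p) (measurable_fun_pair m11 m2)).
have G0 z : (0 <= G z)%E by rewrite lee_fin mulr_ge0 ?ker_ge0 ?sqr_ge0.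
have mH : measurable_fun setT (fun z : (plane R * plane R)%type => (horiz u p q z)%:E).
  by apply/measurable_EFinP; exact: measurable_horiz.
have H0 z : (0 <= (horiz u p q z)%:E)%E by rewrite lee_fin horiz_ge0.
have mIG : measurable_fun setT (fun x : plane R => \int[mu]_(y1 in unitI) G (x, y1))%E.
  exact: (measurable_tonelliF mu (@measurable_unitI R) mG G0).
have IG0 x : (0 <= \int[mu]_(y1 in unitI) G (x, y1))%E by apply: integral_ge0 => y1 _; exact: G0.
apply: (@le_trans _ _ (\int[leb2]_(x in Omega) (Cq%:E * \int[mu]_(y1 in unitI) G (x, y1)))%E).
  apply: ge0_le_integral => //.
  - by move=> x _; apply: integral_ge0 => y _; exact: H0.
  - exact: (measurable_tonelli_planeO mH H0).
  - by apply: measurable_funTS; exact: measurable_funeM.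
  move=> x [x1I x2I].
  have mHx : measurable_fun setT (fun y : plane R => (horiz u p q (x, y))%:E).
    by apply: (measurableT_comp mH); exact: pair1_measurable.
  rewrite (tonelliO1 mHx (fun y => H0 (x, y))).
  rewrite -ge0_integralZl//; last first.
    by apply: measurable_funTS; apply: (measurableT_comp mG); exact: pair1_measurable.
  apply: ge0_le_integral => //.
  - by move=> y1 _; apply: integral_ge0 => y _; exact: H0.
  - by apply: measurable_funTS; exact: (measurable_tonelliO1 mHx (fun y => H0 (x, y))).
  - apply: measurable_funTS; apply: measurable_funeM.
    by apply: (measurableT_comp mG); exact: pair1_measurable.
  move=> y1 _; rewrite /horiz /=.
  under eq_integral do rewrite EFinM /=.
  rewrite ge0_integralZl//.
  - by rewrite muleC lee_wpmul2r//; [exact: (G0 (x, y1))|exact: HCq].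
  - by apply/measurable_EFinP/measurable_funTS; exact: (measurable_sec2 x.2 (measurable_ker q)).
  - by move=> y _; rewrite lee_fin ker_ge0.
  - exact: (G0 (x, y1)).
rewrite ge0_integralZl//; last by apply: measurable_funTS.
rewrite EFinM -muleA lee_wpmul2l//.
have mv2 : measurable_fun setT (fun x : plane R => (v x ^+ 2)%:E).
  by apply/measurable_EFinP; exact: measurable_funX.
have v20 (x : plane R) : (0 <= (v x ^+ 2)%:E)%E by rewrite lee_fin sqr_ge0.
rewrite (tonelliO2 mIG IG0) (tonelliO2 mv2 v20).
rewrite -ge0_integralZl//; last 2 first.
- by apply: measurable_funTS; exact: (measurable_tonelliO2 mv2 v20).
- by move=> x2 _; apply: integral_ge0 => x1 _.
apply: ae_ge0_le_integral => //.
- by move=> x2 _; apply: integral_ge0 => x1 _.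
- by apply: measurable_funTS; exact: (measurable_tonelliO2 mIG IG0).
- by move=> x2 _; rewrite mule_ge0//; apply: integral_ge0 => x1 _.
- by apply: measurable_funTS; apply: measurable_funeM; exact: (measurable_tonelliO2 mv2 v20).
apply: (ae_imp2 Huv (ae_imp2 (section_integrable2 vi) (section_integrable2 v2i) (fun x a b => conj a b))) => x2 H1 [H2 H3] Ix2.
have [c Hc] := H1 Ix2.
apply: (HC1 (fun t => u (t, x2)) (fun t => v (t, x2)) c) => //.
- exact: (measurable_sec1 x2 mu_).
- exact: (measurable_sec1 x2 mv).
- exact: H2.
- have /integrableP[_] := H3 Ix2; apply: le_lt_trans.
  apply: ge0_le_integral => //.
  + by apply: measurable_funTS; exact: (measurable_sec1 x2 mv2).
  + by apply: measurable_funTS; apply: measurableT_comp => //; exact: (measurable_sec1 x2 mv2).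
  + by move=> s _ /=; rewrite lee_fin ler_norm.
Qed.

(** The real counterpart of [slobodeckij]. *)
Definition slobR (s : R) (u : R * R -> R) : \bar R :=
  (\int[leb2]_(x in Omega) \int[leb2]_(y in Omega)
     ((u x - u y) ^+ 2 / (eucl_dist x y) `^ (2 + 2 * s))%:E)%E.

Lemma eucl_dist_ge1 (x y : R * R) : `|x.1 - y.1| <= eucl_dist x y.
Proof.
rewrite /eucl_dist -sqrtr_sqr ler_sqrt ?addr_ge0 ?sqr_ge0//.
by rewrite lerDl sqr_ge0.
Qed.

Lemma eucl_dist_ge2 (x y : R * R) : `|x.2 - y.2| <= eucl_dist x y.
Proof.
rewrite /eucl_dist -sqrtr_sqr ler_sqrt ?addr_ge0 ?sqr_ge0//.
by rewrite lerDr sqr_ge0.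
Qed.

Lemma eucl_dist_ge0 (x y : R * R) : 0 <= eucl_dist x y.
Proof. exact: sqrtr_ge0. Qed.

Lemma measurable_eucl : measurable_fun setT (fun z : (plane R * plane R)%type => eucl_dist z.1 z.2).
Proof.
have ms : measurable_fun setT (fun t : measurableTypeR R => Num.sqrt (t : R)).
  by apply: continuous_measurable_fun; exact: sqrt_continuous.
apply: (measurableT_comp ms).
have m11 : measurable_fun setT (fun z : (plane R * plane R)%type => z.1.1).
  exact: (measurableT_comp measurable_fst measurable_fst).
have m12 : measurable_fun setT (fun z : (plane R * plane R)%type => z.1.2).
  exact: (measurableT_comp measurable_snd measurable_fst).
have m21 : measurable_fun setT (fun z : (plane R * plane R)%type => z.2.1).
  exact: (measurableT_comp measurable_fst measurable_snd).
have m22 : measurable_fun setT (fun z : (plane R * plane R)%type => z.2.2).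
  exact: (measurableT_comp measurable_snd measurable_snd).
by apply: measurable_funD; apply: measurable_funX; exact: measurable_funB.
Qed.

Definition slobK (s : R) (u : R * R -> R) (z : (plane R * plane R)%type) : R :=
  (u z.1 - u z.2) ^+ 2 / (eucl_dist z.1 z.2) `^ (2 + 2 * s).

Lemma slobK_ge0 s u z : 0 <= slobK s u z.
Proof. by rewrite /slobK divr_ge0 ?sqr_ge0 ?powR_ge0. Qed.

Lemma measurable_slobK s u : measurable_fun setT (u : plane R -> R) ->
  measurable_fun setT (slobK s u).
Proof.
move=> mu_; rewrite /slobK.
rewrite (_ : (fun _ => _) = (fun z : (plane R * plane R)%type => (u z.1 - u z.2) ^+ 2 * (eucl_dist z.1 z.2) `^ (- (2 + 2 * s)))); last first.
  by apply/funext => z; rewrite powRN.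
apply: measurable_funM.
  apply: measurable_funX; apply: measurable_funB.
    exact: (measurableT_comp mu_ measurable_fst).
  exact: (measurableT_comp mu_ measurable_snd).
exact: (measurableT_comp (measurable_powR _) measurable_eucl).
Qed.

Lemma inv_powR_le (a b t : R) : 0 <= t -> 0 < a -> a <= b -> b `^ (- t) <= a `^ (- t).
Proof.
move=> t0 a0 ab; have b0 := lt_le_trans a0 ab.
rewrite !powRN lef_pV2 ?posrE ?powR_gt0//.
by apply: ge0_ler_powR => //; rewrite nnegrE ltW.
Qed.

(** The Euclidean distance dominates both coordinate distances, so its negative
    power can be split into two one-dimensional kernels in either order. *)
Lemma ker_eucl (p q s : R) (x y : R * R) : 0 <= p -> 0 <= q -> p + q = 2 + 2 * s ->
  x.1 != y.1 -> x.2 != y.2 ->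
  (eucl_dist x y `^ (2 + 2 * s))^-1 <= ker p x.1 y.1 * ker q x.2 y.2 /\
  (eucl_dist x y `^ (2 + 2 * s))^-1 <= ker p x.2 y.2 * ker q x.1 y.1.
Proof.
move=> p0 q0 <- d1 d2.
have d10 : 0 < `|x.1 - y.1| by rewrite normr_gt0 subr_eq0.
have d20 : 0 < `|x.2 - y.2| by rewrite normr_gt0 subr_eq0.
have e1 := eucl_dist_ge1 x y; have e2 := eucl_dist_ge2 x y.
have e0 : eucl_dist x y != 0 by rewrite gt_eqF// (lt_le_trans d10).
rewrite -powRN opprD powRD; last by rewrite e0 implybT.
by split; apply: ler_pM; rewrite ?powR_ge0//; apply: inv_powR_le.
Qed.

Lemma ae_neq_plane (c : R * R) : {ae leb2, forall y : plane R, y.1 <> c.1 /\ y.2 <> c.2}.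
Proof.
pose A1 : set (plane R) := [set c.1] `*` setT.
pose A2 : set (plane R) := setT `*` [set c.2].
have mA1 : measurable A1 by apply: measurableX => //; exact: measurable_set1.
have mA2 : measurable A2 by apply: measurableX => //; exact: measurable_set1.
have z1 : leb2 A1 = 0%E.
  have := product_measure1E mu mu (measurable_set1 c.1) (@measurableT _ (measurableTypeR R)).
  move=> E; apply: (etrans E); rewrite -[RHS](mul0e (mu setT)).
  by congr (_ * _)%E; exact: lebesgue_measure_set1.
have z2 : leb2 A2 = 0%E.
  have := product_measure1E mu mu (@measurableT _ (measurableTypeR R)) (measurable_set1 c.2).
  move=> E; apply: (etrans E); rewrite -[RHS](mule0 (mu setT)).
  by congr (_ * _)%E; exact: lebesgue_measure_set1.
have n1 : {ae leb2, forall y : plane R, y.1 <> c.1}.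
  exists A1; split => //= y H; split => //=.
  by apply: contrapT => tc; apply: H.
have n2 : {ae leb2, forall y : plane R, y.2 <> c.2}.
  exists A2; split => //= y H; split => //=.
  by apply: contrapT => tc; apply: H.
exact: (ae_imp2 n1 n2).
Qed.

(** An increment between two points of the square is a horizontal one followed
    by a vertical one.  The total exponent [2 + 2 s] is shared out as
    [p + q] with [q < 1] for the direction that is not differentiated and
    [p = 1 + 2 r], [r < 1], for the other; such a choice exists as [s < 1]. *)
Lemma slobodeckij2 (s : R) : 0 < s < 1 -> exists2 C : R, 0 <= C &
  forall (u v1 v2 : R * R -> R),
  measurable_fun setT (u : plane R -> R) ->
  measurable_fun setT (v1 : plane R -> R) ->
  measurable_fun setT (v2 : plane R -> R) ->
  leb2.-integrable (Omega : set (plane R)) (EFin \o v1) ->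
  leb2.-integrable (Omega : set (plane R)) (EFin \o v2) ->
  leb2.-integrable (Omega : set (plane R)) (EFin \o (fun x => v1 x ^+ 2)) ->
  leb2.-integrable (Omega : set (plane R)) (EFin \o (fun x => v2 x ^+ 2)) ->
  acl u v1 -> acl (u \o swap) (v2 \o swap) ->
  (slobR s u <= C%:E * (\int[leb2]_(x in Omega) (v1 x ^+ 2)%:E + \int[leb2]_(x in Omega) (v2 x ^+ 2)%:E))%E.
Proof.
move=> /andP[s0 s1].
(* [1 + 2 r + q = 2 + 2 s], with both [r] and [q] below 1 *)
pose r := (1 + 3 * s) / 4; pose q := (1 + s) / 2.
have r01 : 0 < r < 1 by rewrite /r; apply/andP; split; lra.
have q01 : 0 < q < 1 by rewrite /q; apply/andP; split; lra.
have [C C0 HC] := horiz_bound r01 q01.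
exists (2 * C) => [|u v1 v2 mu_ mv1 mv2 i1 i2 j1 j2 a1 a2]; first by rewrite mulr_ge0.
set p := 1 + (r + r) in HC.
have pq : p + q = 2 + 2 * s by rewrite /p /q /r; lra.
have p0 : 0 <= p by rewrite /p /r; lra.
have q0 : 0 <= q by rewrite /q; lra.
have mus : measurable_fun setT (u \o swap : plane R -> R).
  by apply: measurableT_comp => //; exact: measurable_swap.
have mv2s : measurable_fun setT (v2 \o swap : plane R -> R).
  by apply: measurableT_comp => //; exact: measurable_swap.
have B1 := HC u v1 mu_ mv1 i1 j1 a1.
have B2 := HC _ _ mus mv2s (integrable_swap i2) (integrable_swap j2) a2.
pose H1 (z : (plane R * plane R)%type) : \bar R := (horiz u p q z)%:E.
pose H2 (z : (plane R * plane R)%type) : \bar R := (horiz (u \o swap) p q (swap z.2, swap z.1))%:E.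
have mswap : measurable_fun setT (@swap R R : plane R -> plane R) by exact: measurable_swap.
have mH1 : measurable_fun setT H1 by apply/measurable_EFinP; exact: measurable_horiz.
have mH2 : measurable_fun setT H2.
  apply/measurable_EFinP; apply: (measurableT_comp (measurable_horiz p q mus)).
  by apply: measurable_fun_pair; [exact: (measurableT_comp mswap measurable_snd)|exact: (measurableT_comp mswap measurable_fst)].
have H10 z : (0 <= H1 z)%E by rewrite lee_fin horiz_ge0.
have H20 z : (0 <= H2 z)%E by rewrite lee_fin horiz_ge0.
have mK : measurable_fun setT (fun z => (slobK s u z)%:E) by apply/measurable_EFinP; exact: measurable_slobK.
have K0 z : (0 <= (slobK s u z)%:E)%E by rewrite lee_fin slobK_ge0.
have pt (x y : R * R) : x.1 != y.1 -> x.2 != y.2 ->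
    slobK s u (x, y) <= 2 * horiz u p q (x, y) + 2 * horiz (u \o swap) p q (swap y, swap x).
  move=> d1 d2; have [k1 k2] := ker_eucl p0 q0 pq d1 d2.
  rewrite /slobK /horiz /swap /=.
  case: x y d1 d2 k1 k2 => [x1 x2] [y1 y2] /= d1 d2 k1 k2.
  rewrite (kerC p y2) (kerC q y1).
  set A := u (x1, x2) - u (y1, x2); set B := u (y1, y2) - u (y1, x2).
  have -> : u (x1, x2) - u (y1, y2) = A - B by rewrite /A /B; ring.
  set K := (_ `^ _)^-1 in k1 k2 *.
  have K_0 : 0 <= K by rewrite invr_ge0 powR_ge0.
  apply: (@le_trans _ _ (2 * (A ^+ 2 * K) + 2 * (B ^+ 2 * K))).
    rewrite -subr_ge0 (_ : _ - _ = (A + B) ^+ 2 * K); last by ring.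
    by rewrite mulr_ge0 ?sqr_ge0.
  rewrite -(mulrA (A ^+ 2)) -(mulrA (B ^+ 2)).
  by apply: lerD; rewrite ler_wpM2l//; apply: ler_wpM2l; rewrite ?sqr_ge0.
have I10 x : (0 <= \int[leb2]_(y in Omega) H1 (x, y))%E by apply: integral_ge0.
have I20 x : (0 <= \int[leb2]_(y in Omega) H2 (x, y))%E by apply: integral_ge0.
have mO1 := measurable_tonelli_planeO mH1 H10.
have mO2 := measurable_tonelli_planeO mH2 H20.
have [mL EL] := ge0_integral_lin leb2 (@measurable_Omega R) (ler0n R 2) mO1 mO2 (fun x _ => I10 x) (fun x _ => I20 x).
apply: (@le_trans _ _ (\int[leb2]_(x in Omega) (2%:E * (\int[leb2]_(y in Omega) H1 (x, y)) + 2%:E * (\int[leb2]_(y in Omega) H2 (x, y))))%E).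
  rewrite /slobR; apply: ge0_le_integral => //.
  - by move=> x _; apply: integral_ge0 => y _; exact: (K0 (x, y)).
  - exact: (measurable_tonelli_planeO mK K0).
  move=> x _.
  have mx (f : (plane R * plane R)%type -> \bar R) : measurable_fun setT f -> measurable_fun Omega (fun y : plane R => f (x, y)).
    by move=> mf; apply: measurable_funTS; apply: (measurableT_comp mf); exact: pair1_measurable.
  have [mLx ELx] := ge0_integral_lin leb2 (@measurable_Omega R) (ler0n R 2) (mx _ mH1) (mx _ mH2) (fun y _ => H10 (x, y)) (fun y _ => H20 (x, y)).
  rewrite -ELx.
  apply: ae_ge0_le_integral => //.
  - by move=> y _; exact: (K0 (x, y)).
  - exact: (mx _ mK).
  - by move=> y _; rewrite adde_ge0// mule_ge0.
  apply: (ae_imp (ae_neq_plane x)) => y [y1 y2] _.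
  rewrite /H1 /H2 -!EFinM -EFinD lee_fin; apply: pt.
    by apply/eqP => E; apply: y1.
  by apply/eqP => E; apply: y2.
rewrite EL.
have J1 : (0 <= \int[leb2]_(x in Omega) (v1 x ^+ 2)%:E)%E by apply: integral_ge0 => x _; rewrite lee_fin sqr_ge0.
have J2 : (0 <= \int[leb2]_(x in Omega) (v2 x ^+ 2)%:E)%E by apply: integral_ge0 => x _; rewrite lee_fin sqr_ge0.
apply: (le_twice_add C0 J1 J2); first exact: B1.
rewrite (tonelli_plane_swap mH2 H20).
pose H3 (z : (plane R * plane R)%type) : \bar R := (horiz (u \o swap) p q z)%:E.
have mH3 : measurable_fun setT H3 by apply/measurable_EFinP; exact: measurable_horiz.
have H30 z : (0 <= H3 z)%E by rewrite lee_fin horiz_ge0.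
have E1 := integral_swap2 mH3 H30.
rewrite E1; apply: (le_trans B2); apply: lee_wpmul2l; first by rewrite lee_fin.
pose g (x : R * R) : \bar R := (v2 x ^+ 2)%:E.
have g0 x : (0 <= g x)%E by rewrite lee_fin sqr_ge0.
have mg : measurable_fun (Omega : set (plane R)) g.
  by apply: measurable_funTS; apply/measurable_EFinP; exact: measurable_funX.
have E2 := integral_swap_ge0 g0 mg.
by rewrite -/(g _) -E2.
Qed.

End Slobodeckij2.

(** * Square integrable real functions and weak gradients *)

Lemma integral_Omega_cst (R : realType) (c : \bar R) :
  (\int[leb2]_(x in (Omega : set (plane R))) c = c)%E.
Proof.
rewrite integral_cst; last exact: measurable_Omega.
by rewrite -[RHS]mule1; congr (_ * _)%E; exact: leb2_Omega.
Qed.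

Section RealL2.
Variable R : realType.
Notation mu := (@lebesgue_measure R).
Implicit Types (u v w : R * R -> R).

(** Square integrability on the square of a function that is measurable on the
    whole plane, so that its sections are measurable as well. *)
Definition rL2 u : Prop := measurable_fun setT (u : plane R -> R) /\
  (\int[leb2]_(x in Omega) (u x ^+ 2)%:E < +oo)%E.

Definition ip u v : R := (\int[leb2]_(x in Omega) (u x * v x))%R.

Lemma rL2_measurable u (D : set (plane R)) : measurable D -> rL2 u ->
  measurable_fun D (u : plane R -> R).
Proof. by move=> mD [mu_ _]; exact: measurable_funTS. Qed.

Lemma rL2_sqr_integrable u : rL2 u ->
  leb2.-integrable (Omega : set (plane R)) (EFin \o (fun x => u x ^+ 2)).
Proof.
move=> [mu_ u2]; apply/integrableP; split.
  by apply/measurable_EFinP; apply: measurable_funTS; exact: measurable_funX.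
by under eq_integral do rewrite /= ger0_norm ?sqr_ge0//.
Qed.

Lemma rL2_mul_integrable u v : rL2 u -> rL2 v ->
  leb2.-integrable (Omega : set (plane R)) (EFin \o (fun x => u x * v x)).
Proof.
move=> Lu Lv.
have I : leb2.-integrable (Omega : set (plane R)) (EFin \o (fun x => u x ^+ 2 + v x ^+ 2)).
  rewrite (_ : EFin \o _ = (EFin \o (fun x => (u x ^+ 2)%R)) \+ (EFin \o (fun x => (v x ^+ 2)%R)))%E; last by apply/funext.
  by apply: integrableD => //; exact: rL2_sqr_integrable.
apply: le_integrable I => //.
  by apply/measurable_EFinP; apply: measurable_funM; exact: rL2_measurable.
move=> x _ /=; rewrite lee_fin [leRHS]ger0_norm ?addr_ge0 ?sqr_ge0// normrM.
rewrite -(real_normK (num_real (u x))) -(real_normK (num_real (v x))).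
have := sqr_ge0 (`|u x| - `|v x|); have := normr_ge0 (u x); have := normr_ge0 (v x).
move: `|u x| `|v x| => s t s0 t0; rewrite sqrrB; nra.
Qed.

Lemma rL2_cst (c : R) : rL2 (fun=> c).
Proof.
split; first exact: measurable_cst.
by rewrite integral_Omega_cst ltry.
Qed.

Lemma rL2_integrable u : rL2 u -> leb2.-integrable (Omega : set (plane R)) (EFin \o u).
Proof.
move=> Lu; have := rL2_mul_integrable Lu (rL2_cst 1).
by under [X in EFin \o X]eq_fun do rewrite mulr1.
Qed.

Lemma rL2_mulb u (k : R * R -> R) (C : R) : rL2 u ->
  measurable_fun setT (k : plane R -> R) -> (forall x, Omega x -> `|k x| <= C) ->
  rL2 (fun x => u x * k x).
Proof.
move=> Lu mk kC; split; first by apply: measurable_funM => //; exact: Lu.1.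
have I : leb2.-integrable (Omega : set (plane R)) (EFin \o (fun x => u x ^+ 2 * k x ^+ 2)).
  apply: (integrable_mulb (C := C ^+ 2)) => //; first exact: rL2_sqr_integrable.
    by apply: measurable_funTS; exact: measurable_funX.
  by move=> x Ox; rewrite normrX lerXn2r ?nnegrE ?kC// (le_trans _ (kC x Ox)).
case/integrableP : I => _; apply: le_lt_trans; rewrite le_eqVlt; apply/orP; left; apply/eqP.
by apply: eq_integral => x _ /=; rewrite -exprMn ger0_norm ?sqr_ge0.
Qed.

Lemma rL2Z (c : R) u : rL2 u -> rL2 (fun x => c * u x).
Proof.
move=> Lu; have := @rL2_mulb u (fun=> c) `|c| Lu (measurable_cst _) (fun _ _ => lexx _).
by under eq_fun do rewrite mulrC.
Qed.

Lemma rL2D u v : rL2 u -> rL2 v -> rL2 (fun x => u x + v x).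
Proof.
move=> Lu Lv; split; first by apply: measurable_funD; [exact: Lu.1|exact: Lv.1].
have I : leb2.-integrable (Omega : set (plane R)) (EFin \o (fun x => u x ^+ 2 + v x ^+ 2)).
  rewrite (_ : EFin \o _ = (EFin \o (fun x => (u x ^+ 2)%R)) \+ (EFin \o (fun x => (v x ^+ 2)%R)))%E; last by apply/funext.
  by apply: integrableD => //; exact: rL2_sqr_integrable.
have := integrableZl (@measurable_Omega R) 2 I => /integrableP[_]; apply: le_lt_trans.
apply: ge0_le_integral => //.
- by move=> x _; rewrite lee_fin sqr_ge0.
- apply/measurable_EFinP; apply: measurable_funX; apply: measurable_funD.
    exact: rL2_measurable.
  exact: rL2_measurable.
- apply: measurableT_comp => //; apply: measurable_funeM.
  exact: measurable_int I.
- move=> x _ /=; rewrite lee_fin; apply: le_trans (ler_norm _).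
  have := sqr_ge0 (u x - v x); move: (u x) (v x) => s t; nra.
Qed.

Lemma rL2B u v : rL2 u -> rL2 v -> rL2 (fun x => u x - v x).
Proof.
move=> Lu Lv; have := rL2D Lu (rL2Z (-1) Lv).
by under eq_fun do rewrite mulN1r.
Qed.

Lemma rL2_sum (I : Type) (s : seq I) (f : I -> R * R -> R) :
  (forall i, rL2 (f i)) -> rL2 (fun x => \sum_(i <- s) f i x).
Proof.
move=> Lf; elim: s => [|i s IH].
  by under eq_fun do rewrite big_nil; exact: rL2_cst.
by under eq_fun do rewrite big_cons; exact: rL2D.
Qed.

Lemma rL2_swap u : rL2 u -> rL2 (u \o swap).
Proof.
move=> Lu; split.
  by apply: measurableT_comp; [exact: Lu.1|exact: measurable_swap].
have := integral_swap_ge0 (f := fun x => (u x ^+ 2)%:E) => /= ->; first exact: Lu.2.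
- by move=> x; rewrite lee_fin sqr_ge0.
- by apply/measurable_EFinP; apply: measurable_funTS; apply: measurable_funX; exact: Lu.1.
Qed.

Lemma ipC u v : ip u v = ip v u.
Proof. by apply: eq_Rintegral => x _; rewrite mulrC. Qed.

Lemma ipDl u v w : rL2 u -> rL2 v -> rL2 w -> ip (fun x => u x + v x) w = ip u w + ip v w.
Proof.
move=> Lu Lv Lw; rewrite /ip -RintegralD//; [|exact: rL2_mul_integrable|exact: rL2_mul_integrable].
by apply: eq_Rintegral => x _; rewrite mulrDl.
Qed.

Lemma ipZl (c : R) u w : rL2 u -> rL2 w -> ip (fun x => c * u x) w = c * ip u w.
Proof.
move=> Lu Lw; rewrite /ip -RintegralZl//; last exact: rL2_mul_integrable.
by apply: eq_Rintegral => x _; rewrite mulrA.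
Qed.

Lemma ipBl u v w : rL2 u -> rL2 v -> rL2 w -> ip (fun x => u x - v x) w = ip u w - ip v w.
Proof.
move=> Lu Lv Lw; rewrite /ip -RintegralB//; [|exact: rL2_mul_integrable|exact: rL2_mul_integrable].
by apply: eq_Rintegral => x _; rewrite mulrBl.
Qed.

Lemma ip_suml (I : Type) (s : seq I) (f : I -> R * R -> R) w :
  (forall i, rL2 (f i)) -> rL2 w ->
  ip (fun x => \sum_(i <- s) f i x) w = \sum_(i <- s) ip (f i) w.
Proof.
move=> Lf Lw; elim: s => [|i s IH].
  rewrite big_nil /ip; under eq_Rintegral do rewrite big_nil mul0r.
  by rewrite Rintegral_cst// mul0r.
rewrite big_cons -IH -ipDl//; last exact: rL2_sum.
by apply: eq_Rintegral => x _; rewrite big_cons.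
Qed.

Lemma ip_ge0 u : 0 <= ip u u.
Proof. by apply: Rintegral_ge0 => x _; rewrite -expr2 sqr_ge0. Qed.

Lemma ipE u : rL2 u -> (\int[leb2]_(x in Omega) (u x ^+ 2)%:E = (ip u u)%:E)%E.
Proof.
move=> Lu; rewrite /ip /Rintegral fineK.
  by apply: eq_integral => x _; rewrite expr2.
by apply: integrable_fin_num => //; exact: rL2_mul_integrable.
Qed.

Lemma ip_abs u v : rL2 u -> rL2 v ->
  (\int[leb2]_(x in Omega) `|u x * v x| <= Num.sqrt (ip u u) * Num.sqrt (ip v v))%R.
Proof.
move=> Lu Lv; rewrite -lee_fin /Rintegral fineK; last first.
  apply: integrable_fin_num => //.
  apply: eq_integrable (integrable_abse (rL2_mul_integrable Lu Lv)) => //.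
by apply: cauchy_schwarz; rewrite ?sqrtr_ge0 ?sqr_sqrtr ?ip_ge0 ?ipE//; exact: rL2_measurable.
Qed.

Lemma ip_cs u v : rL2 u -> rL2 v ->
  `|ip u v| <= Num.sqrt (ip u u) * Num.sqrt (ip v v).
Proof.
move=> Lu Lv; apply: le_trans (ip_abs Lu Lv).
by apply: le_normr_Rintegral => //; exact: rL2_mul_integrable.
Qed.

Lemma ip_le u v : rL2 u -> rL2 v -> (forall x, Omega x -> `|u x| <= `|v x|) ->
  ip u u <= ip v v.
Proof.
move=> Lu Lv H; rewrite -lee_fin -!ipE//; apply: ge0_le_integral => //.
- by move=> x _; rewrite lee_fin sqr_ge0.
- by apply/measurable_EFinP; apply: measurable_funX; exact: rL2_measurable.
- by apply/measurable_EFinP; apply: measurable_funX; exact: rL2_measurable.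
- move=> x Ox; rewrite lee_fin -(real_normK (num_real (u x))) -(real_normK (num_real (v x))).
  by rewrite lerXn2r ?nnegrE//; exact: H.
Qed.

Lemma ip_sqrD u v : rL2 u -> rL2 v ->
  ip (fun x => u x + v x) (fun x => u x + v x) <= 2 * ip u u + 2 * ip v v.
Proof.
move=> Lu Lv.
have H : ip (fun x => u x - v x) (fun x => u x - v x) = ip u u - 2 * ip u v + ip v v.
  rewrite ipBl//; last exact: rL2B.
  rewrite [ip u _]ipC [ip v (fun _ => _)]ipC !ipBl// (ipC v u); ring.
have E : ip (fun x => u x + v x) (fun x => u x + v x) = ip u u + 2 * ip u v + ip v v.
  rewrite ipDl//; last exact: rL2D.
  rewrite [ip u _]ipC [ip v (fun _ => _)]ipC !ipDl// (ipC v u); ring.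
have := ip_ge0 (fun x => u x - v x); rewrite H E; lra.
Qed.

Lemma ae_eq_ip u u' v : rL2 u -> rL2 u' -> rL2 v ->
  {ae leb2, forall x, Omega x -> u x = u' x} -> ip u v = ip u' v.
Proof.
move=> Lu Lu' Lv H; apply: ae_eq_Rintegral => //.
- by apply: measurable_funM; exact: rL2_measurable.
- by apply: measurable_funM; exact: rL2_measurable.
- by apply: (ae_imp H) => x + Ox => /(_ Ox) ->.
Qed.

(** Testing against products is enough for absolute continuity on lines. *)
Definition weak_grad u v1 v2 : Prop := [/\ rL2 u, rL2 v1, rL2 v2,
  forall g1 g2, test1 g1 -> test1 g2 ->
    ip u (tensor (derive1 g1) g2) = - ip v1 (tensor g1 g2) &
  forall g1 g2, test1 g1 -> test1 g2 ->
    ip u (tensor g1 (derive1 g2)) = - ip v2 (tensor g1 g2)].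

Lemma test1_derive (g : R -> R) : test1 g -> test1 (derive1 g).
Proof.
move=> [sg [a [b [a0 b1 gz]]]]; split; first exact: (smooth1_derive sg).2.
exists (a / 2), ((1 + b) / 2); split; [lra|lra|] => x xab.
have E : \forall y \near x, cst (0 : R) y = g y.
  have [xa|ax] := ltP x a.
    near=> y; rewrite /cst gz// => /andP[ya _].
    by have : y < a; [near: y; exact: lt_nbhsl|lra].
  have bx : b < x.
    rewrite ltNge; apply/negP => xb; apply: xab; apply/andP; split; lra.
  near=> y; rewrite /cst gz// => /andP[_ yb].
  by have : b < y; [near: y; exact: lt_nbhsr|lra].
rewrite derive1E.
have := @near_eq_is_derive R R^o R^o _ _ x 1 0 E (is_derive_cst (0 : R) x 1) => H.
exact: derive_val.
Unshelve. all: by end_near. Qed.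

Lemma rL2_tensor (g1 g2 : R -> R) : test1 g1 -> test1 g2 -> rL2 (tensor g1 g2).
Proof.
move=> t1 t2.
have [C1 C10 H1] := test1_bounded t1; have [C2 C20 H2] := test1_bounded t2.
have := @rL2_mulb (fun=> 1) (tensor g1 g2) (C1 * C2) (rL2_cst 1).
under eq_fun do rewrite mul1r; apply.
- by apply: measurable_tensor => //; [exact: t1.1|exact: t2.1].
- by move=> x _; rewrite normrM ler_pM.
Qed.

(** The vertical derivative is treated by exchanging the coordinates. *)
Lemma weak_grad_acl u v1 v2 : weak_grad u v1 v2 ->
  acl u v1 /\ acl (u \o swap) (v2 \o swap).
Proof.
move=> [Lu L1 L2 H1 H2]; split.
  apply: acl1; [exact: L1.1|exact: rL2_integrable|exact: rL2_integrable|].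
  by move=> g1 g2 t1 t2; exact: H1.
apply: acl1.
- exact: (rL2_swap L2).1.
- exact: rL2_integrable (rL2_swap Lu).
- exact: rL2_integrable (rL2_swap L2).
move=> g1 g2 t1 t2; have := H2 g2 g1 t2 t1; rewrite /ip.
have I w g g' : rL2 w -> test1 g -> test1 g' -> leb2.-integrable (Omega : set (plane R)) (EFin \o (fun x => w x * tensor g g' x)).
  by move=> Lw t t'; apply: rL2_mul_integrable => //; exact: rL2_tensor.
rewrite -(Rintegral_swap (I _ _ _ Lu t2 (test1_derive t1))).
rewrite -(Rintegral_swap (I _ _ _ L2 t2 t1)) => E.
transitivity (\int[leb2]_(x in Omega) (u (swap x) * tensor g2 (derive1 g1) (swap x)))%R.
  by apply: eq_Rintegral => x _; rewrite /tensor /swap /= mulrC [X in _ = _ * X]mulrC mulrC.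
rewrite E; congr (- _).
by apply: eq_Rintegral => x _; rewrite /tensor /swap /= [X in _ * X = _]mulrC.
Qed.

Lemma slobodeckij_weak (s : R) : 0 < s < 1 -> exists2 C : R, 0 <= C &
  forall u v1 v2, weak_grad u v1 v2 ->
  (slobR s u <= (C * (ip v1 v1 + ip v2 v2))%:E)%E.
Proof.
move=> s01; have [C C0 HC] := slobodeckij2 s01; exists C => // u v1 v2 W.
have [a1 a2] := weak_grad_acl W; have [Lu L1 L2 _ _] := W.
have := HC u v1 v2 Lu.1 L1.1 L2.1 (rL2_integrable L1) (rL2_integrable L2)
  (rL2_sqr_integrable L1) (rL2_sqr_integrable L2) a1 a2.
by rewrite !ipE// EFinM EFinD.
Qed.

End RealL2.

(** * Interpolation and the Poincare inequality on cells *)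

Section DoubleIntegral.
Variable R : realType.
Local Open Scope ereal_scope.

Lemma double_integral_le (K1 K2 K3 : (plane R * plane R)%type -> \bar R) (a b : R) :
  measurable_fun setT K1 -> measurable_fun setT K2 -> measurable_fun setT K3 ->
  (forall z, 0 <= K1 z) -> (forall z, 0 <= K2 z) -> (forall z, 0 <= K3 z) ->
  (0 <= a)%R -> (0 <= b)%R ->
  (forall z, K1 z <= a%:E * K2 z + b%:E * K3 z) ->
  \int[leb2]_(x in Omega) \int[leb2]_(y in Omega) K1 (x, y) <=
  a%:E * (\int[leb2]_(x in Omega) \int[leb2]_(y in Omega) K2 (x, y)) +
  b%:E * (\int[leb2]_(x in Omega) \int[leb2]_(y in Omega) K3 (x, y)).
Proof.
move=> m1 m2 m3 p1 p2 p3 a0 b0 H.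
have sec (K : (plane R * plane R)%type -> \bar R) x : measurable_fun setT K ->
    measurable_fun Omega (fun y : plane R => K (x, y)).
  by move=> mK; apply: measurable_funTS; apply: (measurableT_comp mK); exact: pair1_measurable.
have mO2 := measurable_tonelli_planeO m2 p2.
have mO3 := measurable_tonelli_planeO m3 p3.
have I0 (K : (plane R * plane R)%type -> \bar R) x : (forall z, 0 <= K z) -> 0 <= \int[leb2]_(y in Omega) K (x, y).
  by move=> K0; apply: integral_ge0.
have lin (f g : plane R -> \bar R) : measurable_fun Omega f -> measurable_fun Omega g ->
    (forall x, 0 <= f x) -> (forall x, 0 <= g x) ->
    measurable_fun Omega (fun x => a%:E * f x + b%:E * g x) /\
    \int[leb2]_(x in Omega) (a%:E * f x + b%:E * g x) =
    a%:E * \int[leb2]_(x in Omega) f x + b%:E * \int[leb2]_(x in Omega) g x.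
  move=> mf mg f0 g0.
  have maf : measurable_fun Omega (fun x => a%:E * f x) by exact: measurable_funeM.
  have mbg : measurable_fun Omega (fun x => b%:E * g x) by exact: measurable_funeM.
  split; first exact: emeasurable_funD.
  rewrite ge0_integralD//; last 2 first.
  - by move=> x Dx; rewrite mule_ge0// f0.
  - by move=> x Dx; rewrite mule_ge0// g0.
  by rewrite !ge0_integralZl.
have [mL <-] := lin _ _ mO2 mO3 (fun x => I0 _ x p2) (fun x => I0 _ x p3).
apply: ge0_le_integral => //.
- by move=> x _; exact: I0.
- exact: measurable_tonelli_planeO.
move=> x _; have [mLx <-] := lin _ _ (sec _ x m2) (sec _ x m3) (fun y => p2 (x, y)) (fun y => p3 (x, y)).
apply: ge0_le_integral => //.
exact: sec.
Qed.

End DoubleIntegral.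

Section Interpolation.
Variable R : realType.
Implicit Types u v : R * R -> R.

(** Below the length [rho] a higher order of singularity with a small factor
    takes over; above it the kernel is bounded. *)
Lemma powR_split (rho t s : R) : 0 < rho -> 0 < s < 1 -> 0 <= t ->
  (t `^ (2 + 2 * s))^-1 <=
  rho `^ (1 - s) * (t `^ (2 + 2 * ((1 + s) / 2)))^-1 + rho `^ (- (2 + 2 * s)).
Proof.
move=> r0 /andP[s0 s1]; rewrite le_eqVlt => /predU1P[<-|t0].
  rewrite powR0 ?invr0; last by rewrite gt_eqF//; lra.
  by rewrite addr_ge0 ?mulr_ge0 ?invr_ge0 ?powR_ge0.
have [tr|rt] := leP t rho.
  rewrite -!powRN; apply: ler_wpDr; first exact: powR_ge0.
  have -> : - (2 + 2 * s) = (1 - s) + - (2 + 2 * ((1 + s) / 2)) by field.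
  rewrite powRD; last by rewrite (gt_eqF t0) implybT.
  rewrite ler_wpM2r ?powR_ge0//; apply: ge0_ler_powR => //; rewrite ?nnegrE ?ltW//; lra.
rewrite -powRN; apply: ler_wpDl; first by rewrite mulr_ge0 ?invr_ge0 ?powR_ge0.
by apply: inv_powR_le => //; [lra|exact: ltW].
Qed.

(** Splitting the kernel at a small distance bounds the near part by a small
    multiple of a seminorm of higher order, which the gradient controls, and
    the far part by the L^2 norm. *)
Lemma interpolation (s : R) : 0 < s < 1 -> forall d : R, 0 < d -> exists2 D : R, 0 <= D &
  forall u v1 v2, weak_grad u v1 v2 ->
  (slobR s u <= (d * (ip v1 v1 + ip v2 v2) + D * ip u u)%:E)%E.
Proof.
move=> s01 d d0; have /andP[s0 s1] := s01.
have s01' : 0 < (1 + s) / 2 < 1 by apply/andP; split; lra.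
have [C C0 HC] := slobodeckij_weak s01'.
(* the splitting length for which the near part carries the factor [d] *)
pose rho := (d / (C + 1)) `^ ((1 - s)^-1).
have dC0 : 0 < d / (C + 1) by rewrite divr_gt0//; lra.
have rho0 : 0 < rho by exact: powR_gt0.
have rhoE : rho `^ (1 - s) = d / (C + 1).
  rewrite /rho -powRrM mulVf ?powRr1 ?(ltW dC0)//; lra.
set b := rho `^ (- (2 + 2 * s)).
have b0 : 0 <= b by exact: powR_ge0.
exists (4 * b) => [|u v1 v2 W]; first by rewrite mulr_ge0.
have [Lu _ _ _ _] := W.
pose K1 z := (slobK s u z)%:E; pose K2 z := (slobK ((1 + s) / 2) u z)%:E.
pose K4 (z : (plane R * plane R)%type) := (u z.1 ^+ 2)%:E.
pose K5 (z : (plane R * plane R)%type) := (u z.2 ^+ 2)%:E.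
pose K3 (z : (plane R * plane R)%type) := ((u z.1 - u z.2) ^+ 2)%:E.
have mu1 : measurable_fun setT (fun z : (plane R * plane R)%type => u z.1).
  exact: (measurableT_comp Lu.1 measurable_fst).
have mu2 : measurable_fun setT (fun z : (plane R * plane R)%type => u z.2).
  exact: (measurableT_comp Lu.1 measurable_snd).
have mK1 : measurable_fun setT K1 by apply/measurable_EFinP; apply: measurable_slobK; exact: Lu.1.
have mK2 : measurable_fun setT K2 by apply/measurable_EFinP; apply: measurable_slobK; exact: Lu.1.
have mK3 : measurable_fun setT K3 by apply/measurable_EFinP; apply: measurable_funX; exact: measurable_funB.
have mK4 : measurable_fun setT K4 by apply/measurable_EFinP; exact: measurable_funX.
have mK5 : measurable_fun setT K5 by apply/measurable_EFinP; exact: measurable_funX.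
have p1 z : (0 <= K1 z)%E by rewrite lee_fin slobK_ge0.
have p2 z : (0 <= K2 z)%E by rewrite lee_fin slobK_ge0.
have p3 z : (0 <= K3 z)%E by rewrite lee_fin sqr_ge0.
have p4 z : (0 <= K4 z)%E by rewrite lee_fin sqr_ge0.
have p5 z : (0 <= K5 z)%E by rewrite lee_fin sqr_ge0.
have a0 : 0 <= rho `^ (1 - s) by exact: powR_ge0.
have H1 := @double_integral_le R K1 K2 K3 (rho `^ (1 - s)) b mK1 mK2 mK3 p1 p2 p3 a0 b0.
have H2 := @double_integral_le R K3 K4 K5 2 2 mK3 mK4 mK5 p3 p4 p5 (ler0n _ _) (ler0n _ _).
have E4 : (\int[leb2]_(x in Omega) \int[leb2]_(y in Omega) K4 (x, y) = (ip u u)%:E)%E.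
  by rewrite -ipE//; apply: eq_integral => x _; exact: (integral_Omega_cst (u x ^+ 2)%:E).
have E5 : (\int[leb2]_(x in Omega) \int[leb2]_(y in Omega) K5 (x, y) = (ip u u)%:E)%E.
  by rewrite -ipE//; exact: (integral_Omega_cst (\int[leb2]_(y in Omega) (u y ^+ 2)%:E)%E).
have {}H2 : (\int[leb2]_(x in Omega) \int[leb2]_(y in Omega) K3 (x, y) <= (4 * ip u u)%:E)%E.
  apply: le_trans (H2 _) _.
    move=> z; rewrite /K3 /K4 /K5 -!EFinM -EFinD lee_fin.
    by have := sqr_ge0 (u z.1 + u z.2); rewrite sqrrB sqrrD; lra.
  by rewrite E4 E5 -!EFinM -EFinD lee_fin; lra.
have B := HC u v1 v2 W.
apply: le_trans (H1 _) _.
  move=> z; rewrite /K1 /K2 /K3 /slobK -!EFinM -EFinD lee_fin.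
  rewrite mulrCA [b * _]mulrC -mulrDr ler_wpM2l ?sqr_ge0//.
  by apply: powR_split => //; exact: eucl_dist_ge0.
apply: (@le_trans _ _ ((rho `^ (1 - s))%:E * (C * (ip v1 v1 + ip v2 v2))%:E + b%:E * (4 * ip u u)%:E)%E).
  by apply: leeD; apply: lee_wpmul2l.
rewrite -!EFinM -EFinD lee_fin rhoE.
have g0 : 0 <= ip v1 v1 + ip v2 v2 by rewrite addr_ge0// ip_ge0.
rewrite [b * _]mulrA [b * 4]mulrC lerD2r mulrA ler_wpM2r//.
by rewrite mulrAC ler_pdivrMr; lra || nra.
Qed.

End Interpolation.

Section Cells.
Variable R : realType.
Variable n : nat.
Notation N := (n.+1%:R : R).
Notation K := ('I_n.+1 * 'I_n.+1)%type.
Implicit Types u v : R * R -> R.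

(** The open cells of the grid with [n + 1] cells on a side; they cover the
    square up to a null set. *)
Definition cell (i : nat) : set R := `]i%:R / N, i.+1%:R / N[%classic.
Definition cell2 (k : K) : set (plane R) := cell k.1 `*` cell k.2.
Definition chi (k : K) (x : R * R) : R := \1_(cell2 k) x.
Definition avg u (k : K) : R := N ^+ 2 * ip u (chi k).
(** Orthogonal projection on the functions that are constant on each cell. *)
Definition proj u (x : R * R) : R := \sum_(k : K) avg u k * chi k x.

Let N0 : 0 < N. Proof. by rewrite ltr0n. Qed.

Lemma cell_sub (i : 'I_n.+1) : cell i `<=` unitI.
Proof.
move=> x; rewrite /cell/= in_itv/= unitIE => /andP[h1 h2]; apply/andP; split.
  by apply: le_lt_trans h1; rewrite divr_ge0.
by apply: lt_le_trans h2 _; rewrite ler_pdivrMr// mul1r ler_nat.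
Qed.

Lemma measurable_cell i : measurable (cell i : set (measurableTypeR R)).
Proof. exact: measurable_itv. Qed.

Lemma measurable_cell2 k : measurable (cell2 k).
Proof. by apply: measurableX; exact: measurable_cell. Qed.

Lemma chi01 k x : 0 <= chi k x <= 1.
Proof. by rewrite /chi indicE; case: (_ \in _); rewrite lexx ler01. Qed.

Lemma measurable_chi k : measurable_fun setT (chi k : plane R -> R).
Proof. by apply: measurable_indic; exact: measurable_cell2. Qed.

Lemma rL2_chi k : rL2 (chi k).
Proof.
have := @rL2_mulb R (fun=> 1) (chi k) 1 (@rL2_cst R 1) (measurable_chi k).
under eq_fun do rewrite mul1r; apply => x _.
by have /andP[h1 h2] := chi01 k x; rewrite ger0_norm.
Qed.

Lemma ip_chi k : ip (chi k) (chi k) = N ^- 2.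
Proof.
rewrite /ip /Rintegral.
rewrite (eq_integral (fun x => (\1_(cell2 k) x)%:E)); last first.
  by move=> x _; rewrite /chi indicE; case: (_ \in _); rewrite ?mulr1 ?mulr0.
rewrite integral_indic//; last exact: measurable_cell2.
have -> : cell2 k `&` Omega = cell2 k.
  by apply/setIidl => x [h1 h2]; split; apply: cell_sub; [exact: h1|exact: h2].
have mc i : (@lebesgue_measure R (cell i) = (N^-1)%:E)%E.
  have := @lebesgue_measure_itv R (`]i%:R / N, i.+1%:R / N[); rewrite /= lte_fin.
  rewrite ltr_pM2r ?invr_gt0// ltr_nat ltnSn -EFinB => ->.
  by rewrite -mulrBl -natr1 addrAC subrr add0r mul1r.
transitivity (fine ((N^-1)%:E * (N^-1)%:E)%E); last by rewrite /= expr2 invfM.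
congr fine.
apply: etrans (product_measure1E _ _ (measurable_cell k.1) (measurable_cell k.2)) _.
by congr (_ * _)%E; exact: mc.
Qed.

Lemma avg_bound u k : rL2 u -> avg u k ^+ 2 <= N ^+ 2 * ip u u.
Proof.
move=> Lu; have := ip_cs Lu (rL2_chi k).
rewrite ip_chi sqrtrV ?exprn_ge0// sqrtr_sqr (ger0_norm (ltW N0)) => H.
rewrite /avg exprMn -exprM -[ip u (chi k) ^+ 2]real_normK ?num_real//.
apply: (@le_trans _ _ (N ^+ (2 * 2) * (Num.sqrt (ip u u) / N) ^+ 2)).
  by rewrite ler_wpM2l ?exprn_ge0// lerXn2r ?nnegrE ?mulr_ge0 ?sqrtr_ge0 ?invr_ge0.
rewrite exprMn sqr_sqrtr ?ip_ge0// exprM exprVn [X in X <= _](_ : _ = N ^+ 2 * ip u u)//.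
by field; rewrite gt_eqF.
Qed.

Lemma rL2_proj u : rL2 (proj u).
Proof. by apply: rL2_sum => k; apply: rL2Z; exact: rL2_chi. Qed.

Lemma proj_sym u v : rL2 u -> rL2 v -> ip (proj u) v = ip u (proj v).
Proof.
move=> Lu Lv; rewrite [RHS]ipC /proj !ip_suml//; last 2 first.
- by move=> k; apply: rL2Z; exact: rL2_chi.
- by move=> k; apply: rL2Z; exact: rL2_chi.
apply: eq_bigr => k _; rewrite !ipZl//; [|exact: rL2_chi|exact: rL2_chi].
by rewrite /avg ![ip (chi k) _]ipC; ring.
Qed.

Lemma cell_inj (i j : nat) x : cell i x -> cell j x -> i = j.
Proof.
rewrite /cell/= !in_itv/= => /andP[h1 h2] /andP[h3 h4].
have := lt_trans h1 h4; have := lt_trans h3 h2.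
rewrite !ltr_pM2r ?invr_gt0// !ltr_nat !ltnS => ji ij.
by apply/eqP; rewrite eqn_leq ij ji.
Qed.

Lemma projE u k x : cell2 k x -> proj u x = avg u k.
Proof.
move=> kx; rewrite /proj (bigD1 k)//= big1 => [|j jk].
  by rewrite addr0 /chi indicE mem_set// mulr1.
rewrite /chi indicE memNset ?mulr0// => jx; move/eqP: jk; apply.
case: j k kx jx => [j1 j2] [k1 k2] [/= a1 a2] [/= b1 b2].
by congr pair; apply/val_inj; [exact: cell_inj b1 a1|exact: cell_inj b2 a2].
Qed.

Lemma in_some_cell (t : R) : unitI t -> (forall j : nat, t <> j%:R / N) ->
  exists i : 'I_n.+1, cell i t.
Proof.
rewrite unitIE => /andP[t0 t1] H.
have Nt0 : 0 <= N * t by rewrite mulr_ge0 ?ltW.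
have /andP[h1 h2] := truncn_itv Nt0.
have lt : (Num.truncn (N * t) < n.+1)%N.
  rewrite -(ltr_nat R); apply: le_lt_trans h1 _.
  by rewrite -[X in _ < X]mulr1 ltr_pM2l.
exists (Ordinal lt); rewrite /cell/= in_itv/= ltr_pdivrMr// ltr_pdivlMr// [t * _]mulrC.
rewrite h2 andbT lt_neqAle h1 andbT; apply/negP => /eqP E.
by apply: (H (Num.truncn (N * t))); rewrite E [_ * t]mulrC mulfK// gt_eqF.
Qed.

Lemma eucl_dist_cell k x y : cell2 k x -> cell2 k y -> eucl_dist x y <= 2 / N.
Proof.
move=> [x1 x2] [y1 y2]; rewrite /eucl_dist.
have d (i : nat) s t : cell i s -> cell i t -> (s - t) ^+ 2 <= N^-1 ^+ 2.
  rewrite /cell/= !in_itv/= => /andP[h1 h2] /andP[h3 h4].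
  have E : i.+1%:R / N = i%:R / N + N^-1 by rewrite -natr1 mulrDl mul1r.
  rewrite E in h2 h4; rewrite -real_normK ?num_real// lerXn2r ?nnegrE ?invr_ge0//.
  move: h1 h2 h3 h4; move: (i%:R / N) (N^-1) => a b h1 h2 h3 h4.
  by rewrite ler_norml; apply/andP; split; lra.
have := d _ _ _ x1 y1; have := d _ _ _ x2 y2.
have -> : 2 / N = Num.sqrt ((2 / N) ^+ 2) by rewrite sqrtr_sqr ger0_norm// divr_ge0.
move=> h1 h2; rewrite ler_sqrt ?sqr_ge0//.
by rewrite exprMn; move: h1 h2 (sqr_ge0 N^-1); move: (N^-1 ^+ 2) => t; lra.
Qed.

(** On a cell the deviation from the mean is an average of increments, and the
    cell has diameter at most [2 / (n + 1)]: Cauchy-Schwarz over the cell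
    produces the kernel of order [1 / 2] together with one power of [1 / N]. *)
Lemma poincare_pointwise u k x : rL2 u -> cell2 k x ->
  (((u x - proj u x) ^+ 2)%:E <=
   (8 / N)%:E * \int[leb2]_(y in Omega) (slobK 2^-1 u (x, y))%:E)%E.
Proof.
move=> Lu kx; rewrite (projE u kx).
pose f y := u x - u y.
have Lf : rL2 f by apply: rL2B => //; exact: rL2_cst.
have mf : measurable_fun setT (f : plane R -> R) by exact: Lf.1.
have Lfc : rL2 (fun y => f y * chi k y).
  apply: (rL2_mulb (C := 1)) => //; first exact: measurable_chi.
  by move=> y _; have /andP[h1 h2] := chi01 k y; rewrite ger0_norm.
have cc y : chi k y * chi k y = chi k y.
  by rewrite /chi indicE; case: (_ \in _); rewrite ?mulr1 ?mulr0.
have E : u x - avg u k = N ^+ 2 * ip (fun y => f y * chi k y) (chi k).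
  have -> : ip (fun y => f y * chi k y) (chi k) = ip f (chi k).
    by apply: eq_Rintegral => y _; rewrite -mulrA cc.
  have ux : ip (fun=> u x) (chi k) = u x * ip (chi k) (chi k).
    rewrite -ipZl//; [|exact: rL2_chi|exact: rL2_chi].
    by apply: eq_Rintegral => y _; rewrite -mulrA cc.
  rewrite /f ipBl//; [|exact: rL2_cst|exact: rL2_chi].
  rewrite ux ip_chi mulrBr /avg; congr (_ - _).
  by field; rewrite gt_eqF.
have CS := ip_cs Lfc (rL2_chi k).
have {}CS : (u x - avg u k) ^+ 2 <= N ^+ 2 * ip (fun y => f y * chi k y) (fun y => f y * chi k y).
  rewrite E exprMn -[ip _ (chi k) ^+ 2]real_normK ?num_real//.
  rewrite ip_chi sqrtrV ?exprn_ge0// sqrtr_sqr (ger0_norm (ltW N0)) in CS.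
  set I := ip (fun y => f y * chi k y) (fun y => f y * chi k y) in CS *.
  have I0 : 0 <= I by exact: ip_ge0.
  apply: (@le_trans _ _ ((N ^+ 2) ^+ 2 * (Num.sqrt I / N) ^+ 2)).
    by rewrite ler_wpM2l ?exprn_ge0// lerXn2r ?nnegrE ?mulr_ge0 ?sqrtr_ge0 ?invr_ge0.
  rewrite [(_ / N) ^+ 2]exprMn sqr_sqrtr// exprVn [X in X <= _](_ : _ = N ^+ 2 * I)//.
  by field; rewrite gt_eqF.
rewrite -lee_fin in CS; apply: (le_trans CS).
rewrite EFinM -ipE//.
have -> : (8 / N)%:E = ((N ^+ 2)%:E * ((2 / N) `^ (2 + 2 * 2^-1))%:E)%E.
  rewrite -EFinM; congr EFin.
  have -> : 2 + 2 * 2^-1 = 3%:R :> R by field.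
  by rewrite powR_mulrn ?divr_ge0//; field; rewrite gt_eqF.
rewrite -muleA; apply: lee_wpmul2l; first by rewrite lee_fin exprn_ge0.
have mK : measurable_fun Omega (fun y : plane R => (slobK 2^-1 u (x, y))%:E).
  apply/measurable_EFinP; apply: measurable_funTS.
  by apply: (measurableT_comp (measurable_slobK 2^-1 Lu.1)); exact: pair1_measurable.
rewrite -ge0_integralZl//; last by move=> y _; rewrite lee_fin slobK_ge0.
apply: ge0_le_integral => //.
- by move=> y _; rewrite lee_fin sqr_ge0.
- by apply/measurable_EFinP; apply: measurable_funX; exact: rL2_measurable.
- exact: measurable_funeM.
move=> y _; rewrite -EFinM lee_fin /chi indicE.
have [ky|ky] := boolP (y \in cell2 k); last first.
  by rewrite mulr0 expr0n/= mulr_ge0 ?powR_ge0 ?slobK_ge0.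
rewrite mulr1 /slobK /f /=; have {}ky : cell2 k y by move: ky; rewrite inE.
have [e0|e0] := eqVneq (eucl_dist x y) 0.
  have -> : u x = u y.
    congr u; have := eucl_dist_ge1 x y; have := eucl_dist_ge2 x y.
    rewrite e0 !normr_le0 !subr_eq0 => /eqP h2 /eqP h1.
    by rewrite [x]surjective_pairing [y]surjective_pairing h1 h2.
  by rewrite subrr expr0n/= mul0r mulr0.
have e0' : 0 < eucl_dist x y by rewrite lt_neqAle eq_sym e0 eucl_dist_ge0.
rewrite mulrCA ler_peMr ?sqr_ge0// ler_pdivlMr ?powR_gt0// mul1r.
apply: ge0_ler_powR; rewrite ?nnegrE ?addr_ge0 ?divr_ge0 ?eucl_dist_ge0//.
exact: eucl_dist_cell kx ky.
Qed.

End Cells.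

Section Poincare.
Variable R : realType.

(** Integrating [poincare_pointwise] over the square; almost every point lies
    in an open cell. *)
Lemma poincare : exists2 C : R, 0 <= C &
  forall n (u v1 v2 : R * R -> R), weak_grad u v1 v2 ->
  ip (fun x => u x - proj n u x) (fun x => u x - proj n u x) <=
  C / n.+1%:R * (ip v1 v1 + ip v2 v2).
Proof.
have s01 : 0 < (2^-1 : R) < 1 by apply/andP; split; lra.
have [C C0 HC] := slobodeckij_weak s01.
exists (8 * C) => [|n u v1 v2 W]; first by rewrite mulr_ge0.
have [Lu _ _ _ _] := W.
have LuP : rL2 (fun x => u x - proj n u x) by apply: rL2B => //; exact: rL2_proj.
rewrite -lee_fin -ipE//.
have mK : measurable_fun setT (fun z => (slobK 2^-1 u z)%:E).
  by apply/measurable_EFinP; apply: measurable_slobK; exact: Lu.1.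
have K0 z : (0 <= (slobK 2^-1 u z)%:E)%E by rewrite lee_fin slobK_ge0.
have mO := measurable_tonelli_planeO mK K0.
have I0 x : (0 <= \int[leb2]_(y in Omega) (slobK 2^-1 u (x, y))%:E)%E.
  by apply: integral_ge0.
have c0 : 0 <= 8 / n.+1%:R :> R by rewrite divr_ge0.
apply: (@le_trans _ _ (\int[leb2]_(x in Omega) ((8 / n.+1%:R)%:E * \int[leb2]_(y in Omega) (slobK 2^-1 u (x, y))%:E))%E).
  apply: ae_ge0_le_integral => //.
  - by move=> x _; rewrite lee_fin sqr_ge0.
  - by apply/measurable_EFinP; apply: measurable_funX; exact: rL2_measurable.
  - by move=> x _; rewrite mule_ge0.
  - exact: measurable_funeM.
  have off : {ae leb2, forall x : plane R, forall j : nat, x.1 <> j%:R / n.+1%:R /\ x.2 <> j%:R / n.+1%:R}.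
    apply/ae_foralln => j.
    exact: (ae_neq_plane (j%:R / n.+1%:R, j%:R / n.+1%:R)).
  apply: (ae_imp off) => x Hx [x1 x2].
  have [i1 c1] := in_some_cell x1 (fun j => (Hx j).1).
  have [i2 c2] := in_some_cell x2 (fun j => (Hx j).2).
  exact: (poincare_pointwise (k := (i1, i2)) Lu).
rewrite ge0_integralZl//.
apply: (@le_trans _ _ ((8 / n.+1%:R)%:E * (C * (ip v1 v1 + ip v2 v2))%:E)%E).
  apply: lee_wpmul2l; first by rewrite lee_fin.
  exact: HC W.
by rewrite -EFinM lee_fin le_eqVlt; apply/orP; left; apply/eqP; ring.
Qed.

End Poincare.

(** * Compactness of the Neumann problem *)

Section RealGradient.
Variable R : realType.
Implicit Types u v w g f : R * R -> R.

Lemma continuous_rL2 f : continuous f -> rL2 f.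
Proof.
move=> cf.
have cS : compact (`[0, 1]%classic `*` `[0, 1]%classic : set (R * R)).
  by apply: compact_setX; exact: segment_compact.
have /(@compact_bounded R R^o) [B [_ HB]] : compact (f @` (`[0, 1]%classic `*` `[0, 1]%classic) : set R^o).
  by apply: continuous_compact cS; apply: continuous_subspaceT.
have := @rL2_mulb R (fun=> 1) f (B + 1) (@rL2_cst R 1) (continuous_plane_measurable cf).
under eq_fun do rewrite mul1r; apply => x [x1 x2].
apply: (HB (B + 1)); first by rewrite ltrDl.
exists x => //; split.
  by move: x1; rewrite /= !in_itv/= => /andP[/ltW-> /ltW->].
by move: x2; rewrite /= !in_itv/= => /andP[/ltW-> /ltW->].
Qed.

Lemma rL2_test f : test_function f -> rL2 f.
Proof. by move=> [sf _]; apply: continuous_rL2; exact: (sf [::]).1. Qed.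

Lemma rL2_pderiv j f : test_function f -> rL2 (pderiv j f).
Proof. by move=> [sf _]; apply: continuous_rL2; exact: (sf [:: j]).1. Qed.

(** Weak gradients in the sense of the Sobolev spaces of the statement, that
    is, tested against every test function of two variables. *)
Definition rgrad u u1 u2 : Prop := [/\ rL2 u, rL2 u1, rL2 u2,
  forall f, test_function f -> ip u (pderiv ord0 f) = - ip u1 f &
  forall f, test_function f -> ip u (pderiv ord_max f) = - ip u2 f].

Lemma rgrad_weak u u1 u2 : rgrad u u1 u2 -> weak_grad u u1 u2.
Proof.
move=> [Lu L1 L2 H1 H2]; split => // g1 g2 t1 t2.
  by rewrite -H1 ?pderiv_tensor//; [exact: t1.1|exact: t2.1|exact: test_tensor].
by rewrite -H2 ?pderiv_tensor//; [exact: t1.1|exact: t2.1|exact: test_tensor].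
Qed.

Lemma rgradD u u1 u2 v v1 v2 : rgrad u u1 u2 -> rgrad v v1 v2 ->
  rgrad (fun x => u x + v x) (fun x => u1 x + v1 x) (fun x => u2 x + v2 x).
Proof.
move=> [Lu Lu1 Lu2 H1 H2] [Lv Lv1 Lv2 K1 K2]; split; [exact: rL2D..| |] => f tf.
  by rewrite !ipDl ?H1 ?K1 ?opprD//; [exact: rL2_test|exact: rL2_pderiv].
by rewrite !ipDl ?H2 ?K2 ?opprD//; [exact: rL2_test|exact: rL2_pderiv].
Qed.

Lemma rgradZ (c : R) u u1 u2 : rgrad u u1 u2 ->
  rgrad (fun x => c * u x) (fun x => c * u1 x) (fun x => c * u2 x).
Proof.
move=> [Lu Lu1 Lu2 H1 H2]; split; [exact: rL2Z..| |] => f tf.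
  by rewrite !ipZl ?H1 ?mulrN//; [exact: rL2_test|exact: rL2_pderiv].
by rewrite !ipZl ?H2 ?mulrN//; [exact: rL2_test|exact: rL2_pderiv].
Qed.

Lemma ip0l w : ip (fun=> 0) w = 0.
Proof. by rewrite /ip; under eq_Rintegral do rewrite mul0r; rewrite Rintegral_cst// mul0r. Qed.

Lemma ip_sqrZ (c : R) u : rL2 u ->
  ip (fun x => c * u x) (fun x => c * u x) = c ^+ 2 * ip u u.
Proof.
move=> Lu; have Lc := rL2Z c Lu.
by rewrite (ipZl c Lu Lc) (ipC u) (ipZl c Lu Lu) mulrA expr2.
Qed.

Lemma rgrad0 : rgrad (fun=> 0) (fun=> 0) (fun=> 0).
Proof. by split; [exact: rL2_cst..| |] => f _; rewrite !ip0l oppr0. Qed.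

(** Weak solutions of [- Laplace w + a w = g] with the natural (Neumann)
    boundary condition, together with their gradient. *)
Definition weak_sol (a : R) w w1 w2 g : Prop := rgrad w w1 w2 /\
  forall p p1 p2, rgrad p p1 p2 -> ip w1 p1 + ip w2 p2 + a * ip w p = ip g p.

Lemma weak_solD a w w1 w2 g v v1 v2 k : rL2 g -> rL2 k ->
  weak_sol a w w1 w2 g -> weak_sol a v v1 v2 k ->
  weak_sol a (fun x => w x + v x) (fun x => w1 x + v1 x) (fun x => w2 x + v2 x)
    (fun x => g x + k x).
Proof.
move=> Lg Lk [gw Hw] [gv Hv]; split; first exact: rgradD.
move=> p p1 p2 gp; have [Lw Lw1 Lw2 _ _] := gw; have [Lv Lv1 Lv2 _ _] := gv.
have [Lp Lp1 Lp2 _ _] := gp.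
by rewrite !ipDl// -(Hw _ _ _ gp) -(Hv _ _ _ gp); ring.
Qed.

Lemma weak_solZ a (c : R) w w1 w2 g : rL2 g -> weak_sol a w w1 w2 g ->
  weak_sol a (fun x => c * w x) (fun x => c * w1 x) (fun x => c * w2 x) (fun x => c * g x).
Proof.
move=> Lg [gw Hw]; split; first exact: rgradZ.
move=> p p1 p2 gp; have [Lw Lw1 Lw2 _ _] := gw; have [Lp Lp1 Lp2 _ _] := gp.
by rewrite !ipZl// -(Hw _ _ _ gp); ring.
Qed.

Lemma weak_sol0 a : weak_sol a (fun=> 0) (fun=> 0) (fun=> 0) (fun=> 0).
Proof. by split; [exact: rgrad0|move=> p p1 p2 _; rewrite !ip0l; ring]. Qed.

Lemma weak_sol_sum a (I : Type) (s : seq I) (c : I -> R) (W W1 W2 g : I -> R * R -> R) :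
  (forall i, rL2 (g i)) -> (forall i, weak_sol a (W i) (W1 i) (W2 i) (g i)) ->
  weak_sol a (fun x => \sum_(i <- s) c i * W i x) (fun x => \sum_(i <- s) c i * W1 i x)
    (fun x => \sum_(i <- s) c i * W2 i x) (fun x => \sum_(i <- s) c i * g i x).
Proof.
move=> Lg HW; elim: s => [|i s IH].
  under eq_fun do rewrite big_nil; under [X in weak_sol _ _ X]eq_fun do rewrite big_nil.
  under [X in weak_sol _ _ _ X]eq_fun do rewrite big_nil.
  by under [X in weak_sol _ _ _ _ X]eq_fun do rewrite big_nil; exact: weak_sol0.
under eq_fun do rewrite big_cons; under [X in weak_sol _ _ X]eq_fun do rewrite big_cons.
under [X in weak_sol _ _ _ X]eq_fun do rewrite big_cons.
under [X in weak_sol _ _ _ _ X]eq_fun do rewrite big_cons.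
apply: weak_solD; [exact: rL2Z| |exact: weak_solZ|exact: IH].
by apply: rL2_sum => j; exact: rL2Z.
Qed.

End RealGradient.

Section Multiplier.
Variable R : realType.
Implicit Types u p m : R * R -> R.

Lemma ip1_le m : rL2 (fun x => m x ^+ 2) ->
  ip m m <= Num.sqrt (ip (fun x => m x ^+ 2) (fun x => m x ^+ 2)).
Proof.
move=> Lm; have := ip_cs Lm (rL2_cst 1).
have -> : ip (fun=> 1) (fun=> 1) = 1 :> R.
  rewrite /ip; under eq_Rintegral do rewrite mulr1.
  rewrite Rintegral_cst// mul1r; have := @leb2_Omega R => /(congr1 fine) /= H; exact: H.
rewrite sqrtr1 mulr1; apply: le_trans; apply: le_trans (ler_norm _).
by rewrite le_eqVlt; apply/orP; left; apply/eqP; apply: eq_Rintegral => x _; rewrite mulr1 expr2.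
Qed.

(** The truncated squares decrease to zero and are dominated by the square. *)
Lemma tail_small p : rL2 p -> forall eta : R, 0 < eta -> exists n : nat,
  ((\int[leb2]_(x in Omega) (Num.max (p x ^+ 2 - n%:R) 0)%:E) <= eta%:E)%E.
Proof.
move=> Lp eta eta0.
have mp n : measurable_fun (Omega : set (plane R)) (fun x => (Num.max (p x ^+ 2 - n%:R) 0)%:E).
  apply/measurable_EFinP; apply: measurable_maxr => //; apply: measurable_funB => //.
  by apply: measurable_funX; exact: rL2_measurable.
have := @dominated_convergence _ _ _ leb2 (Omega : set (plane R)) (@measurable_Omega R)
  (fun n x => (Num.max (p x ^+ 2 - n%:R) 0)%:E) (fun=> 0%E) (EFin \o (fun x => p x ^+ 2)) mp
  (measurable_cst _).
case.
- apply: aeW => x _; apply/cvg_EFin; first by near=> n.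
  apply: cvg_near_cst; exists (Num.truncn (p x ^+ 2)).+1 => // n /= hn.
  rewrite max_r// subr_le0; apply: ltW.
  have /andP[_ h] := truncn_itv (sqr_ge0 (p x)); apply: lt_le_trans h _.
  by rewrite ler_nat.
- exact: rL2_sqr_integrable.
- apply: aeW => x n _ /=; rewrite lee_fin ger0_norm ?le_max ?lexx ?orbT//.
  by rewrite ge_max sqr_ge0 andbT gerBl.
move=> _ _; rewrite integral0 => H.
have : \forall n \near \oo, ((\int[leb2]_(x in Omega) (Num.max (p x ^+ 2 - n%:R) 0)%:E) <= eta%:E)%E.
  have /fine_cvgP[fn /cvgrPdist_le /(_ _ eta0) cv] := H.
  near=> n.
  have f : (\int[leb2]_(x in Omega) (Num.max (p x ^+ 2 - n%:R) 0)%:E)%E \is a fin_num by near: n.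
  rewrite -(fineK f) lee_fin; have : `|0 - fine (\int[leb2]_(x in Omega) (Num.max (p x ^+ 2 - n%:R) 0)%:E)%E| <= eta by near: n.
  by rewrite sub0r normrN; apply: le_trans; exact: ler_norm.
by move=> [n _ /(_ n (leqnn n))] h; exists n.
Unshelve. all: by end_near. Qed.

(** Absolute continuity of the integral of [p^2]: where [p] is large the
    multiplier is only bounded, elsewhere its own smallness counts. *)
Lemma small_multiplier p (C : R) : rL2 p -> 0 <= C -> forall eta : R, 0 < eta ->
  exists2 tau : R, 0 < tau & forall m, measurable_fun setT (m : plane R -> R) ->
    (forall x, Omega x -> `|m x| <= C) ->
    ip (fun x => m x ^+ 2) (fun x => m x ^+ 2) <= tau ->
    ip (fun x => p x * m x) (fun x => p x * m x) <= eta.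
Proof.
move=> Lp C0 eta eta0.
have e0 : 0 < eta / 2 / (C ^+ 2 + 1) by rewrite !divr_gt0// ltr_wpDl// sqr_ge0.
have [n Hn] := tail_small Lp e0.
(* the L^2 norm of [m] is estimated by that of [m^2], hence the square *)
exists ((eta / 2 / (n%:R + 1)) ^+ 2) => [|m mm mC mtau].
  by rewrite exprn_gt0// !divr_gt0// ltr_wpDl.
have n10 : 0 < (n%:R : R) + 1 by rewrite ltr_wpDl.
have Lm : rL2 m.
  have := @rL2_mulb R (fun=> 1) m C (rL2_cst 1) mm mC.
  by under eq_fun do rewrite mul1r.
have Lm2 : rL2 (fun x => m x ^+ 2).
  have := rL2_mulb Lm mm mC; by under eq_fun do rewrite -expr2.
have Lpm := rL2_mulb Lp mm mC.
have Hm : ip m m <= eta / 2 / (n%:R + 1).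
  apply: le_trans (ip1_le Lm2) _.
  have q0 : 0 <= eta / 2 / (n%:R + 1) by rewrite !divr_ge0 ?(ltW eta0) ?(ltW n10).
  by rewrite -[leRHS](ger0_norm q0) -sqrtr_sqr ler_sqrt ?sqr_ge0.
pose T x := (Num.max (p x ^+ 2 - n%:R) 0)%:E.
have T0 x : (0 <= T x)%E by rewrite lee_fin le_max lexx orbT.
have mT : measurable_fun (Omega : set (plane R)) T.
  apply/measurable_EFinP; apply: measurable_maxr => //; apply: measurable_funB => //.
  by apply: measurable_funX; exact: rL2_measurable.
have mm2 : measurable_fun (Omega : set (plane R)) (fun x => (m x ^+ 2)%:E).
  by apply/measurable_EFinP; apply: measurable_funX; exact: rL2_measurable.
rewrite -lee_fin -ipE//.
apply: (@le_trans _ _ (\int[leb2]_(x in Omega) (n%:R%:E * (m x ^+ 2)%:E + (C ^+ 2)%:E * T x))%E).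
  apply: ge0_le_integral => //.
  - by move=> x _; rewrite lee_fin sqr_ge0.
  - by apply/measurable_EFinP; apply: measurable_funX; exact: rL2_measurable.
  - by apply: emeasurable_funD; exact: measurable_funeM.
  move=> x Ox; rewrite /T -!EFinM -EFinD lee_fin exprMn.
  have mx : m x ^+ 2 <= C ^+ 2.
    by rewrite -(real_normK (num_real (m x))) lerXn2r ?nnegrE//; exact: mC.
  have h : p x ^+ 2 <= n%:R + Num.max (p x ^+ 2 - n%:R) 0 by rewrite -lerBlDl le_max lexx.
  have h2 : 0 <= Num.max (p x ^+ 2 - n%:R) 0 by rewrite le_max lexx orbT.
  move: h h2 (sqr_ge0 (m x)) mx; set t := Num.max (p x ^+ 2 - n%:R) 0.
  move: t (p x ^+ 2) (m x ^+ 2) (C ^+ 2) (n%:R : R).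
  clear=> t P q D k h h2 q0 qD; apply: (@le_trans _ _ ((k + t) * q)); first exact: ler_wpM2r.
  by rewrite mulrDl lerD2l mulrC ler_wpM2r.
rewrite ge0_integralD//; last 4 first.
- by move=> x _; rewrite mule_ge0// lee_fin sqr_ge0.
- exact: measurable_funeM.
- by move=> x _; rewrite mule_ge0// lee_fin sqr_ge0.
- exact: measurable_funeM.
rewrite !ge0_integralZl//; last 2 first.
- by rewrite lee_fin sqr_ge0.
- by move=> x _; rewrite lee_fin sqr_ge0.
rewrite ipE//.
apply: (@le_trans _ _ (n%:R%:E * (eta / 2 / (n%:R + 1))%:E + (C ^+ 2)%:E * (eta / 2 / (C ^+ 2 + 1))%:E)%E).
  apply: leeD; apply: lee_wpmul2l; rewrite ?lee_fin ?sqr_ge0//.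
rewrite -!EFinM -EFinD lee_fin.
have half (t : R) : 0 <= t -> t * (eta / 2 / (t + 1)) <= eta / 2.
  move=> t0; rewrite mulrA ler_pdivrMr ?ltr_wpDl//; move: t0 eta0; clear; nra.
have := half n%:R (ler0n _ _); have := half _ (sqr_ge0 C).
by move: (n%:R * _) (C ^+ 2 * _); clear; move=> x y; lra.
Unshelve. all: by end_near. Qed.

End Multiplier.

Section Compactness.
Variable R : realType.
Implicit Types u w g m : R * R -> R.

(** The data that remain after subtracting cell means are orthogonal to the
    functions constant on cells, so the solution may be replaced by its own
    deviation from the cell means, which the gradient controls with a factor
    [1 / (n + 1)]. *)
Lemma energy_residual (a : R) : 0 < a -> exists2 c : R, 0 <= c &
  forall n g e e1 e2, rL2 g -> weak_sol a e e1 e2 (fun x => g x - proj n g x) ->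
  ip e1 e1 + ip e2 e2 <= c / n.+1%:R * ip g g.
Proof.
move=> a0; have [c c0 Hc] := poincare R; exists c => // n g e e1 e2 Lg [ge He].
have [Le Le1 Le2 _ _] := ge.
set E := ip e1 e1 + ip e2 e2.
have E0 : 0 <= E by rewrite addr_ge0// ip_ge0.
have LP := rL2_proj n e; have LPg := rL2_proj n g.
have LeP : rL2 (fun x => e x - proj n e x) by exact: rL2B.
have Eq := He _ _ _ ge.
have E1 : ip (fun x => g x - proj n g x) e = ip g (fun x => e x - proj n e x).
  by rewrite ipBl// proj_sym// [RHS]ipC ipBl// ![ip _ g]ipC.
have CS := ip_cs Lg LeP.
have H1 : E <= Num.sqrt (ip g g) * Num.sqrt (c / n.+1%:R * E).
  apply: (@le_trans _ _ (ip g (fun x => e x - proj n e x))).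
    rewrite -E1 -Eq /E lerDl mulr_ge0 ?ip_ge0//; exact: ltW.
  apply: le_trans (ler_norm _) _; apply: le_trans CS _.
  rewrite ler_wpM2l ?sqrtr_ge0// ler_sqrt; first exact: Hc (rgrad_weak ge).
  by rewrite mulr_ge0// divr_ge0.
have cn0 : 0 <= c / n.+1%:R by rewrite divr_ge0.
have H2 : E ^+ 2 <= ip g g * (c / n.+1%:R * E).
  have := lerXn2r 2 (E0 : E \in Num.nneg).
  move=> /(_ (Num.sqrt (ip g g) * Num.sqrt (c / n.+1%:R * E))).
  rewrite nnegrE mulr_ge0 ?sqrtr_ge0// => /(_ isT H1).
  by rewrite exprMn !sqr_sqrtr ?ip_ge0// mulr_ge0.
have g0 := ip_ge0 g.
move: E0; rewrite le_eqVlt => /predU1P[<-|Ep]; first by rewrite mulr_ge0.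
by rewrite -(ler_pM2r Ep) -expr2; apply: le_trans H2 _; rewrite mulrA [ip g g * _]mulrC.
Qed.

(** A compactness statement in disguise: a multiplier that is bounded and
    small in the mean is small against the gradients of all solutions with
    data in a ball, although those gradients have no common majorant. *)
Lemma compact_resolvent (a : R) : 0 < a ->
  (forall g, rL2 g -> exists w w1 w2, weak_sol a w w1 w2 g) ->
  forall B C d : R, 0 <= B -> 0 <= C -> 0 < d -> exists2 tau : R, 0 < tau &
  forall m, measurable_fun setT (m : plane R -> R) ->
    (forall x, Omega x -> `|m x| <= C) ->
    ip (fun x => m x ^+ 2) (fun x => m x ^+ 2) <= tau ->
  forall g w w1 w2, rL2 g -> ip g g <= B -> weak_sol a w w1 w2 g ->
    ip (fun x => w1 x * m x) (fun x => w1 x * m x) +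
    ip (fun x => w2 x * m x) (fun x => w2 x * m x) <= d.
Proof.
move=> a0 ex B C d B0 C0 d0.
have [c c0 Hc] := energy_residual a0.
have [n Hn] : exists n : nat, 2 * C ^+ 2 * (c / n.+1%:R * B) <= d / 2.
  exists (Num.truncn (2 * C ^+ 2 * c * B / (d / 2))).
  have t0 : 0 <= 2 * C ^+ 2 * c * B / (d / 2).
    by rewrite divr_ge0 ?divr_ge0 ?(ltW d0)// !mulr_ge0// sqr_ge0.
  have /andP[_ /ltW] := truncn_itv t0; rewrite ler_pdivrMr ?divr_gt0// => h.
  set N := (Num.truncn _).+1 in h *.
  have -> : 2 * C ^+ 2 * (c / N%:R * B) = 2 * C ^+ 2 * c * B / N%:R.
    by rewrite -!mulrA [B / _]mulrC.
  by rewrite ler_pdivrMr ?ltr0n// [d / 2 * _]mulrC.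
pose K := ('I_n.+1 * 'I_n.+1)%type.
have exK (k : K) : {W : (R * R -> R) * (R * R -> R) * (R * R -> R) |
    weak_sol a W.1.1 W.1.2 W.2 (@chi R n k)}.
  apply: cid; have [w [w1 [w2 H]]] := ex _ (@rL2_chi R n k).
  by exists (w, w1, w2).
pose W k := (projT1 (exK k)).1.1; pose W1 k := (projT1 (exK k)).1.2.
pose W2 k := (projT1 (exK k)).2.
have HW k : weak_sol a (W k) (W1 k) (W2 k) (@chi R n k) by exact: (projT2 (exK k)).
have LW k : [/\ rL2 (W k), rL2 (W1 k) & rL2 (W2 k)].
  by have [[]] := HW k.
(* up to the factor [A], majorants of the gradients of the projected solutions *)
pose p1 x := \sum_(k : K) `|W1 k x|; pose p2 x := \sum_(k : K) `|W2 k x|.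
have Labs (u : R * R -> R) : rL2 u -> rL2 (fun x => `|u x|).
  move=> [mu u2]; split; first exact: measurableT_comp.
  by under eq_integral do rewrite real_normK ?num_real//.
have Lp1 : rL2 p1 by apply: rL2_sum => k; apply: Labs; have [] := LW k.
have Lp2 : rL2 p2 by apply: rL2_sum => k; apply: Labs; have [] := LW k.
(* a bound for the cell means of a datum in the ball *)
pose A := n.+1%:R * (B + 1) : R.
have A0 : 0 < A by rewrite mulr_gt0 ?ltr0n// ltr_wpDl.
pose eta := d / 2 / (4 * A ^+ 2).
have eta0 : 0 < eta by rewrite !divr_gt0// mulr_gt0// exprn_gt0.
have [t1 t10 H1] := small_multiplier Lp1 C0 eta0.
have [t2 t20 H2] := small_multiplier Lp2 C0 eta0.
exists (Num.min t1 t2) => [|m mm mC]; first by rewrite lt_min t10 t20.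
rewrite le_min => /andP[/(H1 m mm mC) {}H1 /(H2 m mm mC) {}H2] g w w1 w2 Lg gB Hw.
pose q x := \sum_(k : K) - avg g k * W k x.
pose q1 x := \sum_(k : K) - avg g k * W1 k x.
pose q2 x := \sum_(k : K) - avg g k * W2 k x.
pose e1 x := w1 x + q1 x; pose e2 x := w2 x + q2 x.
have Hq : weak_sol a q q1 q2 (fun x => - proj n g x).
  have -> : (fun x => - proj n g x) = (fun x => \sum_(k : K) - avg g k * chi k x).
    by apply/funext => x; rewrite /proj -sumrN; apply: eq_bigr => k _; rewrite mulNr.
  apply: weak_sol_sum => // k; exact: (@rL2_chi R n k).
have LNp : rL2 (fun x => - proj n g x).
  by have := rL2Z (-1) (rL2_proj n g); under eq_fun do rewrite mulN1r.
have He : weak_sol a (fun x => w x + q x) e1 e2 (fun x => g x - proj n g x).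
  exact: weak_solD.
have [[Lw Lw1 Lw2 _ _] _] := Hw; have [[Lq Lq1 Lq2 _ _] _] := Hq.
have [[_ Le1 Le2 _ _] _] := He.
have avgA (k : K) : `|avg g k| <= A.
  rewrite -(ler_pXn2r (n := 2))// ?nnegrE ?(ltW A0)// real_normK ?num_real//.
  apply: le_trans (avg_bound k Lg) _; rewrite /A exprMn ler_wpM2l ?sqr_ge0//.
  by apply: le_trans gB _; move: B0; clear; nra.
have bnd (v V e : R * R -> R) (S : K -> R * R -> R) : rL2 v -> rL2 V -> rL2 e ->
    (forall k, rL2 (S k)) -> V = (fun x => \sum_(k : K) `|S k x|) ->
    (forall x, e x = v x + \sum_(k : K) - avg g k * S k x) ->
    ip (fun x => V x * m x) (fun x => V x * m x) <= eta ->
    ip (fun x => v x * m x) (fun x => v x * m x) <= 2 * C ^+ 2 * ip e e + 2 * A ^+ 2 * eta.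
  move=> Lv LV Le LS EV Ee HV.
  pose r x := \sum_(k : K) avg g k * S k x.
  have Lr : rL2 r by apply: rL2_sum => k; exact: rL2Z.
  have -> : (fun x => v x * m x) = (fun x => e x * m x + r x * m x).
    apply/funext => x; rewrite -mulrDl; congr (_ * _).
    by rewrite Ee /r -addrA -big_split big1 ?addr0// => k _ /=; rewrite mulNr addNr.
  apply: le_trans (ip_sqrD (rL2_mulb Le mm mC) (rL2_mulb Lr mm mC)) _.
  rewrite -(mulrA 2 (C ^+ 2)) -(mulrA 2 (A ^+ 2)).
  apply: lerD; rewrite ler_wpM2l//.
    have -> : C ^+ 2 * ip e e = ip (fun x => C * e x) (fun x => C * e x).
      by rewrite ip_sqrZ.
    apply: ip_le; [exact: rL2_mulb mm mC|exact: rL2Z|] => x Ox.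
    by rewrite !normrM mulrC ler_wpM2r// (le_trans (mC x Ox))// ler_norm.
  apply: (@le_trans _ _ (A ^+ 2 * ip (fun x => V x * m x) (fun x => V x * m x))).
    have LVm := rL2_mulb LV mm mC.
    have -> : A ^+ 2 * ip (fun x => V x * m x) (fun x => V x * m x) =
        ip (fun x => A * (V x * m x)) (fun x => A * (V x * m x)).
      by rewrite ip_sqrZ.
    apply: ip_le; [exact: rL2_mulb mm mC|exact: rL2Z|] => x Ox.
    rewrite mulrA [leLHS]normrM [leRHS]normrM ler_wpM2r// EV mulr_sumr.
    apply: le_trans (ler_norm_sum _ _ _) _; apply: le_trans (ler_norm _).
    apply: ler_sum => k _; rewrite normrM ler_wpM2r//.
  by rewrite ler_wpM2l ?sqr_ge0.
have b1 := bnd w1 p1 e1 (fun k => W1 k) Lw1 Lp1 Le1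
  (fun k => let: And3 _ h _ := LW k in h) erefl (fun=> erefl) H1.
have b2 := bnd w2 p2 e2 (fun k => W2 k) Lw2 Lp2 Le2
  (fun k => let: And3 _ _ h := LW k in h) erefl (fun=> erefl) H2.
have E := Hc n g _ e1 e2 Lg He.
apply: le_trans (lerD b1 b2) _.
have -> : 2 * C ^+ 2 * ip e1 e1 + 2 * A ^+ 2 * eta + (2 * C ^+ 2 * ip e2 e2 + 2 * A ^+ 2 * eta) =
  2 * C ^+ 2 * (ip e1 e1 + ip e2 e2) + 4 * A ^+ 2 * eta by ring.
have -> : 4 * A ^+ 2 * eta = d / 2.
  by rewrite /eta; field; rewrite gt_eqF.
rewrite [leRHS](splitr d) lerD2r; apply: le_trans Hn.
rewrite ler_wpM2l ?mulr_ge0 ?sqr_ge0//; apply: le_trans E _.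
by rewrite ler_wpM2l// divr_ge0.
Qed.

End Compactness.

(** * Complex square integrable functions *)

Section ComplexL2.
Variable R : realType.
Local Open Scope complex_scope.
Implicit Types (u v : R * R -> R[i]) (f g k : R * R -> R).

Lemma normc_sq (z : R[i]) : Normc.normc z ^+ 2 = complex.Re z ^+ 2 + complex.Im z ^+ 2.
Proof. by case: z => a b /=; rewrite sqr_sqrtr// addr_ge0// sqr_ge0. Qed.

Lemma normc_ge0 (z : R[i]) : 0 <= Normc.normc z.
Proof. by case: z => a b /=; rewrite sqrtr_ge0. Qed.

Lemma normc_le (z : R[i]) : Normc.normc z <= `|complex.Re z| + `|complex.Im z|.
Proof.
rewrite -(ler_pXn2r (n := 2))// ?nnegrE ?normc_ge0 ?addr_ge0//.
rewrite normc_sq sqrrD !real_normK ?num_real// lerD2r lerDl.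
by rewrite mulrn_wge0// mulr_ge0.
Qed.

Lemma Re_le_normc (z : R[i]) : `|complex.Re z| <= Normc.normc z.
Proof.
rewrite -(ler_pXn2r (n := 2))// ?nnegrE ?normc_ge0// normc_sq.
by rewrite real_normK ?num_real// lerDl sqr_ge0.
Qed.

(** Real part on the square, extended by zero: the functions of the statement
    are measurable on the square only. *)
Definition Rp u : R * R -> R := (fun x => complex.Re (u x)) \_ Omega.
Definition Ip u : R * R -> R := (fun x => complex.Im (u x)) \_ Omega.

Lemma RpE u x : Omega x -> Rp u x = complex.Re (u x).
Proof. by move=> Ox; rewrite /Rp patchE mem_set. Qed.

Lemma IpE u x : Omega x -> Ip u x = complex.Im (u x).
Proof. by move=> Ox; rewrite /Ip patchE mem_set. Qed.

Lemma measurable_onO f : measurable_fun (Omega : set (plane R)) (f : plane R -> R) <->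
  measurable_fun setT (f \_ Omega : plane R -> R).
Proof. exact: (@measurable_restrictT _ _ (plane R) (measurableTypeR R) Omega f (@measurable_Omega R)). Qed.

Definition nsq u : R := ip (Rp u) (Rp u) + ip (Ip u) (Ip u).

Lemma nsq_ge0 u : 0 <= nsq u.
Proof. by rewrite addr_ge0// ip_ge0. Qed.

Definition cL2 u : Prop := rL2 (Rp u) /\ rL2 (Ip u).

Lemma inL2_integral u : cmeasurable u ->
  (\int[leb2]_(x in Omega) ((Normc.normc (u x)) ^+ 2)%:E =
   \int[leb2]_(x in Omega) (Rp u x ^+ 2)%:E + \int[leb2]_(x in Omega) (Ip u x ^+ 2)%:E)%E.
Proof.
move=> [m1 m2]; rewrite -ge0_integralD//; last 4 first.
- by move=> x _; rewrite lee_fin sqr_ge0.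
- apply/measurable_EFinP; apply: measurable_funX; apply: measurable_funTS.
  by apply/measurable_onO.
- by move=> x _; rewrite lee_fin sqr_ge0.
- apply/measurable_EFinP; apply: measurable_funX; apply: measurable_funTS.
  by apply/measurable_onO.
apply: eq_integral => x; rewrite inE => Ox.
by rewrite -EFinD RpE// IpE// normc_sq.
Qed.

Lemma inL2P u : inL2 u <-> cL2 u.
Proof.
have n0 : (0 <= \int[leb2]_(x in Omega) ((Normc.normc (u x)) ^+ 2)%:E)%E.
  by apply: integral_ge0 => x _; rewrite lee_fin sqr_ge0.
have r0 (f : R * R -> R) : (0 <= \int[leb2]_(x in Omega) (f x ^+ 2)%:E)%E.
  by apply: integral_ge0 => x _; rewrite lee_fin sqr_ge0.
split => [[mu]|[[mr r2] [mi i2]]].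
  rewrite /L2norm => lt.
  have {}lt : (\int[leb2]_(x in Omega) ((Normc.normc (u x)) ^+ 2)%:E < +oo)%E.
    rewrite ltey; apply/eqP => E; move: lt; rewrite E /=.
    by rewrite ltxx.
  move: lt; rewrite inL2_integral// => lt; have [m1 m2] := mu.
  split; split.
  - exact/measurable_onO.
  - by apply: le_lt_trans lt; rewrite leeDl.
  - exact/measurable_onO.
  - by apply: le_lt_trans lt; rewrite leeDr.
have mu : cmeasurable u by split; apply/measurable_onO.
split => //; rewrite /L2norm inL2_integral//.
have : (\int[leb2]_(x in Omega) (Rp u x ^+ 2)%:E + \int[leb2]_(x in Omega) (Ip u x ^+ 2)%:E < +oo)%E.
  exact: lte_add_pinfty.
by case: (_ + _)%E => //= r _; rewrite ltry.
Qed.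

Lemma L2norm_sq u : cL2 u -> (L2norm u ^+ 2 = (nsq u)%:E)%E.
Proof.
move=> Lu; have [mu _] := (inL2P u).2 Lu; have [Lr Li] := Lu.
rewrite /L2norm sqr_sqrte; first by rewrite inL2_integral// !ipE// -EFinD.
by apply: integral_ge0 => x _; rewrite lee_fin sqr_ge0.
Qed.

Lemma RpD u v : Rp (fun x => u x + v x) = (fun x => Rp u x + Rp v x).
Proof. by apply/funext => x; rewrite /Rp !patchE; case: ifP; rewrite ?raddfD// addr0. Qed.

Lemma IpD u v : Ip (fun x => u x + v x) = (fun x => Ip u x + Ip v x).
Proof. by apply/funext => x; rewrite /Ip !patchE; case: ifP; rewrite ?raddfD// addr0. Qed.

Lemma RpZ (c : R[i]) u : Rp (fun x => c * u x) =
  (fun x => complex.Re c * Rp u x + - complex.Im c * Ip u x).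
Proof.
apply/funext => x; rewrite /Rp /Ip !patchE; case: ifP; rewrite ?mulr0 ?addr0//.
by case: c (u x) => a b [a' b'] _ /=; rewrite mulNr.
Qed.

Lemma IpZ (c : R[i]) u : Ip (fun x => c * u x) =
  (fun x => complex.Re c * Ip u x + complex.Im c * Rp u x).
Proof.
apply/funext => x; rewrite /Rp /Ip !patchE; case: ifP; rewrite ?mulr0 ?addr0//.
by case: c (u x) => a b [a' b'] _ /=.
Qed.

Lemma Rp_conj u : Rp (fun x => conjc (u x)) = Rp u.
Proof. by apply/funext => x; rewrite /Rp !patchE; case: ifP => //; case: (u x). Qed.

Lemma Ip_conj u : Ip (fun x => conjc (u x)) = (fun x => -1 * Ip u x).
Proof.
apply/funext => x; rewrite /Ip !patchE; case: ifP => //; last by rewrite mulr0.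
by case: (u x) => a b _ /=; rewrite mulN1r.
Qed.

Lemma cL2D u v : cL2 u -> cL2 v -> cL2 (fun x => u x + v x).
Proof. by move=> [a b] [c d]; rewrite /cL2 RpD IpD; split; exact: rL2D. Qed.

Lemma cL2Z (c : R[i]) u : cL2 u -> cL2 (fun x => c * u x).
Proof. by move=> [a b]; rewrite /cL2 RpZ IpZ; split; apply: rL2D; exact: rL2Z. Qed.

Lemma cL2_conj u : cL2 u -> cL2 (fun x => conjc (u x)).
Proof. by move=> [a b]; rewrite /cL2 Rp_conj Ip_conj; split => //; exact: rL2Z. Qed.

Lemma nsq_conj u : cL2 u -> nsq (fun x => conjc (u x)) = nsq u.
Proof. by move=> [a b]; rewrite /nsq Rp_conj Ip_conj ip_sqrZ// sqrrN expr1n mul1r. Qed.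

Lemma nsqD u v : cL2 u -> cL2 v -> nsq (fun x => u x + v x) <= 2 * nsq u + 2 * nsq v.
Proof.
move=> [a b] [c d]; rewrite /nsq RpD IpD.
by have := ip_sqrD a c; have := ip_sqrD b d; lra.
Qed.

Lemma nsqZ (c : R[i]) u : cL2 u ->
  nsq (fun x => c * u x) = Normc.normc c ^+ 2 * nsq u.
Proof.
move=> [a b]; rewrite /nsq RpZ IpZ normc_sq.
have La (t : R) := rL2Z t a; have Lb (t : R) := rL2Z t b.
have E (s t : R) f g : rL2 f -> rL2 g ->
    ip (fun x => s * f x + t * g x) (fun x => s * f x + t * g x) =
    s ^+ 2 * ip f f + 2 * s * t * ip f g + t ^+ 2 * ip g g.
  move=> Lf Lg; have Lsf := rL2Z s Lf; have Ltg := rL2Z t Lg.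
  have Ls := rL2D Lsf Ltg.
  rewrite ipDl// !ipZl// (ipC f) (ipC g (fun _ => _)) !ipDl// !ipZl// (ipC g f); ring.
rewrite !E// (ipC (Ip u) (Rp u)); ring.
Qed.

(** The symmetric bilinear pairing of two complex functions against a real
    weight, in terms of which every form of the problem is written. *)
Definition cform k u v : R[i] := cintegral (fun x => u x * v x * (k x)%:C).

Definition weight k : Prop := measurable_fun setT (k : plane R -> R) /\
  exists C : R, forall x, Omega x -> `|k x| <= C.

Lemma rL2_weight k f : weight k -> rL2 f -> rL2 (fun x => f x * k x).
Proof. by move=> [mk [C kC]] Lf; exact: rL2_mulb Lf mk kC. Qed.

Lemma cformE k u v : weight k -> cL2 u -> cL2 v -> cform k u v =
  (ip (fun x => Rp u x * k x) (Rp v) - ip (fun x => Ip u x * k x) (Ip v)) +i*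
  (ip (fun x => Rp u x * k x) (Ip v) + ip (fun x => Ip u x * k x) (Rp v)).
Proof.
move=> wk [Lu Lu'] [Lv Lv']; have Lk := rL2_weight wk Lu; have Lk' := rL2_weight wk Lu'.
rewrite /cform /cintegral /ip -RintegralB//; [|exact: rL2_mul_integrable|exact: rL2_mul_integrable].
rewrite -RintegralD//; [|exact: rL2_mul_integrable|exact: rL2_mul_integrable].
congr (_ +i* _).
  apply: eq_Rintegral => x; rewrite inE => Ox; rewrite !RpE// !IpE//.
  by case: (u x) (v x) => a b [c d] /=; ring.
apply: eq_Rintegral => x; rewrite inE => Ox; rewrite !RpE// !IpE//.
by case: (u x) (v x) => a b [c d] /=; ring.
Qed.

Lemma cform_ext k u u' v v' :
  (forall x, Omega x -> u x * v x = u' x * v' x) -> cform k u v = cform k u' v'.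
Proof.
move=> H; rewrite /cform /cintegral.
by congr (_ +i* _); apply: eq_Rintegral => x; rewrite inE => Ox; rewrite H.
Qed.

Lemma cformC k u v : cform k u v = cform k v u.
Proof. by apply: cform_ext => x _; rewrite mulrC. Qed.

Lemma complexP (z w : R[i]) : complex.Re z = complex.Re w -> complex.Im z = complex.Im w -> z = w.
Proof. by case: z w => a b [c d] /= -> ->. Qed.

Lemma cformDl k u u' v : weight k -> cL2 u -> cL2 u' -> cL2 v ->
  cform k (fun x => u x + u' x) v = cform k u v + cform k u' v.
Proof.
move=> wk Lu Lu' Lv; rewrite !cformE//; last exact: cL2D.
rewrite RpD IpD.
have D f g : (fun x => (f x + g x) * k x) = (fun x => f x * k x + g x * k x).
  by apply/funext => x; rewrite mulrDl.
rewrite !D; case: Lu Lu' Lv => [a b] [a' b'] [c d].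
have L f (Lf : rL2 f) := @rL2_weight k f wk Lf.
have La := L _ a; have Lb := L _ b; have La' := L _ a'; have Lb' := L _ b'.
by rewrite !ipDl//; apply: complexP => /=; ring.
Qed.

Lemma cformZl k (c : R[i]) u v : weight k -> cL2 u -> cL2 v ->
  cform k (fun x => c * u x) v = c * cform k u v.
Proof.
move=> wk Lu Lv; rewrite !cformE//; last exact: cL2Z.
rewrite RpZ IpZ.
have D (s t : R) f g : (fun x => (s * f x + t * g x) * k x) =
    (fun x => s * (f x * k x) + t * (g x * k x)).
  by apply/funext => x; ring.
rewrite !D; case: Lu Lv => [a b] [a' b'].
have L f (Lf : rL2 f) := @rL2_weight k f wk Lf.
have La := L _ a; have Lb := L _ b; have LaZ t := rL2Z t La; have LbZ t := rL2Z t Lb.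
rewrite !ipDl// !ipZl//; case: c {D} => s t.
by apply: complexP => /=; ring.
Qed.

Lemma cformDr k u v v' : weight k -> cL2 u -> cL2 v -> cL2 v' ->
  cform k u (fun x => v x + v' x) = cform k u v + cform k u v'.
Proof. by move=> wk Lu Lv Lv'; rewrite cformC cformDl// !(cformC _ u). Qed.

Lemma cformZr k (c : R[i]) u v : weight k -> cL2 u -> cL2 v ->
  cform k u (fun x => c * v x) = c * cform k u v.
Proof. by move=> wk Lu Lv; rewrite cformC cformZl// (cformC _ u). Qed.

Lemma weightD k k' : weight k -> weight k' -> weight (fun x => k x + k' x).
Proof.
move=> [mk [C kC]] [mk' [C' kC']]; split; first exact: measurable_funD.
exists (C + C') => x Ox; apply: le_trans (ler_normD _ _) _.
by apply: lerD; [exact: kC|exact: kC'].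
Qed.

Lemma weightM k k' : weight k -> weight k' -> weight (fun x => k x * k' x).
Proof.
move=> [mk [C kC]] [mk' [C' kC']]; split; first exact: measurable_funM.
by exists (C * C') => x Ox; rewrite normrM ler_pM// ?kC ?kC'.
Qed.

Lemma weight_cst (c : R) : weight (fun=> c).
Proof. by split; [exact: measurable_cst|exists `|c|]. Qed.

Lemma cformDk k k' u v : weight k -> weight k' -> cL2 u -> cL2 v ->
  cform (fun x => k x + k' x) u v = cform k u v + cform k' u v.
Proof.
move=> wk wk' Lu Lv; rewrite !cformE//; last exact: weightD.
have D f : (fun x => f x * (k x + k' x)) = (fun x => f x * k x + f x * k' x).
  by apply/funext => x; rewrite mulrDr.
rewrite !D; case: Lu Lv => [a b] [c d].
have L f (Lf : rL2 f) := @rL2_weight k f wk Lf.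
have L' f (Lf : rL2 f) := @rL2_weight k' f wk' Lf.
have La := L _ a; have Lb := L _ b; have La' := L' _ a; have Lb' := L' _ b.
by rewrite !ipDl//; apply: complexP => /=; ring.
Qed.

Lemma cformZk (c : R) k u v : weight k -> cL2 u -> cL2 v ->
  cform (fun x => c * k x) u v = c%:C * cform k u v.
Proof.
move=> wk Lu Lv; rewrite !cformE//; last by apply: weightM => //; exact: weight_cst.
have D f : (fun x => f x * (c * k x)) = (fun x => c * (f x * k x)).
  by apply/funext => x; ring.
rewrite !D; case: Lu Lv => [a b] [a' b'].
have L f (Lf : rL2 f) := @rL2_weight k f wk Lf.
have La := L _ a; have Lb := L _ b.
by rewrite !ipZl//; apply: complexP => /=; ring.
Qed.

Definition wsq k u : R := ip (fun x => Rp u x * k x) (fun x => Rp u x * k x) +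
  ip (fun x => Ip u x * k x) (fun x => Ip u x * k x).

Lemma wsq_le k u (C : R) : weight k -> cL2 u -> (forall x, Omega x -> `|k x| <= C) ->
  wsq k u <= C ^+ 2 * nsq u.
Proof.
move=> wk [a b] kC.
have H f : rL2 f -> ip (fun x => f x * k x) (fun x => f x * k x) <= C ^+ 2 * ip f f.
  move=> Lf; rewrite -ip_sqrZ//; apply: ip_le; [exact: rL2_weight|exact: rL2Z|] => x Ox.
  by rewrite !normrM mulrC ler_wpM2r// (le_trans (kC x Ox))// ler_norm.
by rewrite /wsq /nsq mulrDr; apply: lerD; exact: H.
Qed.

Lemma wsq1 u : wsq (fun=> 1) u = nsq u.
Proof.
have E f : (fun x : R * R => f x * 1) = f by apply/funext => x; rewrite mulr1.
by rewrite /wsq /nsq !E.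
Qed.

(** Weighted Cauchy-Schwarz inequality; the weight is split into two factors
    because one of them is put on a function that it makes small. *)
Lemma cform_le k k' u v : weight k -> weight k' -> cL2 u -> cL2 v -> forall A B : R,
  0 <= A -> 0 <= B ->
  wsq k u <= A ^+ 2 -> wsq k' v <= B ^+ 2 ->
  Normc.normc (cform (fun x => k x * k' x) u v) <= 4 * (A * B).
Proof.
move=> wk wk' Lu Lv A B A0 B0 HA HB.
rewrite cformE//; last exact: weightM.
have D f g : ip (fun x => f x * (k x * k' x)) g = ip (fun x => f x * k x) (fun x => g x * k' x).
  by apply: eq_Rintegral => x _; ring.
rewrite !D; case: Lu Lv => [a b] [c d].
have L f (Lf : rL2 f) := @rL2_weight k f wk Lf.
have L' f (Lf : rL2 f) := @rL2_weight k' f wk' Lf.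
have La := L _ a; have Lb := L _ b; have Lc := L' _ c; have Ld := L' _ d.
have CS f g : rL2 f -> rL2 g -> ip f f <= A ^+ 2 -> ip g g <= B ^+ 2 -> `|ip f g| <= A * B.
  move=> Lf Lg fA gB; apply: le_trans (ip_cs Lf Lg) _.
  rewrite -(ger0_norm A0) -(ger0_norm B0) -!sqrtr_sqr.
  by rewrite ler_pM ?sqrtr_ge0// ler_sqrt ?sqr_ge0.
have a0 := ip_ge0 (fun x => Rp u x * k x); have b0 := ip_ge0 (fun x => Ip u x * k x).
have c0 := ip_ge0 (fun x => Rp v x * k' x); have d0 := ip_ge0 (fun x => Ip v x * k' x).
have hA1 := le_trans (ler_wpDr b0 (lexx _)) HA; have hA2 := le_trans (ler_wpDl a0 (lexx _)) HA.
have hB1 := le_trans (ler_wpDr d0 (lexx _)) HB; have hB2 := le_trans (ler_wpDl c0 (lexx _)) HB.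
have e1 := CS _ _ La Lc hA1 hB1; have e2 := CS _ _ Lb Ld hA2 hB2.
have e3 := CS _ _ La Ld hA1 hB2; have e4 := CS _ _ Lb Lc hA2 hB1.
apply: le_trans (normc_le _) _ => /=.
apply: le_trans (lerD (ler_normB _ _) (ler_normD _ _)) _.
apply: le_trans (lerD (lerD e1 e2) (lerD e3 e4)) _.
by move: (A * B); clear; move=> t; lra.
Qed.

Lemma ae_cform k u u' v : weight k -> cL2 u -> cL2 u' -> cL2 v ->
  {ae leb2, forall x, Omega x -> u x = u' x} -> cform k u v = cform k u' v.
Proof.
move=> wk Lu Lu' Lv H; rewrite !cformE//; case: Lu Lu' Lv => [a b] [a' b'] [c d].
have L f (Lf : rL2 f) := @rL2_weight k f wk Lf.
have HR : {ae leb2, forall x, Omega x -> Rp u x * k x = Rp u' x * k x}.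
  by apply: (ae_imp H) => x + Ox => /(_ Ox) E; rewrite !RpE// E.
have HI : {ae leb2, forall x, Omega x -> Ip u x * k x = Ip u' x * k x}.
  by apply: (ae_imp H) => x + Ox => /(_ Ox) E; rewrite !IpE// E.
have La := L _ a; have Lb := L _ b; have La' := L _ a'; have Lb' := L _ b'.
have ER g (Lg : rL2 g) := ae_eq_ip La La' Lg HR.
have EI g (Lg : rL2 g) := ae_eq_ip Lb Lb' Lg HI.
by rewrite !ER// !EI.
Qed.

End ComplexL2.

(** * Sobolev norms of complex functions *)

Section WeakDerivatives.
Variable R : realType.
Local Open Scope complex_scope.
Implicit Types (u v : R * R -> R[i]) (f g k : R * R -> R).

Lemma cintegral_test u f : cintegral (fun x => u x * (f x)%:C) = ip (Rp u) f +i* ip (Ip u) f.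
Proof.
rewrite /cintegral; congr (_ +i* _); apply: eq_Rintegral => x; rewrite inE => Ox.
  by rewrite RpE//; case: (u x) => a b /=; rewrite mulr0 subr0.
by rewrite IpE//; case: (u x) => a b /=; rewrite mulr0 add0r.
Qed.

(** Real test functions separate the real and imaginary parts of a weak
    derivative. *)
Lemma is_wderivE (al : nat * nat) u v : is_wderiv al u v <->
  cL2 v /\ forall f, test_function f ->
    ip (Rp u) (mpderiv al f) = (-1) ^+ (al.1 + al.2) * ip (Rp v) f /\
    ip (Ip u) (mpderiv al f) = (-1) ^+ (al.1 + al.2) * ip (Ip v) f.
Proof.
have E (n : nat) (z : R[i]) : (-1) ^+ n * z =
    ((-1) ^+ n * complex.Re z) +i* ((-1) ^+ n * complex.Im z).
  elim: n z => [|n IH] [x y]; first by rewrite !expr0 !mul1r.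
  by rewrite exprS -mulrA IH /= !exprS; apply: complexP => /=; ring.
split => [[Lv H]|[Lv H]].
  split; first exact/inL2P.
  by move=> f tf; have := H f tf; rewrite !cintegral_test E => -[-> ->].
split; first exact/inL2P.
by move=> f tf; have [h1 h2] := H f tf; rewrite !cintegral_test E /= h1 h2.
Qed.

Lemma ip_test_uniq f f' : rL2 f -> rL2 f' ->
  (forall g, test_function g -> ip f g = ip f' g) ->
  {ae leb2, forall x : plane R, Omega x -> f x = f' x}.
Proof.
move=> Lf Lf' H.
have LB := rL2B Lf Lf'.
have := @fundamental_lemma2 R (fun x => f x - f' x).
move=> /(_ (rL2_integrable LB)) K.
have /K : forall g1 g2 : R -> R, test1 g1 -> test1 g2 ->
    (\int[leb2]_(x in Omega) ((f x - f' x) * tensor g1 g2 x))%R = 0.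
  move=> g1 g2 t1 t2; have tt := test_tensor t1 t2.
  rewrite -[LHS]/(ip (fun x => f x - f' x) (tensor g1 g2)) ipBl ?H ?subrr//.
  exact: rL2_test.
by move=> Z; apply: (ae_imp Z) => x + Ox => /(_ Ox) /eqP; rewrite subr_eq0 => /eqP.
Qed.

Lemma is_wderiv_uniq al u v v' : is_wderiv al u v -> is_wderiv al u v' ->
  {ae leb2, forall x : plane R, Omega x -> v x = v' x}.
Proof.
move=> /is_wderivE[[a b] H] /is_wderivE[[a' b'] H'].
have s0 : (-1) ^+ (al.1 + al.2) != 0 :> R by rewrite expf_neq0// oppr_eq0 oner_eq0.
have er : {ae leb2, forall x : plane R, Omega x -> Rp v x = Rp v' x}.
  apply: ip_test_uniq => // g tg; apply: (mulfI s0).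
  by rewrite -(H g tg).1 -(H' g tg).1.
have ei : {ae leb2, forall x : plane R, Omega x -> Ip v x = Ip v' x}.
  apply: ip_test_uniq => // g tg; apply: (mulfI s0).
  by rewrite -(H g tg).2 -(H' g tg).2.
apply: (ae_imp2 er ei) => x Er Ei Ox; apply: complexP.
  by have := Er Ox; rewrite !RpE.
by have := Ei Ox; rewrite !IpE.
Qed.

Lemma wderivP al u : (exists v, is_wderiv al u v) -> is_wderiv al u (wderiv al u).
Proof. by move=> [v Hv]; exact: (xgetPex (fun=> 0) (ex_intro _ v Hv)). Qed.

Lemma is_wderiv0 u : cL2 u -> is_wderiv (0, 0)%N u u.
Proof. by move=> Lu; split; [exact/inL2P|move=> f _; rewrite expr0 mul1r]. Qed.

(** A weak gradient of a complex function, given by real and imaginary parts;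
    [cgradP] compares it with the derivatives of the statement. *)
Definition cgrad u u1 u2 : Prop :=
  rgrad (Rp u) (Rp u1) (Rp u2) /\ rgrad (Ip u) (Ip u1) (Ip u2).

Lemma cgradP u u1 u2 : cgrad u u1 u2 <->
  [/\ cL2 u, is_wderiv (1, 0)%N u u1 & is_wderiv (0, 1)%N u u2].
Proof.
split => [[[Lr Lr1 Lr2 Hr1 Hr2] [Li Li1 Li2 Hi1 Hi2]]|[[Lr Li]]].
  split => //; apply/is_wderivE; split => // f tf; rewrite /= expr1 !mulN1r.
    by split; [exact: Hr1|exact: Hi1].
  by split; [exact: Hr2|exact: Hi2].
move=> /is_wderivE[[Lr1 Li1] H1] /is_wderivE[[Lr2 Li2] H2]; split; split => // f tf.
- by have [] := H1 f tf; rewrite /= expr1 !mulN1r.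
- by have [] := H2 f tf; rewrite /= expr1 !mulN1r.
- by have [] := H1 f tf; rewrite /= expr1 !mulN1r.
- by have [] := H2 f tf; rewrite /= expr1 !mulN1r.
Qed.

Lemma cgrad_cL2 u u1 u2 : cgrad u u1 u2 -> [/\ cL2 u, cL2 u1 & cL2 u2].
Proof. by move=> [[? ? ? _ _] [? ? ? _ _]]. Qed.

Lemma cgradD u u1 u2 v v1 v2 : cgrad u u1 u2 -> cgrad v v1 v2 ->
  cgrad (fun x => u x + v x) (fun x => u1 x + v1 x) (fun x => u2 x + v2 x).
Proof. by move=> [a b] [c d]; rewrite /cgrad !RpD !IpD; split; exact: rgradD. Qed.

Lemma cgradZ (c : R[i]) u u1 u2 : cgrad u u1 u2 ->
  cgrad (fun x => c * u x) (fun x => c * u1 x) (fun x => c * u2 x).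
Proof.
by move=> [a b]; rewrite /cgrad !RpZ !IpZ; split; apply: rgradD; exact: rgradZ.
Qed.

Lemma cgrad_conj u u1 u2 : cgrad u u1 u2 ->
  cgrad (fun x => conjc (u x)) (fun x => conjc (u1 x)) (fun x => conjc (u2 x)).
Proof.
by move=> [a b]; rewrite /cgrad !Rp_conj !Ip_conj; split => //; exact: rgradZ.
Qed.

Lemma cgradB u u1 u2 v v1 v2 : cgrad u u1 u2 -> cgrad v v1 v2 ->
  cgrad (fun x => u x - v x) (fun x => u1 x - v1 x) (fun x => u2 x - v2 x).
Proof.
move=> gu gv; have := cgradD gu (cgradZ (-1) gv).
have E (f g : R * R -> R[i]) : (fun x => f x + -1 * g x) = (fun x : R * R => f x - g x :> R[i]).
  by apply/funext => x; rewrite mulN1r.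
by rewrite (E u v) (E u1 v1) (E u2 v2).
Qed.

Lemma rL2_onO f : rL2 f -> rL2 (f \_ Omega).
Proof.
move=> [mf f2]; split; first by apply/measurable_onO; exact: measurable_funTS.
apply: le_lt_trans f2; rewrite le_eqVlt; apply/orP; left; apply/eqP.
by apply: eq_integral => x Ox; rewrite patchE Ox.
Qed.

Lemma ip_onO f g : ip (f \_ Omega) g = ip f g.
Proof. by apply: eq_Rintegral => x Ox; rewrite patchE Ox. Qed.

Lemma rgrad_onO f f1 f2 : rgrad f f1 f2 -> rgrad (f \_ Omega) (f1 \_ Omega) (f2 \_ Omega).
Proof.
move=> [L L1 L2 H1 H2]; split; [exact: rL2_onO..| |] => g tg; rewrite !ip_onO; auto.
Qed.

Lemma Rp_real f : Rp (fun x => (f x)%:C) = f \_ Omega.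
Proof. by []. Qed.

Lemma Ip_real f : Ip (fun x => (f x)%:C) = fun=> 0.
Proof. by apply/funext => x; rewrite /Ip patchE; case: ifP. Qed.

Lemma cgrad_real f f1 f2 : rgrad f f1 f2 ->
  cgrad (fun x => (f x)%:C) (fun x => (f1 x)%:C) (fun x => (f2 x)%:C).
Proof. by move=> g; split; [exact: rgrad_onO|rewrite !Ip_real; exact: rgrad0]. Qed.

Lemma cgrad_uniq u u1 u2 v1 v2 : cgrad u u1 u2 -> cgrad u v1 v2 ->
  {ae leb2, forall x : plane R, Omega x -> u1 x = v1 x} /\
  {ae leb2, forall x : plane R, Omega x -> u2 x = v2 x}.
Proof.
by move=> /cgradP[_ a b] /cgradP[_ c d]; split; [exact: is_wderiv_uniq a c|exact: is_wderiv_uniq b d].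
Qed.

Lemma ae_nsq u v : cL2 u -> cL2 v ->
  {ae leb2, forall x : plane R, Omega x -> u x = v x} -> nsq u = nsq v.
Proof.
move=> [a b] [c d] H.
have er : {ae leb2, forall x : plane R, Omega x -> Rp u x = Rp v x}.
  by apply: (ae_imp H) => x + Ox => /(_ Ox) E; rewrite !RpE// E.
have ei : {ae leb2, forall x : plane R, Omega x -> Ip u x = Ip v x}.
  by apply: (ae_imp H) => x + Ox => /(_ Ox) E; rewrite !IpE// E.
rewrite /nsq (ae_eq_ip a c a er) (ae_eq_ip b d b ei) !(ipC _ (Rp u)) !(ipC _ (Ip u)).
by rewrite (ae_eq_ip a c c er) (ae_eq_ip b d d ei).
Qed.

(** Square of the H^1 norm, for any choice of the weak gradient. *)
Definition h1sq u u1 u2 : R := nsq u + nsq u1 + nsq u2.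

Lemma h1sq_ge0 u u1 u2 : 0 <= h1sq u u1 u2.
Proof. by apply: addr_ge0 (nsq_ge0 _); apply: addr_ge0; exact: nsq_ge0. Qed.

Lemma Hnorm_sq_1 u : Hnorm_sq 1 u =
  (L2norm (wderiv (0, 0)%N u) ^+ 2 + L2norm (wderiv (0, 1)%N u) ^+ 2 +
   L2norm (wderiv (1, 0)%N u) ^+ 2)%E.
Proof.
rewrite /Hnorm_sq truncn1 subrr ltxx adde0.
have E (P : pred 'I_2) (F : 'I_2 -> \bar R) : (\sum_(j < 2 | P j) F j =
    (if P ord0 then F ord0 else 0) + (if P (lift ord0 ord0) then F (lift ord0 ord0) else 0))%E.
  by rewrite big_mkcond big_ord_recl big_ord_recl big_ord0; congr (_ + _)%E; exact: adde0.
rewrite big_ord_recl big_ord_recl big_ord0 !E /=; congr (_ + _)%E.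
by rewrite -[RHS]adde0; congr (_ + _)%E; exact: adde0.
Qed.

Lemma inH1_cgrad u : inH 1 u -> cgrad u (wderiv (1, 0)%N u) (wderiv (0, 1)%N u).
Proof.
move=> [Lu ex _]; apply/cgradP; rewrite truncn1 in ex; split; first exact/inL2P.
  exact: wderivP (ex 1 0 _)%N.
exact: wderivP (ex 0 1 _)%N.
Qed.

Lemma L2norm_wderiv al u v : is_wderiv al u v -> (L2norm (wderiv al u) ^+ 2 = (nsq v)%:E)%E.
Proof.
move=> wv; have dv := wderivP (ex_intro _ _ wv).
have [[Lv _] [Ld _]] := ((is_wderivE al u v).1 wv, (is_wderivE al u _).1 dv).
by rewrite L2norm_sq// (ae_nsq Ld Lv (is_wderiv_uniq dv wv)).
Qed.

Lemma cgrad_Hnorm_sq u u1 u2 : cgrad u u1 u2 -> Hnorm_sq 1 u = (h1sq u u1 u2)%:E.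
Proof.
move=> gu; have /cgradP[Lu w1 w2] := gu.
rewrite Hnorm_sq_1 /h1sq addrAC EFinD EFinD.
have E0 := L2norm_wderiv (is_wderiv0 Lu); have E1 := L2norm_wderiv w1.
by have E2 := L2norm_wderiv w2; congr (_ + _ + _)%E.
Qed.

Lemma cgrad_inH1 u u1 u2 : cgrad u u1 u2 -> inH 1 u.
Proof.
move=> gu; have /cgradP[Lu w1 w2] := gu; split; first exact/inL2P.
  rewrite truncn1 => -[|[|//]] [|[|//]] //= _; [|by exists u2|by exists u1].
  by exists u; exact: is_wderiv0.
by rewrite (cgrad_Hnorm_sq gu) ltry.
Qed.

Lemma sqrte_le1 (x : \bar R) : (0 <= x)%E -> (sqrte x <= 1)%E -> (x <= 1)%E.
Proof.
case: x => [r| |] //=; rewrite !lee_fin => r0 h.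
by rewrite -(sqr_sqrtr r0) -[leRHS](expr1n _ 2) lerXn2r ?nnegrE ?sqrtr_ge0.
Qed.

Lemma sqrte_le (x : \bar R) (r : R) : 0 <= r -> (x <= (r ^+ 2)%:E)%E -> (sqrte x <= r%:E)%E.
Proof.
move=> r0; case: x => [t| |] //=; rewrite ?lee_fin// => h.
by rewrite -[leRHS](ger0_norm r0) -sqrtr_sqr ler_wsqrtr.
Qed.

Lemma cgrad_Hnorm u u1 u2 : cgrad u u1 u2 -> Hnorm 1 u = (Num.sqrt (h1sq u u1 u2))%:E.
Proof.
move=> gu; rewrite /Hnorm; case: asboolP => [_|H]; first by rewrite (cgrad_Hnorm_sq gu).
by case: H; exact: cgrad_inH1 gu.
Qed.

Lemma truncn_lt1 (s : R) : 0 <= s < 1 -> Num.truncn s = 0%N.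
Proof. by move=> s01; apply: truncn_def. Qed.

Lemma Hnorm_sq_lt1 (s : R) u : 0 <= s < 1 -> Hnorm_sq s u =
  (L2norm (wderiv (0, 0)%N u) ^+ 2 +
   if (0 < s)%R then slobodeckij s (wderiv (0, 0)%N u) else 0)%E.
Proof.
move=> s01; rewrite /Hnorm_sq truncn_lt1// subr0.
by rewrite !big_ord1 big_mkcond big_ord1.
Qed.

Lemma slobodeckij_le (s : R) u : cL2 u ->
  (slobodeckij s u <= slobR s (Rp u) + slobR s (Ip u))%E.
Proof.
move=> [Lr Li].
pose K1 z := (slobK s (Rp u) z)%:E; pose K2 z := (slobK s (Ip u) z)%:E.
pose K z := (K1 z + K2 z)%E.
have m1 : measurable_fun setT K1 by apply/measurable_EFinP; apply: measurable_slobK; exact: Lr.1.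
have m2 : measurable_fun setT K2 by apply/measurable_EFinP; apply: measurable_slobK; exact: Li.1.
have mK : measurable_fun setT K by exact: emeasurable_funD.
have p1 z : (0 <= K1 z)%E by rewrite lee_fin slobK_ge0.
have p2 z : (0 <= K2 z)%E by rewrite lee_fin slobK_ge0.
have pK z : (0 <= K z)%E by rewrite adde_ge0.
have -> : slobodeckij s u = (\int[leb2]_(x in Omega) \int[leb2]_(y in Omega) K (x, y))%E.
  apply: eq_integral => x; rewrite inE => Ox; apply: eq_integral => y; rewrite inE => Oy.
  rewrite /K /K1 /K2 /slobK /= -EFinD -mulrDl normc_sq !RpE// !IpE//.
  by rewrite !raddfB.
apply: le_trans (double_integral_le mK m1 m2 pK p1 p2 ler01 ler01 _) _.
  by move=> z; rewrite !mul1e.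
by apply: leeD; rewrite mul1e.
Qed.

Lemma slobodeckij_ge0 (s : R) u : (0 <= slobodeckij s u)%E.
Proof.
apply: integral_ge0 => x _; apply: integral_ge0 => y _.
by rewrite lee_fin divr_ge0 ?sqr_ge0 ?powR_ge0.
Qed.

Lemma ae_Rp u v : {ae leb2, forall x : plane R, Omega x -> u x = v x} ->
  {ae leb2, forall x : plane R, Omega x -> Rp u x = Rp v x}.
Proof. by move=> H; apply: (ae_imp H) => x + Ox => /(_ Ox) E; rewrite !RpE// E. Qed.

Lemma ae_Ip u v : {ae leb2, forall x : plane R, Omega x -> u x = v x} ->
  {ae leb2, forall x : plane R, Omega x -> Ip u x = Ip v x}.
Proof. by move=> H; apply: (ae_imp H) => x + Ox => /(_ Ox) E; rewrite !IpE// E. Qed.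

(** A weak gradient belongs to every function that agrees with [u] almost
    everywhere; this is how the chosen representative [wderiv (0, 0) u], which
    enters the norms, is handled. *)
Lemma ae_cgrad u v u1 u2 : cL2 v ->
  {ae leb2, forall x : plane R, Omega x -> u x = v x} ->
  cgrad u u1 u2 -> cgrad v u1 u2.
Proof.
move=> [c d] H [[Lr a b Hr1 Hr2] [Li a' b' Hi1 Hi2]].
have Er g (Lg : rL2 g) := ae_eq_ip Lr c Lg (ae_Rp H).
have Ei g (Lg : rL2 g) := ae_eq_ip Li d Lg (ae_Ip H).
split; split => // f tf; have Lf j := rL2_pderiv j tf.
- by rewrite -Er// Hr1.
- by rewrite -Er// Hr2.
- by rewrite -Ei// Hi1.
- by rewrite -Ei// Hi2.
Qed.

(** The complex form of [interpolation], including the case [s = 0] in which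
    the norm is the L^2 norm. *)
Lemma Hnorm_interpolation (s : R) : 0 <= s < 1 -> forall d : R, 0 < d ->
  exists2 D : R, 0 <= D & forall u u1 u2, cgrad u u1 u2 ->
  inH s u /\ (Hnorm_sq s u <= (d * (nsq u1 + nsq u2) + D * nsq u)%:E)%E.
Proof.
move=> s01 d d0.
have [D D0 HD] : exists2 D : R, 0 <= D & forall u u1 u2, cgrad u u1 u2 ->
    (Hnorm_sq s u <= (d * (nsq u1 + nsq u2) + D * nsq u)%:E)%E.
  have [s0|s0] := leP s 0.
    exists 1 => // u u1 u2 gu; rewrite Hnorm_sq_lt1// ltNge s0 adde0.
    have [Lu L1 L2] := cgrad_cL2 gu.
    rewrite (L2norm_wderiv (is_wderiv0 Lu)) lee_fin mul1r lerDr.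
    by rewrite mulr_ge0 ?(ltW d0)// addr_ge0// nsq_ge0.
  have s01' : 0 < s < 1 by rewrite s0; case/andP: s01.
  have [D D0 HD] := interpolation s01' d0.
  exists (D + 1) => [|u u1 u2 gu]; first by rewrite addr_ge0.
  rewrite Hnorm_sq_lt1// s0; have [Lu L1 L2] := cgrad_cL2 gu.
  have dv := wderivP (ex_intro _ _ (is_wderiv0 Lu)).
  have [Lw _] := (is_wderivE _ _ _).1 dv.
  have wu := is_wderiv_uniq (is_wderiv0 Lu) dv; have gw := ae_cgrad Lw wu gu.
  have nw := esym (ae_nsq Lu Lw wu).
  rewrite (L2norm_wderiv (is_wderiv0 Lu)).
  have B := slobodeckij_le s Lw.
  have B1 := HD _ _ _ (rgrad_weak gw.1); have B2 := HD _ _ _ (rgrad_weak gw.2).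
  have {}B := le_trans B (leeD B1 B2).
  apply: le_trans (leeD (lexx _) B) _; rewrite -!EFinD lee_fin -nw /nsq.
  by rewrite le_eqVlt; apply/orP; left; apply/eqP; ring.
exists D => // u u1 u2 gu; split; last exact: HD.
have [Lu L1 L2] := cgrad_cL2 gu; split; first exact/inL2P.
  by rewrite truncn_lt1// => -[|//] [|//] _; exists u; exact: is_wderiv0.
by apply: le_lt_trans (HD _ _ _ gu) _; rewrite ltry.
Qed.

Lemma Hnorm_sq_ge_L2 (r : R) u : (L2norm (wderiv (0, 0)%N u) ^+ 2 <= Hnorm_sq r u)%E.
Proof.
have L0 v : (0 <= L2norm v ^+ 2)%E by rewrite expe_ge0// sqrte_ge0.
rewrite /Hnorm_sq big_ord_recl big_mkcond big_ord_recl /=.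
rewrite -addeA -addeA leeDl//; apply: adde_ge0; last apply: adde_ge0.
- by apply: sume_ge0 => j _; case: ifP => // _; exact: L0.
- by apply: sume_ge0 => i _; apply: sume_ge0 => j _; exact: L0.
by case: ifP => // _; apply: sume_ge0 => i _; exact: slobodeckij_ge0.
Qed.

Lemma H_ball_L2 (r : R) u : H_ball r u -> cL2 u /\ nsq u <= 1.
Proof.
move=> [iu]; rewrite /Hnorm; case: asboolP => // _ h.
have Lu : cL2 u by apply/inL2P; case: iu.
split => //; rewrite -lee_fin -(L2norm_wderiv (is_wderiv0 Lu)).
apply: le_trans (Hnorm_sq_ge_L2 r u) _; apply: sqrte_le1 => //.
apply: le_trans (Hnorm_sq_ge_L2 r u); by rewrite expe_ge0// sqrte_ge0.
Qed.

End WeakDerivatives.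

(** * The pulled-back form *)

Section Geometry.
Variable R : realType.
Local Open Scope complex_scope.
Implicit Types (phi : R -> R -> R) (eps : R) (x : R * R).

(** The entries of the second row of [Dh]; for [eps = 0] division by zero gives
    [0] and [1], so the unperturbed square is covered by the same formulas. *)
Definition pfun phi eps x : R := phi x.2 eps / eps * cos (x.1 / eps).
Definition qfun phi eps x : R := 1 + derive1 (phi ^~ eps) x.2 * sin (x.1 / eps).

(** The shape of [Dh]: the first coordinate is left unchanged. *)
Definition lower2 (p q : R) : 'M[R]_2 := \matrix_(i < 2, j < 2)
  if i == ord0 then (if j == ord0 then 1 else 0) else (if j == ord0 then p else q).

Lemma DhE phi eps x : eps = 0 \/ derivable (phi ^~ eps) x.2 1 ->
  Dh phi eps x = lower2 (pfun phi eps x) (qfun phi eps x).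
Proof.
move=> H; apply/matrixP => i j; rewrite !mxE /pderiv /comp2.
have I1 t : is_derive t (1 : R) (fun s : R => s) 1 by exact: is_derive_id.
have scal t : is_derive t (1 : R) (fun s : R => s / eps) (eps^-1).
  have := @is_deriveZ R R^o R^o id (eps^-1) t 1 1 (I1 t).
  rewrite /GRing.scale /= mulr1 => D.
  by rewrite (_ : (fun s => s / eps) = (fun s => eps^-1 * s))//; apply/funext => s; rewrite mulrC.
case: ifP => _; rewrite /unit_vec; case: ifP => _.
- rewrite (_ : (fun y => _) = fst); last by apply/funext => y; rewrite /h; case: ifP.
  have D := @is_derive_section1 R fst x 1 (I1 x.1); exact: derive_val.
- rewrite (_ : (fun y => _) = fst); last by apply/funext => y; rewrite /h; case: ifP.
  have D := @is_derive_section2 R fst x 0 (is_derive_cst _ _ _); exact: derive_val.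
- rewrite /h /pfun; have [->|e0] := eqVneq eps 0.
    rewrite invr0 mulr0 mul0r.
    have D := @is_derive_section1 R snd x 0 (is_derive_cst _ _ _); exact: derive_val.
  suff D : is_derive x (1, 0) (fun y : R * R => y.2 + phi y.2 eps * sin (y.1 / eps))
      (phi x.2 eps / eps * cos (x.1 / eps)) by exact: derive_val.
  apply: is_derive_section1 => /=.
  have D1 := @is_derive1_comp R sin (fun s => s / eps) x.1 _ _ (is_derive_sin (x.1 / eps)) (scal x.1).
  have D2 := is_deriveZ (phi x.2 eps) D1.
  have D3 := is_deriveD (is_derive_cst x.2 x.1 (1 : R)) D2.
  apply: is_derive_eq D3 _; rewrite add0r /GRing.scale /=; ring.
- rewrite /h /qfun; have [e0|e0] := eqVneq eps 0.
    rewrite e0 invr0 mulr0 sin0 mulr0 addr0.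
    have D := @is_derive_section2 R snd x 1 (I1 x.2); exact: derive_val.
  case: H => [/eqP|H]; first by rewrite (negbTE e0).
  suff D : is_derive x (0, 1) (fun y : R * R => y.2 + phi y.2 eps * sin (y.1 / eps))
      (1 + derive1 (phi ^~ eps) x.2 * sin (x.1 / eps)) by exact: derive_val.
  apply: is_derive_section2 => /=.
  have D0 : is_derive x.2 (1 : R) (phi ^~ eps) (derive1 (phi ^~ eps) x.2).
    by rewrite derive1E; exact: derivableP.
  have D2 := is_deriveM D0 (is_derive_cst (sin (x.1 / eps)) x.2 (1 : R)).
  have D3 := is_deriveD (I1 x.2) D2.
  apply: is_derive_eq D3 _; rewrite /GRing.scale /= mulr0 add0r; ring.
Qed.

Lemma det_lower2 p q : \det (lower2 p q) = q.
Proof.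
rewrite det_trig; last first.
  by apply/is_trig_mxP => i j ij; rewrite mxE; case: i j ij => [[|[|//]] i] [[|[|//]] j].
by rewrite big_ord_recl big_ord_recl big_ord0 !mxE /= mul1r mulr1.
Qed.

Lemma inv_lower2 p q : q != 0 -> invmx (lower2 p q) = lower2 (- (p / q)) q^-1.
Proof.
move=> q0; have E : lower2 p q *m lower2 (- (p / q)) q^-1 = 1%:M.
  apply/matrixP => i j; rewrite !mxE big_ord_recl big_ord_recl big_ord0 !mxE /=.
  case: i j => [[|[|//]] i] [[|[|//]] j] /=; rewrite ?mulr1 ?mul1r ?mulr0 ?mul0r ?addr0 ?add0r//.
    by rewrite mulrN mulrCA divff// mulr1 subrr.
  by rewrite divff.
have [U _] := mulmx1_unit E.
by rewrite -[LHS]mulmx1 -E mulKmx.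
Qed.

Lemma grad_epsE phi eps (u : R * R -> R[i]) x (p q : R) : q != 0 -> Dh phi eps x = lower2 p q ->
  grad_eps phi eps u x ord0 ord0 = wderiv (1, 0)%N u x - (p / q)%:C * wderiv (0, 1)%N u x /\
  grad_eps phi eps u x (lift ord0 ord0) ord0 = (q^-1)%:C * wderiv (0, 1)%N u x.
Proof.
move=> q0 E; rewrite /grad_eps E inv_lower2// !mxE !big_ord_recl !big_ord0 !mxE /=.
by rewrite rmorph0 rmorph1 rmorphN mul0r mul1r !addr0 add0r mulNr.
Qed.

End Geometry.

Section Forms.
Variable R : realType.
Local Open Scope complex_scope.
Implicit Types (u v w : R * R -> R[i]) (f g k p q r : R * R -> R).

Definition cintegrable (F : R * R -> R[i]) : Prop :=
  leb2.-integrable (Omega : set (plane R)) (EFin \o (fun x => complex.Re (F x))) /\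
  leb2.-integrable (Omega : set (plane R)) (EFin \o (fun x => complex.Im (F x))).

Lemma cintegralD (F G : R * R -> R[i]) : cintegrable F -> cintegrable G ->
  cintegrable (fun x => F x + G x) /\
  cintegral (fun x => F x + G x) = cintegral F + cintegral G.
Proof.
move=> [F1 F2] [G1 G2].
have ER : (fun x => complex.Re (F x + G x)) = (fun x => complex.Re (F x) + complex.Re (G x)).
  by apply/funext => x; rewrite raddfD.
have EI : (fun x => complex.Im (F x + G x)) = (fun x => complex.Im (F x) + complex.Im (G x)).
  by apply/funext => x; rewrite raddfD.
rewrite /cintegrable /cintegral ER EI; split.
  by split; [exact: (integrableD _ F1 G1)|exact: (integrableD _ F2 G2)].
by rewrite !RintegralD//; apply: complexP.
Qed.

Lemma eq_cintegral (F G : R * R -> R[i]) : (forall x, Omega x -> F x = G x) ->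
  cintegral F = cintegral G.
Proof.
move=> H; rewrite /cintegral.
by congr (_ +i* _); apply: eq_Rintegral => x; rewrite inE => Ox; rewrite H.
Qed.

Lemma cform_integrable k u v : weight k -> cL2 u -> cL2 v ->
  cintegrable (fun x => u x * v x * (k x)%:C).
Proof.
move=> wk [a b] [c d]; have Lk := rL2_weight wk a; have Lk' := rL2_weight wk b.
have i1 := rL2_mul_integrable Lk c; have i2 := rL2_mul_integrable Lk' d.
have i3 := rL2_mul_integrable Lk d; have i4 := rL2_mul_integrable Lk' c.
have iB := integrableB (@measurable_Omega R) i1 i2.
have iD := integrableD (@measurable_Omega R) i3 i4.
split.
  apply: eq_integrable iB => // x; rewrite inE => Ox /=; rewrite -EFinB; congr EFin.
  by rewrite !RpE// !IpE//; case: (u x) (v x) => a' b' [c' d'] /=; ring.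
apply: eq_integrable iD => // x; rewrite inE => Ox /=; rewrite -EFinD; congr EFin.
by rewrite !RpE// !IpE//; case: (u x) (v x) => a' b' [c' d'] /=; ring.
Qed.

Definition aform (a : R) p q r u u1 u2 v v1 v2 : R[i] :=
  cform q u1 v1 + cform p u1 v2 + cform p u2 v1 + cform r u2 v2 + a%:C * cform q u v.

(** The coefficients of the pulled-back form: the matrix
    [(Dh)^-1 (Dh)^-T |Jh|] equals [[q, p], [p, r]]. *)
Definition geometry (C eta : R) p q r : Prop :=
  [/\ weight p, weight q, weight r & forall x, Omega x ->
    [/\ `|p x| <= C, `|q x - 1| <= eta & q x * r x = 1 + p x ^+ 2]].

Lemma geometry0 (C eta : R) : 0 <= C -> 0 <= eta ->
  geometry C eta (fun=> 0) (fun=> 1) (fun=> 1).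
Proof.
move=> C0 e0; split; try exact: weight_cst.
by move=> x _; rewrite normr0 subrr normr0 expr0n addr0 mulr1.
Qed.

Definition kappa (C a : R) : R := Num.min (a / 2) (1 / (16 * (C ^+ 2 + 1))).

Lemma kappa_gt0 (C a : R) : 0 < a -> 0 < kappa C a.
Proof.
by move=> a0; rewrite lt_min !divr_gt0// mulr_gt0// ltr_wpDl// sqr_ge0.
Qed.

(** Completing the square gives [((Q s + P t)^2 + t^2) / Q], whose vanishing
    forces [t] and then [s] to vanish; the constant makes this quantitative. *)
Lemma coercive_pointwise (C P Q T s t : R) : `|P| <= C -> 2^-1 <= Q <= 2 ->
  Q * T = 1 + P ^+ 2 -> 1 / (16 * (C ^+ 2 + 1)) * (s ^+ 2 + t ^+ 2) <=
  s * Q * s + 2 * (s * P * t) + t * T * t.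
Proof.
move=> PC /andP[q1 q2] QT.
have Q0 : 0 < Q by lra.
have c0 : 0 < 16 * (C ^+ 2 + 1) by rewrite mulr_gt0// ltr_wpDl// sqr_ge0.
have C0 : 0 <= C by exact: le_trans PC.
have P2 : P ^+ 2 <= C ^+ 2.
  by rewrite -(real_normK (num_real P)) lerXn2r ?nnegrE.
have E : s * Q * s + 2 * (s * P * t) + t * T * t = ((Q * s + P * t) ^+ 2 + t ^+ 2) / Q.
  apply: (mulIf (lt0r_neq0 Q0)); rewrite mulfVK ?gt_eqF//.
  have -> : (s * Q * s + 2 * (s * P * t) + t * T * t) * Q =
    (Q * s) ^+ 2 + 2 * (Q * s) * (P * t) + t ^+ 2 * (Q * T) by ring.
  by rewrite QT; ring.
rewrite E; set z := Q * s + P * t.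
have s2 : s ^+ 2 <= 8 * z ^+ 2 + 8 * C ^+ 2 * t ^+ 2.
  have h1 : (Q * s) ^+ 2 <= 2 * z ^+ 2 + 2 * (P ^+ 2 * t ^+ 2).
    have -> : Q * s = z - P * t by rewrite /z; ring.
    rewrite -exprMn; have := sqr_ge0 (z + P * t); rewrite sqrrB sqrrD; lra.
  have h2 : 4^-1 * s ^+ 2 <= (Q * s) ^+ 2.
    rewrite exprMn ler_wpM2r ?sqr_ge0//.
    have -> : 4^-1 = 2^-1 ^+ 2 :> R by field.
    by rewrite lerXn2r ?nnegrE ?(ltW Q0).
  have h3 : P ^+ 2 * t ^+ 2 <= C ^+ 2 * t ^+ 2 by rewrite ler_wpM2r ?sqr_ge0.
  rewrite -mulrA; move: (C ^+ 2 * _) (P ^+ 2 * _) (s ^+ 2) (z ^+ 2) ((Q * s) ^+ 2) h1 h2 h3.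
  by clear; move=> *; lra.
rewrite ler_pdivlMr// mul1r -mulrA mulrC ler_pdivrMr//.
rewrite [(_ + _) * Q]mulrC.
have z2 := sqr_ge0 z; have t2 := sqr_ge0 t; have C2 := sqr_ge0 C.
have : Q * (s ^+ 2 + t ^+ 2) <= 2 * (s ^+ 2 + t ^+ 2) by rewrite ler_wpM2r ?addr_ge0 ?sqr_ge0.
move=> /le_trans; apply; have Cz : 0 <= C ^+ 2 * z ^+ 2 by rewrite mulr_ge0.
move: s2 Cz; rewrite -mulrA => s2 Cz.
have -> : (z ^+ 2 + t ^+ 2) * (16 * (C ^+ 2 + 1)) =
  16 * (C ^+ 2 * z ^+ 2) + 16 * (C ^+ 2 * t ^+ 2) + 16 * z ^+ 2 + 16 * t ^+ 2 by ring.
have Ct : 0 <= C ^+ 2 * t ^+ 2 by rewrite mulr_ge0.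
move: (C ^+ 2 * z ^+ 2) (C ^+ 2 * t ^+ 2) (s ^+ 2) (t ^+ 2) (z ^+ 2) s2 Cz Ct z2 t2; clear.
by move=> *; lra.
Qed.

Section Bounds.
Variables (C eta : R) (p q r : R * R -> R).
Hypotheses (C0 : 0 <= C) (eta2 : eta <= 2^-1) (G : geometry C eta p q r).

Let wp : weight p. Proof. by case: G. Qed.
Let wq : weight q. Proof. by case: G. Qed.
Let wr : weight r. Proof. by case: G. Qed.

Lemma geometry_q x : Omega x -> 2^-1 <= q x <= 2.
Proof.
move=> Ox; have [_ _ _ /(_ x Ox)[_ + _]] := G.
rewrite ler_norml => /andP[h1 h2]; apply/andP; split; move: h1 h2 eta2; lra.
Qed.

Lemma A_op_aform (a : R) phi eps u v : inH 1 u -> inH 1 v ->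
  (forall x, Omega x -> Dh phi eps x = lower2 (- p x) (q x)) ->
  A_op a phi eps u v = aform a p q r u (wderiv (1, 0)%N u) (wderiv (0, 1)%N u)
    v (wderiv (1, 0)%N v) (wderiv (0, 1)%N v).
Proof.
move=> /inH1_cgrad gu /inH1_cgrad gv HD.
have [Lu Lu1 Lu2] := cgrad_cL2 gu; have [Lv Lv1 Lv2] := cgrad_cL2 gv.
have [u1 E1] : exists u1, wderiv (1, 0)%N u = u1 by eexists.
have [u2 E2] : exists u2, wderiv (0, 1)%N u = u2 by eexists.
have [v1 E3] : exists v1, wderiv (1, 0)%N v = v1 by eexists.
have [v2 E4] : exists v2, wderiv (0, 1)%N v = v2 by eexists.
rewrite E1 E2 E3 E4 in gu gv Lu1 Lu2 Lv1 Lv2 *.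
have i1 := cform_integrable wq Lu1 Lv1; have i2 := cform_integrable wp Lu1 Lv2.
have i3 := cform_integrable wp Lu2 Lv1; have i4 := cform_integrable wr Lu2 Lv2.
have [i12 e12] := cintegralD i1 i2; have [i123 e123] := cintegralD i12 i3.
have [_ e] := cintegralD i123 i4.
rewrite /A_op /aform; congr (_ + _ * _).
  rewrite /cform -e12 -e123 -e; apply: eq_cintegral => x Ox.
  have /andP[q1 _] := geometry_q Ox; have q0 : 0 < q x by apply: lt_le_trans q1; rewrite invr_gt0.
  have [g1 g2] := grad_epsE u (lt0r_neq0 q0) (HD x Ox).
  have [g3 g4] := grad_epsE v (lt0r_neq0 q0) (HD x Ox).
  rewrite !big_ord_recl big_ord0 addr0 g1 g2 g3 g4 E1 E2 E3 E4 /Jh HD// det_lower2 gtr0_norm//.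
  have -> : r x = (1 + p x ^+ 2) / q x.
    by have [_ _ _ /(_ x Ox)[_ _ <-]] := G; field; rewrite gt_eqF.
  have qc : (q x)%:C != 0 by rewrite fmorph_eq0 gt_eqF.
  by rewrite !(rmorphM, rmorphD, rmorphN, rmorph1, fmorphV, rmorphXn) /=; field.
apply: eq_cintegral => x Ox; rewrite /Jh HD// det_lower2 gtr0_norm//.
by have /andP[q1 _] := geometry_q Ox; apply: lt_le_trans q1; rewrite invr_gt0.
Qed.

Lemma embed_cform phi eps u v :
  (forall x, Omega x -> Dh phi eps x = lower2 (- p x) (q x)) ->
  embed phi eps u v = cform q u v.
Proof.
move=> HD; apply: eq_cintegral => x Ox; rewrite /Jh HD// det_lower2 gtr0_norm//.
by have /andP[q1 _] := geometry_q Ox; apply: lt_le_trans q1; rewrite invr_gt0.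
Qed.

Lemma ae_aform (a : R) u u1 u2 u1' u2' v v1 v2 v1' v2' :
  cgrad u u1 u2 -> cgrad u u1' u2' -> cgrad v v1 v2 -> cgrad v v1' v2' ->
  aform a p q r u u1 u2 v v1 v2 = aform a p q r u u1' u2' v v1' v2'.
Proof.
move=> gu gu' gv gv'; have [a1 a2] := cgrad_uniq gu gu'; have [b1 b2] := cgrad_uniq gv gv'.
have [Lu Lu1 Lu2] := cgrad_cL2 gu; have [Lv Lv1 Lv2] := cgrad_cL2 gv.
have [_ Lu1' Lu2'] := cgrad_cL2 gu'; have [_ Lv1' Lv2'] := cgrad_cL2 gv'.
have E k (f f' g g' : R * R -> R[i]) : weight k -> cL2 f -> cL2 f' -> cL2 g -> cL2 g' ->
    {ae leb2, forall x : plane R, Omega x -> f x = f' x} ->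
    {ae leb2, forall x : plane R, Omega x -> g x = g' x} -> cform k f g = cform k f' g'.
  move=> wk Lf Lf' Lg Lg' ff gg.
  by rewrite (ae_cform wk Lf Lf' Lg ff) cformC (ae_cform wk Lg Lg' Lf' gg) cformC.
rewrite /aform (E q u1 u1' v1 v1')// (E p u1 u1' v2 v2')// (E p u2 u2' v1 v1')//.
by rewrite (E r u2 u2' v2 v2').
Qed.

Lemma A_opE (a : R) phi eps u u1 u2 v v1 v2 : cgrad u u1 u2 -> cgrad v v1 v2 ->
  (forall x, Omega x -> Dh phi eps x = lower2 (- p x) (q x)) ->
  A_op a phi eps u v = aform a p q r u u1 u2 v v1 v2.
Proof.
move=> gu gv HD; have iu := cgrad_inH1 gu; have iv := cgrad_inH1 gv.
rewrite (A_op_aform _ iu iv HD).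
by apply: ae_aform => //; exact: inH1_cgrad.
Qed.

Lemma coercive_real (a : R) f f1 f2 : 0 < a -> rL2 f -> rL2 f1 -> rL2 f2 ->
  kappa C a * (ip f f + ip f1 f1 + ip f2 f2) <=
  ip (fun x => f1 x * q x) f1 + 2 * ip (fun x => f1 x * p x) f2 +
  ip (fun x => f2 x * r x) f2 + a * ip (fun x => f x * q x) f.
Proof.
move=> a0 Lf L1 L2.
set k := 1 / (16 * (C ^+ 2 + 1)).
have k0 : 0 <= k by rewrite divr_ge0// mulr_ge0// addr_ge0// sqr_ge0.
have i1 := rL2_mul_integrable (rL2_weight wq L1) L1.
have i2 := rL2_mul_integrable (rL2_weight wp L1) L2.
have i3 := rL2_mul_integrable (rL2_weight wr L2) L2.
have i4 := rL2_mul_integrable L1 L1; have i5 := rL2_mul_integrable L2 L2.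
have i6 := rL2_mul_integrable Lf Lf; have i7 := rL2_mul_integrable (rL2_weight wq Lf) Lf.
have zl g (c : R) : leb2.-integrable (Omega : set (plane R)) (EFin \o g) ->
  leb2.-integrable (Omega : set (plane R)) (EFin \o (fun x => c * g x)).
  by move=> ig; exact: (integrableZl (@measurable_Omega R) c ig).
have dl g g' : leb2.-integrable (Omega : set (plane R)) (EFin \o g) ->
  leb2.-integrable (Omega : set (plane R)) (EFin \o g') ->
  leb2.-integrable (Omega : set (plane R)) (EFin \o (fun x => g x + g' x)).
  by move=> ig ig'; exact: (integrableD (@measurable_Omega R) ig ig').
have P1 : k * (ip f1 f1 + ip f2 f2) <= ip (fun x => f1 x * q x) f1 +
    2 * ip (fun x => f1 x * p x) f2 + ip (fun x => f2 x * r x) f2.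
  have i2' := zl _ 2 i2; have i12 := dl _ _ i1 i2'; have i45 := dl _ _ i4 i5.
  rewrite /ip -RintegralD// -RintegralZl// -RintegralZl// -RintegralD// -RintegralD//.
  apply: le_Rintegral => //; [exact: zl|exact: dl|] => x Ox.
  have [_ _ _ /(_ x Ox)[pC qe qr]] := G.
  have := @coercive_pointwise C (p x) (q x) (r x) (f1 x) (f2 x) pC (geometry_q Ox) qr.
  by rewrite -!expr2.
have P2 : 2^-1 * ip f f <= ip (fun x => f x * q x) f.
  rewrite /ip -RintegralZl//; apply: le_Rintegral => //; first exact: zl.
  move=> x Ox; have /andP[q1 _] := geometry_q Ox.
  by rewrite mulrAC [leRHS]mulrC ler_wpM2r// -expr2 sqr_ge0.
have ka : kappa C a <= a / 2 by rewrite ge_min lexx.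
have kk : kappa C a <= k by rewrite ge_min lexx orbT.
rewrite -(addrA (ip f f)) (addrC (ip f f)) mulrDr; apply: lerD.
  by apply: le_trans P1; rewrite ler_wpM2r// addr_ge0// ip_ge0.
apply: (@le_trans _ _ (a * (2^-1 * ip f f))).
  by rewrite mulrA ler_wpM2r// ip_ge0.
by rewrite ler_wpM2l// ltW.
Qed.

(** The real part of the form at [u] and its conjugate is the sum of the real
    forms at the real and imaginary parts of [u]. *)
Lemma coercive (a : R) u u1 u2 : 0 < a -> cgrad u u1 u2 ->
  kappa C a * h1sq u u1 u2 <=
  Normc.normc (aform a p q r u u1 u2 (fun x => conjc (u x)) (fun x => conjc (u1 x))
    (fun x => conjc (u2 x))).
Proof.
move=> a0 gu; have [Lu Lu1 Lu2] := cgrad_cL2 gu.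
(* pairing with a conjugate turns the bilinear form into an inner product *)
have Re_cform k (f g : R * R -> R[i]) : weight k -> cL2 f -> cL2 g ->
    complex.Re (cform k f (fun x => conjc (g x))) =
    ip (fun x => Rp f x * k x) (Rp g) + ip (fun x => Ip f x * k x) (Ip g).
  move=> wk Lf Lg; rewrite cformE//; last exact: cL2_conj.
  rewrite Rp_conj Ip_conj /=; case: Lf Lg => [b c] [d e].
  by rewrite (ipC _ (fun x => -1 * Ip g x)) ipZl//; [rewrite (ipC (Ip g)); ring|exact: rL2_weight].
have sw k f g : ip (fun x => f x * k x) g = ip (fun x => g x * k x) f.
  by apply: eq_Rintegral => x _; ring.
apply: le_trans (Re_le_normc _); apply: le_trans (ler_norm _).
have [[b1 b2] [c1 c2] [d1 d2]] := And3 Lu Lu1 Lu2.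
have H1 := coercive_real a0 b1 c1 d1; have H2 := coercive_real a0 b2 c2 d2.
have ReD (y z : R[i]) : complex.Re (y + z) = complex.Re y + complex.Re z by case: y z => ? ? [].
have ReZ (z : R[i]) : complex.Re (a%:C * z) = a * complex.Re z.
  by case: z => s t /=; rewrite mul0r subr0.
rewrite /aform !ReD ReZ.
rewrite !Re_cform// (sw p (Rp u2)) (sw p (Ip u2)).
apply: le_trans (le_trans (lerD H1 H2) _); first by rewrite -mulrDr /h1sq /nsq; rewrite le_eqVlt; apply/orP; left; apply/eqP; congr (_ * _); ring.
by rewrite le_eqVlt; apply/orP; left; apply/eqP; ring.
Qed.

(** The case in which the whole weight is put on the second function. *)
Lemma cform_le1 k u v (A B : R) : weight k -> cL2 u -> cL2 v -> 0 <= A -> 0 <= B ->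
  nsq u <= A ^+ 2 -> wsq k v <= B ^+ 2 -> Normc.normc (cform k u v) <= 4 * (A * B).
Proof.
move=> wk Lu Lv A0 B0 uA vB.
have := cform_le (weight_cst 1) wk Lu Lv A0 B0; rewrite wsq1 => /(_ uA vB).
by rewrite (_ : (fun x => 1 * k x) = k)//; apply/funext => x; rewrite mul1r.
Qed.

Lemma normcD (y z : R[i]) : Normc.normc (y + z) <= Normc.normc y + Normc.normc z.
Proof. exact: le_normcD. Qed.

Lemma cform1D k u v : weight k -> cL2 u -> cL2 v ->
  cform k u v = cform (fun=> 1) u v + cform (fun x => k x - 1) u v.
Proof.
move=> wk Lu Lv; rewrite -cformDk//; [|exact: weight_cst|by apply: weightD => //; exact: weight_cst].
by congr (cform _ u v); apply/funext => x; rewrite addrC subrK.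
Qed.

Lemma cform0k u v : cL2 u -> cL2 v -> cform (fun=> 0) u v = 0.
Proof.
move=> Lu Lv; transitivity (0%:C * cform (fun=> 1) u v); last exact: mul0r.
rewrite -cformZk//; last exact: weight_cst.
by congr (cform _ u v); apply/funext => x; rewrite mul0r.
Qed.

Hypothesis eta0 : 0 <= eta.

Lemma wsq_q1 v (W : R) : cL2 v -> 0 <= W -> nsq v <= W ^+ 2 ->
  wsq (fun x => q x - 1) v <= (eta * W) ^+ 2.
Proof.
move=> Lv W0 vW; apply: le_trans (wsq_le (C := eta) _ Lv _) _.
- by apply: weightD => //; exact: weight_cst.
- by move=> x Ox; have [_ _ _ /(_ x Ox)[]] := G.
- by rewrite exprMn ler_wpM2l ?sqr_ge0.
Qed.

(** From [q r = 1 + p^2] one gets [q (r - 1) = (1 - q) + p^2], and one of the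
    two factors [p] is simply bounded. *)
Lemma wsq_r1 v (W D : R) : cL2 v -> 0 <= W -> 0 <= D -> nsq v <= W ^+ 2 ->
  wsq p v <= D ^+ 2 -> wsq (fun x => r x - 1) v <= (3 * eta * W + 3 * C * D) ^+ 2.
Proof.
move=> [b c] W0 D0 vW vD.
have wr1 : weight (fun x => r x - 1) by apply: weightD => //; exact: weight_cst.
have bnd x : Omega x -> `|r x - 1| <= `|2 * eta + 2 * C * `|p x| |.
  move=> Ox; have [_ _ _ /(_ x Ox)[pC qe qr]] := G.
  have /andP[q1 _] := geometry_q Ox.
  rewrite [leRHS]ger0_norm ?addr_ge0 ?mulr_ge0//.
  have q0 : 0 < q x by apply: lt_le_trans q1; rewrite invr_gt0.
  have E : q x * (r x - 1) = - (q x - 1) + p x ^+ 2 by rewrite mulrBr qr; ring.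
  have H : `|q x * (r x - 1)| <= eta + C * `|p x|.
    rewrite E; apply: le_trans (ler_normD _ _) _; rewrite normrN lerD//.
    by rewrite normrX expr2 ler_wpM2r.
  rewrite normrM (gtr0_norm q0) in H.
  have H2 : 2^-1 * `|r x - 1| <= q x * `|r x - 1| by rewrite ler_wpM2r.
  have := le_trans H2 H; rewrite -mulrA; move: (C * _) `|_ - 1| => s t.
  by move=> h; rewrite -mulrDr -ler_pdivrMl.
have one f : rL2 f -> ip (fun x => f x * (r x - 1)) (fun x => f x * (r x - 1)) <=
    8 * eta ^+ 2 * ip f f + 8 * C ^+ 2 * ip (fun x => f x * p x) (fun x => f x * p x).
  move=> Lf.
  have wa : weight (fun x => `|p x|).
    case: wp => [mp [B HB]]; split; first exact: measurableT_comp.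
    by exists B => x Ox; rewrite normr_id; exact: HB.
  have La := rL2_weight wa Lf; have Lp := rL2_weight wp Lf.
  have LZ1 := rL2Z (2 * eta) Lf; have LZ2 := rL2Z (2 * C) La.
  apply: (@le_trans _ _ (ip (fun x => 2 * eta * f x + 2 * C * (f x * `|p x|))
     (fun x => 2 * eta * f x + 2 * C * (f x * `|p x|)))).
    apply: ip_le; [exact: rL2_weight|exact: rL2D|] => x Ox.
    rewrite normrM; apply: (@le_trans _ _ (`|f x| * `|2 * eta + 2 * C * `|p x| |)).
      by rewrite ler_wpM2l// bnd.
    by rewrite -normrM le_eqVlt; apply/orP; left; apply/eqP; congr (`|_|); ring.
  apply: le_trans (ip_sqrD LZ1 LZ2) _; rewrite !ip_sqrZ//.
  have -> : ip (fun x => f x * `|p x|) (fun x => f x * `|p x|) =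
      ip (fun x => f x * p x) (fun x => f x * p x).
    apply: eq_Rintegral => x _; rewrite mulrACA [RHS]mulrACA; congr (_ * _).
    by rewrite -!expr2 real_normK ?num_real.
  by rewrite le_eqVlt; apply/orP; left; apply/eqP; ring.
have o1 := one _ b; have o2 := one _ c.
apply: le_trans (lerD o1 o2) _.
have h1 : 8 * eta ^+ 2 * nsq v <= 8 * (eta * W) ^+ 2.
  rewrite [(eta * W) ^+ 2]exprMn [leRHS]mulrA; apply: ler_wpM2l vW.
  by apply: mulr_ge0 => //; exact: sqr_ge0.
have h2 : 8 * C ^+ 2 * wsq p v <= 8 * (C * D) ^+ 2.
  rewrite [(C * D) ^+ 2]exprMn [leRHS]mulrA; apply: ler_wpM2l vD.
  by apply: mulr_ge0 => //; exact: sqr_ge0.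
apply: (@le_trans _ _ (8 * eta ^+ 2 * nsq v + 8 * C ^+ 2 * wsq p v)).
  by rewrite le_eqVlt; apply/orP; left; apply/eqP; rewrite /nsq /wsq; ring.
apply: le_trans (lerD h1 h2) _.
have -> : (3 * eta * W + 3 * C * D) ^+ 2 =
  9 * (eta * W) ^+ 2 + 18 * ((eta * W) * (C * D)) + 9 * (C * D) ^+ 2 by ring.
have := mulr_ge0 (mulr_ge0 eta0 W0) (mulr_ge0 C0 D0).
have := sqr_ge0 (eta * W); have := sqr_ge0 (C * D).
move: ((eta * W) ^+ 2) ((C * D) ^+ 2) ((eta * W) * (C * D)) => x y z.
by move=> *; lra.
Qed.

(** Every coefficient differs from that of the Dirichlet form either by a
    uniformly small amount or by a multiple of [p]; in the latter case the
    factor [p] is kept with the gradient of [w]. *)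
Lemma aform_diff (a : R) u u1 u2 w w1 w2 (U W D : R) : 0 < a ->
  cgrad u u1 u2 -> cgrad w w1 w2 -> 0 <= U -> 0 <= W -> 0 <= D ->
  h1sq u u1 u2 <= U ^+ 2 -> h1sq w w1 w2 <= W ^+ 2 -> wsq p w1 + wsq p w2 <= D ^+ 2 ->
  Normc.normc (aform a p q r u u1 u2 w w1 w2 -
    aform a (fun=> 0) (fun=> 1) (fun=> 1) u u1 u2 w w1 w2) <=
  4 * U * ((4 + a) * eta * W + (2 + 3 * C) * D).
Proof.
move=> a0 gu gw U0 W0 D0 hU hW hD.
have [Lu Lu1 Lu2] := cgrad_cL2 gu; have [Lw Lw1 Lw2] := cgrad_cL2 gw.
have wge k v : 0 <= wsq k v by rewrite addr_ge0// ip_ge0.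
have [n0 n1 n2] := And3 (nsq_ge0 u) (nsq_ge0 u1) (nsq_ge0 u2).
have [m0 m1 m2] := And3 (nsq_ge0 w) (nsq_ge0 w1) (nsq_ge0 w2).
have uU : nsq u <= U ^+ 2 by move: hU; rewrite /h1sq; lra.
have u1U : nsq u1 <= U ^+ 2 by move: hU; rewrite /h1sq; lra.
have u2U : nsq u2 <= U ^+ 2 by move: hU; rewrite /h1sq; lra.
have wW : nsq w <= W ^+ 2 by move: hW; rewrite /h1sq; lra.
have w1W : nsq w1 <= W ^+ 2 by move: hW; rewrite /h1sq; lra.
have w2W : nsq w2 <= W ^+ 2 by move: hW; rewrite /h1sq; lra.
have p1D : wsq p w1 <= D ^+ 2 by have := wge p w2; move: hD; lra.
have p2D : wsq p w2 <= D ^+ 2 by have := wge p w1; move: hD; lra.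
rewrite /aform !cform0k// (cform1D wq Lu1 Lw1) (cform1D wr Lu2 Lw2) (cform1D wq Lu Lw).
set A1 := cform (fun=> 1) u1 w1; set A2 := cform (fun=> 1) u2 w2; set A3 := cform (fun=> 1) u w.
have wq1 : weight (fun x => q x - 1) by apply: weightD => //; exact: weight_cst.
have wr1 : weight (fun x => r x - 1) by apply: weightD => //; exact: weight_cst.
have b1 := cform_le1 wq1 Lu1 Lw1 U0 (mulr_ge0 eta0 W0) u1U (wsq_q1 Lw1 W0 w1W).
have b2 := cform_le1 wp Lu1 Lw2 U0 D0 u1U p2D.
have b3 := cform_le1 wp Lu2 Lw1 U0 D0 u2U p1D.
have r0 : 0 <= 3 * eta * W + 3 * C * D by rewrite addr_ge0// !mulr_ge0.
have b4 := cform_le1 wr1 Lu2 Lw2 U0 r0 u2U (wsq_r1 Lw2 W0 D0 w2W p2D).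
have b5 := cform_le1 wq1 Lu Lw U0 (mulr_ge0 eta0 W0) uU (wsq_q1 Lw W0 wW).
move: (cform (fun x => q x - 1) u1 w1) (cform p u1 w2) (cform p u2 w1)
  (cform (fun x => r x - 1) u2 w2) (cform (fun x => q x - 1) u w) b1 b2 b3 b4 b5.
move: A1 A2 A3 => A1 A2 A3 B1 B2 B3 B4 B5 b1 b2 b3 b4 b5.
have -> : A1 + B1 + B2 + B3 + (A2 + B4) + a%:C * (A3 + B5) - (A1 + 0 + 0 + A2 + a%:C * A3) =
  B1 + B2 + B3 + B4 + a%:C * B5 by ring.
have na : Normc.normc (a%:C * B5) = a * Normc.normc B5.
  by rewrite Normc.normcM /= expr0n addr0 sqrtr_sqr gtr0_norm.
have ab5 : a * Normc.normc B5 <= a * (4 * (U * (eta * W))) by rewrite ler_wpM2l// ltW.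
have h1 := normcD (B1 + B2 + B3 + B4) (a%:C * B5).
have h2 := normcD (B1 + B2 + B3) B4; have h3 := normcD (B1 + B2) B3; have h4 := normcD B1 B2.
rewrite na in h1; apply: le_trans h1 _.
have -> : 4 * U * ((4 + a) * eta * W + (2 + 3 * C) * D) =
  4 * (U * (eta * W)) + 4 * (U * D) + 4 * (U * D) + 4 * (U * (3 * eta * W + 3 * C * D)) +
  a * (4 * (U * (eta * W))) by ring.
by lra.
Qed.

End Bounds.
End Forms.

(** * Functionals and uniform bounds on resolvents *)

Section Functionals.
Variable R : realType.
Local Open Scope complex_scope.
Implicit Types (u v w : R * R -> R[i]) (F G : functional R).

(** Linearity on H^1, where all the functionals of the proof live. *)
Definition hlin F : Prop := forall (c : R[i]) u v, inH 1 u -> inH 1 v ->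
  F (fun x => c * u x + v x) = c * F u + F v.

(** Boundedness by an upper estimate [rho] of the norm, which spares the square
    root in the norm and may be applied to any choice of weak gradient. *)
Definition hbound F (c : R) : Prop := forall u u1 u2 (rho : R), cgrad u u1 u2 ->
  0 < rho -> h1sq u u1 u2 <= rho ^+ 2 -> Normc.normc (F u) <= c * rho.

Lemma cgrad0 : cgrad (fun=> 0 : R[i]) (fun=> 0) (fun=> 0).
Proof. exact: (cgrad_real (@rgrad0 R)). Qed.

Lemma hlinZ F (c : R[i]) u : hlin F -> inH 1 u -> F (fun x => c * u x) = c * F u.
Proof.
move=> lF iu; have i0 := cgrad_inH1 cgrad0.
have F0 : F (fun=> 0) = 0.
  have := lF 1 _ _ i0 i0.
  have -> : (fun x : R * R => 1 * (0 : R[i]) + 0) = (fun=> 0) by apply/funext => x; rewrite mul1r addr0.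
  by rewrite mul1r; move/(congr1 (fun z => z - F (fun=> 0))); rewrite subrr addrK => <-.
have := lF c _ _ iu i0; rewrite F0 addr0 => <-.
by congr F; apply/funext => x; rewrite addr0.
Qed.

Lemma hbound_in_dual F (c : R) : hlin F -> hbound F c -> in_dual 1 F.
Proof.
move=> lF bF; split; first exact: lF.
exists `|c| => u iu; have gu := inH1_cgrad iu; rewrite (cgrad_Hnorm gu) -EFinM lee_fin.
set h := h1sq _ _ _; apply/ler_addgt0Pr => e e0.
have c1 : 0 < `|c| + 1 by rewrite ltr_wpDl.
have r0 : 0 < Num.sqrt h + e / (`|c| + 1) by rewrite ltr_wpDl ?sqrtr_ge0// divr_gt0.
apply: le_trans (bF _ _ _ _ gu r0 _) _.
  have h0 : 0 <= h := h1sq_ge0 _ _ _.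
  rewrite -[leLHS](sqr_sqrtr h0) lerXn2r ?nnegrE ?sqrtr_ge0 ?(ltW r0)//.
  by rewrite lerDl divr_ge0 ?(ltW e0) ?(ltW c1).
apply: (@le_trans _ _ (`|c| * (Num.sqrt h + e / (`|c| + 1)))).
  by rewrite ler_wpM2r ?(ltW r0)// ler_norm.
rewrite mulrDr lerD2l mulrA ler_pdivrMr//.
by rewrite mulrC ler_wpM2l ?(ltW e0)// lerDl.
Qed.

Lemma hbound_dual_ball F : hlin F -> hbound F 1 -> dual_ball 1 F.
Proof.
move=> lF bF; split; first exact: hbound_in_dual bF.
apply: ub_ereal_sup => _ [u [iu nu] <-]; rewrite lee_fin.
have gu := inH1_cgrad iu; have := bF _ _ _ 1 gu ltr01; rewrite mulr1 expr1n; apply.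
move: nu; rewrite (cgrad_Hnorm gu) lee_fin => nu.
by rewrite -(sqr_sqrtr (h1sq_ge0 _ _ _)) -[leRHS](expr1n _ 2) lerXn2r ?nnegrE ?sqrtr_ge0.
Qed.

Lemma h1sqZ (c : R[i]) u u1 u2 : cgrad u u1 u2 ->
  h1sq (fun x => c * u x) (fun x => c * u1 x) (fun x => c * u2 x) =
  Normc.normc c ^+ 2 * h1sq u u1 u2.
Proof. by move=> /cgrad_cL2[a b d]; rewrite /h1sq !nsqZ// !mulrDr. Qed.

Lemma h1sq_conj u u1 u2 : cgrad u u1 u2 ->
  h1sq (fun x => conjc (u x)) (fun x => conjc (u1 x)) (fun x => conjc (u2 x)) = h1sq u u1 u2.
Proof. by move=> /cgrad_cL2[a b d]; rewrite /h1sq !nsq_conj. Qed.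

Lemma h1sqD u u1 u2 v v1 v2 : cgrad u u1 u2 -> cgrad v v1 v2 ->
  h1sq (fun x => u x + v x) (fun x => u1 x + v1 x) (fun x => u2 x + v2 x) <=
  2 * h1sq u u1 u2 + 2 * h1sq v v1 v2.
Proof.
move=> /cgrad_cL2[a b d] /cgrad_cL2[a' b' d'].
have := nsqD a a'; have := nsqD b b'; have := nsqD d d'; rewrite /h1sq.
by move=> h1 h2 h3; apply: le_trans (lerD (lerD h3 h2) h1) _; rewrite le_eqVlt; apply/orP; left; apply/eqP; ring.
Qed.

Lemma normc_real (c : R) : Normc.normc (c%:C) = `|c|.
Proof. by rewrite /= expr0n addr0 sqrtr_sqr. Qed.

(** A functional is bounded on the unit ball only; homogeneity gives the rest. *)
Lemma hbound_unit F (c : R) : hlin F ->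
  (forall u, H_ball 1 u -> Normc.normc (F u) <= c) -> hbound F c.
Proof.
move=> lF H u u1 u2 rho gu r0 hu.
have gz := cgradZ (rho^-1)%:C gu; have iz := cgrad_inH1 gz.
have B : H_ball 1 (fun x => (rho^-1)%:C * u x).
  split => //; rewrite (cgrad_Hnorm gz) lee_fin h1sqZ// normc_real gtr0_norm ?invr_gt0//.
  by rewrite -[leRHS]sqrtr1 ler_sqrt// exprVn mulrC ler_pdivrMr ?exprn_gt0// mul1r.
have := H _ B; rewrite (hlinZ _ lF (cgrad_inH1 gu)).
by rewrite Normc.normcM normc_real gtr0_norm ?invr_gt0// mulrC ler_pdivrMr.
Qed.

(** H^1 embeds in H^b for [b < 1], so the unit ball of the dual of H^b is
    bounded in the dual of H^1. *)
Lemma dual_ball_hbound (b : R) : 0 <= b < 1 -> exists2 c : R, 0 < c &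
  forall F, dual_ball b F -> hlin F /\ hbound F c.
Proof.
move=> b01; have [D D0 HD] := Hnorm_interpolation b01 ltr01.
exists (1 + D) => [|F [[lF _] nF]]; first by rewrite ltr_wpDr.
have ib u u1 u2 (gu : cgrad u u1 u2) : inH b u by exact: (HD _ _ _ gu).1.
have lF' : hlin F.
  by move=> c u v /inH1_cgrad gu /inH1_cgrad gv; apply: lF; [exact: ib gu|exact: ib gv].
split => // u u1 u2 rho gu r0 hu.
have t0 : 0 < (1 + D) * rho by rewrite mulr_gt0// ltr_wpDr.
pose t := ((1 + D) * rho)^-1; have tp : 0 < t by rewrite invr_gt0.
have gz := cgradZ t%:C gu.
have B : H_ball b (fun x => t%:C * u x).
  have [iz nz] := HD _ _ _ gz; split => //; rewrite /Hnorm; case: asboolP => // _.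
  apply: sqrte_le => //; apply: le_trans nz _; rewrite lee_fin expr1n.
  apply: (@le_trans _ _ ((1 + D) * h1sq (fun x => t%:C * u x) (fun x => t%:C * u1 x) (fun x => t%:C * u2 x))).
    rewrite mul1r mulrDl mul1r /h1sq.
    have := nsq_ge0 (fun x => t%:C * u x); have := nsq_ge0 (fun x => t%:C * u1 x).
    have := nsq_ge0 (fun x => t%:C * u2 x); move: (nsq _) (nsq _) (nsq _) => y1 y2 y3 h1 h2 h3.
    by apply: lerD; [lra|rewrite ler_wpM2l//; lra].
  rewrite h1sqZ// normc_real (gtr0_norm tp).
  apply: (@le_trans _ _ ((1 + D) * (t ^+ 2 * rho ^+ 2))).
    by rewrite ler_wpM2l ?addr_ge0// ler_wpM2l// sqr_ge0.
  have -> : (1 + D) * (t ^+ 2 * rho ^+ 2) = (1 + D)^-1.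
    by rewrite /t; field; apply/andP; split; rewrite gt_eqF// ltr_wpDr.
  by rewrite invf_le1 ?ltr_wpDr// lerDl.
have : Normc.normc (F (fun x => t%:C * u x)) <= 1.
  rewrite -lee_fin; apply: le_trans nF; apply: ereal_sup_ubound.
  by exists (fun x => t%:C * u x).
rewrite (hlinZ _ lF' (cgrad_inH1 gu)).
by rewrite Normc.normcM normc_real (gtr0_norm tp) /t mulrC ler_pdivrMr// mul1r.
Qed.

End Functionals.

Section Apriori.
Variable R : realType.
Local Open Scope complex_scope.
Implicit Types (u v w : R * R -> R[i]) (F G : functional R).
Variables (a : R) (phi : R -> R -> R) (eps : R).
Variables (C eta : R) (p q r : R * R -> R).
Hypotheses (a0 : 0 < a) (C0 : 0 <= C) (eta2 : eta <= 2^-1) (G : geometry C eta p q r).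
Hypothesis HD : forall x, Omega x -> Dh phi eps x = lower2 (- p x) (q x).

Let wp : weight p. Proof. by case: G. Qed.
Let wq : weight q. Proof. by case: G. Qed.
Let wr : weight r. Proof. by case: G. Qed.

Lemma aformDZl (c : R[i]) u u1 u2 v v1 v2 w w1 w2 :
  cgrad u u1 u2 -> cgrad v v1 v2 -> cgrad w w1 w2 ->
  aform a p q r (fun x => c * u x + v x) (fun x => c * u1 x + v1 x) (fun x => c * u2 x + v2 x)
    w w1 w2 = c * aform a p q r u u1 u2 w w1 w2 + aform a p q r v v1 v2 w w1 w2.
Proof.
move=> /cgrad_cL2[Lu Lu1 Lu2] /cgrad_cL2[Lv Lv1 Lv2] /cgrad_cL2[Lw Lw1 Lw2].
have E k (f g h : R * R -> R[i]) : weight k -> cL2 f -> cL2 g -> cL2 h ->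
    cform k (fun x => c * f x + g x) h = c * cform k f h + cform k g h.
  by move=> wk Lf Lg Lh; have Lc := cL2Z c Lf; rewrite cformDl// cformZl.
by rewrite /aform !E//; ring.
Qed.

Lemma aformC u u1 u2 v v1 v2 : aform a p q r u u1 u2 v v1 v2 = aform a p q r v v1 v2 u u1 u2.
Proof.
rewrite /aform (cformC q u1) (cformC p u1) (cformC p u2) (cformC r u2) (cformC q u).
by congr (_ + _ + _); rewrite -!addrA; congr (_ + _); rewrite addrC.
Qed.

Lemma solvesP (lam : R[i]) F u : solves a phi eps lam F u <-> inH 1 u /\
  forall u1 u2 w w1 w2, cgrad u u1 u2 -> cgrad w w1 w2 ->
    aform a p q r u u1 u2 w w1 w2 - lam * cform q u w = F w.
Proof.
split=> -[iu H]; split => //.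
  move=> u1 u2 w w1 w2 gu gw; rewrite -(H w (cgrad_inH1 gw)).
  by rewrite (A_opE eta2 G a gu gw HD) (embed_cform eta2 G _ _ HD).
move=> w iw; have gu := inH1_cgrad iu; have gw := inH1_cgrad iw.
by rewrite (A_opE eta2 G a gu gw HD) (embed_cform eta2 G _ _ HD); exact: H.
Qed.

Lemma solves_comb (lam c : R[i]) F H u v : solves a phi eps lam F u -> solves a phi eps lam H v ->
  solves a phi eps lam (fun w => c * F w + H w) (fun x => c * u x + v x).
Proof.
move=> /solvesP[iu Hu] /solvesP[iv Hv]; apply/solvesP.
have gu := inH1_cgrad iu; have gv := inH1_cgrad iv; have gc := cgradD (cgradZ c gu) gv.
split; first exact: cgrad_inH1 gc.
move=> u1 u2 w w1 w2 g gw; rewrite (ae_aform G a g gc gw gw) aformDZl//.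
have [Lu _ _] := cgrad_cL2 gu; have [Lv _ _] := cgrad_cL2 gv; have [Lw _ _] := cgrad_cL2 gw.
rewrite -(Hu _ _ _ _ _ gu gw) -(Hv _ _ _ _ _ gv gw) cformDl//; last exact: cL2Z.
by rewrite cformZl//; ring.
Qed.

Lemma resolvent_solves lam F : (exists u, solves a phi eps lam F u) ->
  solves a phi eps lam F (resolvent a phi eps lam F).
Proof. by move=> [u Hu]; exact: (xgetPex (fun=> 0) (ex_intro _ u Hu)). Qed.

Lemma hlin_embed u : cL2 u -> hlin (embed phi eps u).
Proof.
move=> Lu c v w /inH1_cgrad/cgrad_cL2[Lv _ _] /inH1_cgrad/cgrad_cL2[Lw _ _].
rewrite !(embed_cform eta2 G _ _ HD) cformDr//; last exact: cL2Z.
by rewrite cformZr.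
Qed.

(** The resolvent bound concerns the selected solution for data in the unit
    ball; uniqueness and scaling extend it to any solution for any data. *)
Lemma embed_bound (mu : R) lam F u (c : R) : resolvent_set a phi eps lam ->
  (resolvent_norm a phi eps lam <= mu%:E)%E -> hlin F -> hbound F c -> 0 < c ->
  solves a phi eps lam F u -> hbound (embed phi eps u) (c * mu).
Proof.
move=> [ex un _] nmu lF bF c0 su.
pose H : functional R := fun w => (c^-1)%:C * F w.
have lH : hlin H by move=> d v w iv iw; rewrite /H lF//; ring.
have bH : hbound H 1.
  move=> v v1 v2 rho gv r0 hv; rewrite /H Normc.normcM normc_real gtr0_norm ?invr_gt0//.
  by rewrite mulrC ler_pdivrMr// mul1r mulrC; exact: bF gv r0 hv.
have dH := hbound_dual_ball lH bH.
set v := resolvent a phi eps lam H.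
have sv : solves a phi eps lam H v by apply: resolvent_solves; apply: ex; case: dH.
have iu := su.1; have iv := sv.1.
have gu := inH1_cgrad iu; have gv := inH1_cgrad iv.
have [Lu _ _] := cgrad_cL2 gu; have [Lv _ _] := cgrad_cL2 gv.
have s0 : solves a phi eps lam (fun=> 0) (fun x => - c%:C * v x + u x).
  have := solves_comb (- c%:C) sv su; congr (solves _ _ _ _ _ _).
  apply/funext => w; rewrite /H mulrA mulNr -rmorphM /= divff ?gt_eqF//.
  by rewrite mulN1r addNr.
have uv : {ae leb2, forall x : plane R, Omega x -> u x = c%:C * v x}.
  apply: (ae_imp (un _ s0)) => x + Ox => /(_ Ox) /eqP.
  by rewrite mulNr addrC subr_eq0 => /eqP.
have bv : forall w, H_ball 1 w -> Normc.normc (embed phi eps v w) <= mu.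
  move=> w Bw; rewrite -lee_fin; apply: le_trans nmu.
  apply: (@le_trans _ _ (dual_norm 1 (embed phi eps v))).
    by apply: ereal_sup_ubound; exists w.
  by apply: ereal_sup_ubound; exists H.
have bv' := hbound_unit (hlin_embed Lv) bv.
move=> w w1 w2 rho gw r0 hw; have [Lw _ _] := cgrad_cL2 gw.
have := bv' _ _ _ _ gw r0 hw; rewrite !(embed_cform eta2 G _ _ HD).
rewrite (ae_cform wq Lu (cL2Z c%:C Lv) Lw uv) cformZl// Normc.normcM normc_real gtr0_norm//.
by move=> h; rewrite -mulrA ler_wpM2l// ltW.
Qed.

(** Coercivity at [u] and its conjugate, the term with [lam] being moved to
    the right, where [embed_bound] controls it. *)
Lemma apriori (mu L : R) lam F u u1 u2 (c : R) : resolvent_set a phi eps lam ->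
  (resolvent_norm a phi eps lam <= mu%:E)%E -> 0 <= mu -> Normc.normc lam <= L ->
  hlin F -> hbound F c -> 0 < c -> solves a phi eps lam F u -> cgrad u u1 u2 ->
  h1sq u u1 u2 <= (c * ((1 + L * mu) / kappa C a)) ^+ 2.
Proof.
move=> rs nmu mu0 lL lF bF c0 su gu.
have be := embed_bound rs nmu lF bF c0 su.
have k0 := kappa_gt0 C a0.
have L0 : 0 <= L := le_trans (normc_ge0 _) lL.
have [_ Hu] := (solvesP lam F u).1 su.
have h0 := h1sq_ge0 u u1 u2; set h := h1sq u u1 u2 in h0 *.
have [hz|hp] := eqVneq h 0; first by rewrite hz sqr_ge0.
have hpos : 0 < h by rewrite lt_neqAle eq_sym hp.
pose rho := Num.sqrt h; have rho0 : 0 < rho by rewrite sqrtr_gt0.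
have rhoE : rho ^+ 2 = h by rewrite sqr_sqrtr.
have gc := cgrad_conj gu.
have hc : h1sq (fun x => conjc (u x)) (fun x => conjc (u1 x)) (fun x => conjc (u2 x)) <= rho ^+ 2.
  by rewrite h1sq_conj// rhoE.
have B1 := bF _ _ _ _ gc rho0 hc; have B2 := be _ _ _ _ gc rho0 hc.
have K := coercive eta2 G a0 gu.
have E := Hu _ _ _ _ _ gu gc.
rewrite -(embed_cform eta2 G _ _ HD) in E.
move/(congr1 (fun z => z + lam * embed phi eps u (fun x => conjc (u x)))): E; rewrite subrK => E.
rewrite E in K.
have N : kappa C a * h <= c * rho + L * (c * mu * rho).
  apply: le_trans K _; apply: le_trans (normcD _ _) _; apply: lerD => //.
  by rewrite Normc.normcM ler_pM ?normc_ge0.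
have : kappa C a * rho <= c * (1 + L * mu).
  rewrite -(ler_pM2r rho0) -mulrA -expr2 rhoE; apply: le_trans N _.
  by rewrite le_eqVlt; apply/orP; left; apply/eqP; ring.
rewrite mulrC -ler_pdivlMr// mulrA => H; rewrite -rhoE lerXn2r ?nnegrE ?(ltW rho0)//.
by apply: le_trans H; exact: ltW.
Qed.

End Apriori.

(** * Smallness in the mean by duality *)

Section Comparison.
Variable R : realType.
Local Open Scope complex_scope.
Implicit Types (u v w g : R * R -> R[i]) (F : functional R).

Lemma cform_real f (h : R * R -> R) :
  cform (fun=> 1) f (fun x => (h x)%:C) = ip (Rp f) h +i* ip (Ip f) h.
Proof.
by rewrite -cintegral_test; apply: eq_cintegral => x _; rewrite mulr1.
Qed.

(** The form is real, so testing with real functions decouples the real and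
    imaginary parts. *)
Lemma real_part_weak_sol (a : R) u u1 u2 g : cgrad u u1 u2 -> cL2 g ->
  (forall w w1 w2, cgrad w w1 w2 ->
    aform a (fun=> 0) (fun=> 1) (fun=> 1) u u1 u2 w w1 w2 = cform (fun=> 1) g w) ->
  weak_sol a (Rp u) (Rp u1) (Rp u2) (Rp g) /\ weak_sol a (Ip u) (Ip u1) (Ip u2) (Ip g).
Proof.
move=> gu Lg H; have [Lu Lu1 Lu2] := cgrad_cL2 gu.
have E h h1 h2 (gh : rgrad h h1 h2) := H _ _ _ (cgrad_real gh).
have L (h h1 h2 : R * R -> R) : rgrad h h1 h2 ->
    [/\ cL2 (fun x => (h x)%:C), cL2 (fun x => (h1 x)%:C) & cL2 (fun x => (h2 x)%:C)].
  by move=> gh; exact: cgrad_cL2 (cgrad_real gh).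
split; split; [exact: gu.1| |exact: gu.2|].
  move=> h h1 h2 gh; have [Lh Lh1 Lh2] := L _ _ _ gh.
  have := congr1 (@complex.Re R) (E _ _ _ gh).
  by rewrite /aform !cform0k// !cform_real /= mul0r subr0 !addr0.
move=> h h1 h2 gh; have [Lh Lh1 Lh2] := L _ _ _ gh.
have := congr1 (@complex.Im R) (E _ _ _ gh).
by rewrite /aform !cform0k// !cform_real /= mul0r !addr0.
Qed.

Lemma Dh0 (phi : R -> R -> R) (x : R * R) : Dh phi 0 x = lower2 (- 0) 1.
Proof.
rewrite DhE; last by left.
by rewrite /pfun /qfun invr0 !mulr0 sin0 mulr0 mul0r oppr0 addr0.
Qed.

Lemma normcN (y : R[i]) : Normc.normc (- y) = Normc.normc y.
Proof. by case: y => s t; rewrite /= !sqrrN. Qed.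

Lemma nsq_le_h1sq u u1 u2 : nsq u <= h1sq u u1 u2.
Proof. by rewrite /h1sq -addrA lerDl addr_ge0// nsq_ge0. Qed.

Lemma hbound_cform k g (A B : R) : weight k -> cL2 g -> 0 <= A -> 0 <= B ->
  nsq g <= A ^+ 2 -> (forall x, Omega x -> `|k x| <= B) ->
  hbound (fun w => cform k g w) (4 * A * B).
Proof.
move=> wk Lg A0 B0 gA kB w w1 w2 rho gw r0 hw; have [Lw _ _] := cgrad_cL2 gw.
rewrite -!mulrA; apply: cform_le1 => //; first by rewrite mulr_ge0// ltW.
apply: le_trans (wsq_le wk Lw kB) _; rewrite exprMn ler_wpM2l ?sqr_ge0//.
exact: le_trans (nsq_le_h1sq _ _ _) hw.
Qed.

(** The value 0 of the spectral parameter is admissible, and the real part of a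
    solution with real datum solves the real problem. *)
Lemma weak_sol_exists (a : R) (phi : R -> R -> R) : resolvent_set a phi 0 0 ->
  forall g : R * R -> R, rL2 g -> exists w w1 w2 : R * R -> R, weak_sol a w w1 w2 g.
Proof.
move=> [ex _ _] g Lg.
have G := @geometry0 R 0 0 (lexx _) (lexx _).
have h0 : (0 : R) <= 2^-1 by [].
have HD x (Ox : Omega x) := Dh0 phi x.
have LgC : cL2 (fun x => (g x)%:C).
  by split; [exact: rL2_onO|rewrite Ip_real; exact: rL2_cst].
have w1 := @weight_cst R 1.
have lF := hlin_embed h0 G HD LgC.
have bF : hbound (embed phi 0 (fun x => (g x)%:C)) (4 * Num.sqrt (nsq (fun x => (g x)%:C)) * 1).
  move=> w v1 v2 rho gw rp hw; rewrite (embed_cform h0 G _ _ HD).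
  apply: (hbound_cform w1 LgC (sqrtr_ge0 _) ler01 _ _ gw rp hw).
    by rewrite sqr_sqrtr ?nsq_ge0.
  by move=> x _; rewrite normr1.
have [u su] := ex _ (hbound_in_dual lF bF).
have [iu Hu] := (solvesP a h0 G HD 0 _ u).1 su; have gu := inH1_cgrad iu.
have [|W _] := real_part_weak_sol (a := a) gu LgC.
  move=> w v1 v2 gw; rewrite -(embed_cform h0 G _ _ HD) -(Hu _ _ _ _ _ gu gw).
  by rewrite mul0r subr0.
exists (Rp u), (Rp (wderiv (1, 0)%N u)), (Rp (wderiv (0, 1)%N u)).
have [gW HW] := W; split => // h h1 h2 gh; rewrite (HW _ _ _ gh) Rp_real.
exact: ip_onO.
Qed.

Lemma compact_resolvent_scaled (a : R) : 0 < a ->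
  (forall g : R * R -> R, rL2 g -> exists w w1 w2 : R * R -> R, weak_sol a w w1 w2 g) ->
  forall B C d : R, 0 <= B -> 0 <= C -> 0 < d -> exists2 tau : R, 0 < tau &
  forall m : R * R -> R, measurable_fun setT (m : plane R -> R) ->
    (forall x, Omega x -> `|m x| <= C) ->
    ip (fun x => m x ^+ 2) (fun x => m x ^+ 2) <= tau ->
  forall (g w w1 w2 : R * R -> R) (t : R), 0 < t -> rL2 g -> ip g g <= B * t ^+ 2 -> weak_sol a w w1 w2 g ->
    ip (fun x => w1 x * m x) (fun x => w1 x * m x) +
    ip (fun x => w2 x * m x) (fun x => w2 x * m x) <= d * t ^+ 2.
Proof.
move=> a0 ex B C d B0 C0 d0; have [tau t0 H] := compact_resolvent a0 ex B0 C0 d0.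
exists tau => // m mm mC mt g w w1 w2 t tp Lg gB W.
have := H m mm mC mt _ _ _ _ (rL2Z t^-1 Lg) _ (weak_solZ t^-1 Lg W).
rewrite ip_sqrZ// exprVn mulrC ler_pdivrMr ?exprn_gt0// => /(_ gB).
have [[_ L1 L2 _ _] _] := W.
have E (f : R * R -> R) : rL2 f -> ip (fun x => t^-1 * f x * m x) (fun x => t^-1 * f x * m x) =
    (t ^+ 2)^-1 * ip (fun x => f x * m x) (fun x => f x * m x).
  move=> Lf; rewrite -exprVn -ip_sqrZ; last exact: rL2_mulb Lf mm mC.
  by apply: eq_Rintegral => x _; rewrite !mulrA.
by rewrite !E// -mulrDr mulrC ler_pdivrMr// exprn_gt0.
Qed.

Section FixedEps.
Variables (a : R) (phi : R -> R -> R) (eps : R).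
Variables (C eta : R) (p q r : R * R -> R).
Hypotheses (a0 : 0 < a) (C0 : 0 <= C) (eta0 : 0 <= eta) (eta2 : eta <= 2^-1).
Hypothesis G : geometry C eta p q r.
Hypothesis HD : forall x, Omega x -> Dh phi eps x = lower2 (- p x) (q x).
Variables (lam : R[i]) (L mu c : R).
Hypotheses (mu0 : 0 <= mu) (c0 : 0 < c) (lamL : Normc.normc lam <= L).
Hypothesis re : resolvent_set a phi eps lam.
Hypothesis r0 : resolvent_set a phi 0 lam.
Hypothesis ne : (resolvent_norm a phi eps lam <= mu%:E)%E.
Hypothesis n0 : (resolvent_norm a phi 0 lam <= mu%:E)%E.

Let G0 := geometry0 C0 eta0.
Let HD0 x (Ox : Omega x) := Dh0 phi x.
Let K : R := (1 + L * mu) / kappa C a.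

Let L0 : 0 <= L. Proof. exact: le_trans (normc_ge0 _) lamL. Qed.
Let K0 : 0 < K.
Proof. by rewrite divr_gt0 ?(kappa_gt0 C a0)// ltr_wpDr// mulr_ge0. Qed.

(** The duality argument.  Here [n] is the L^2 norm of the difference; every
    term on the right is linear in [n], since [w] and its gradient are. *)
Lemma L2_difference (Fe F0 : functional R) u u1 u2 v v1 v2 (k0 d : R) : 0 <= k0 -> 0 < d ->
  hlin Fe -> hbound Fe c -> hlin F0 -> hbound F0 c ->
  hbound (fun w => Fe w - F0 w) k0 ->
  solves a phi eps lam Fe u -> solves a phi 0 lam F0 v ->
  cgrad u u1 u2 -> cgrad v v1 v2 ->
  (forall (g w w1 w2 : R * R -> R) (t : R), 0 < t -> rL2 g ->
    ip g g <= (2 + 2 * L ^+ 2 * (4 * K) ^+ 2) * t ^+ 2 -> weak_sol a w w1 w2 g ->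
    ip (fun x => w1 x * p x) (fun x => w1 x * p x) +
    ip (fun x => w2 x * p x) (fun x => w2 x * p x) <= d ^+ 2 * t ^+ 2) ->
  nsq (fun x => u x - v x) <=
    (4 * (c * K) * ((4 + a + L) * eta * (4 * K) + (2 + 3 * C) * (2 * d)) + 4 * K * k0) ^+ 2.
Proof.
move=> k00 d0 lFe bFe lF0 bF0 bd su sv gu gv Hc.
have hu := apriori a0 eta2 G HD re ne mu0 lamL lFe bFe c0 su gu.
rewrite -/K in hu.
have gz := cgradB gu gv; set z := (fun x => u x - v x) in gz *.
have [Lz Lz1 Lz2] := cgrad_cL2 gz; have Lg := cL2_conj Lz.
set X := 4 * (c * K) * _ + _.
have X0 : 0 <= X.
  rewrite /X; move: (ltW K0) (ltW c0) (ltW d0) (ltW a0).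
  by move: K => K' K'0 c0' d0' a0'; rewrite !(addr_ge0, mulr_ge0).
have [nz|nz] := eqVneq (nsq z) 0; first by rewrite nz sqr_ge0.
pose n := Num.sqrt (nsq z).
have np : 0 < n by rewrite sqrtr_gt0 lt_neqAle eq_sym nz nsq_ge0.
have nE : n ^+ 2 = nsq z by rewrite sqr_sqrtr ?nsq_ge0.
have gn : nsq (fun x => conjc (z x)) <= n ^+ 2 by rewrite nsq_conj// nE.
have w1 := @weight_cst R 1.
have lg := hlin_embed eta2 G0 HD0 Lg.
have bg : hbound (embed phi 0 (fun x => conjc (z x))) (4 * n).
  move=> w v1' v2' rho gw rp hw; rewrite (embed_cform eta2 G0 _ _ HD0) -[4 * n]mulr1.
  apply: (hbound_cform w1 Lg (ltW np) ler01 gn) gw rp hw.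
  by move=> x _; rewrite normr1.
have n40 : 0 < 4 * n by rewrite mulr_gt0.
have [ex0 _ _] := r0.
have [w sw] := ex0 _ (hbound_in_dual lg bg).
have gw := inH1_cgrad sw.1; have [Lw Lw1 Lw2] := cgrad_cL2 gw.
have hw := apriori a0 eta2 G0 HD0 r0 n0 mu0 lamL lg bg n40 sw gw.
rewrite -/K in hw.
have [_ Hu] := (solvesP a eta2 G HD lam Fe u).1 su.
have [_ Hv] := (solvesP a eta2 G0 HD0 lam F0 v).1 sv.
have [_ Hw] := (solvesP a eta2 G0 HD0 lam _ w).1 sw.
have Eu := Hu _ _ _ _ _ gu gw; have Ev := Hv _ _ _ _ _ gv gw; have Ew := Hw _ _ _ _ _ gw gz.
rewrite (embed_cform eta2 G0 _ _ HD0) in Ew.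
have LG : cL2 (fun x => lam * w x + conjc (z x)) by apply: cL2D => //; exact: cL2Z.
have weak_solG : forall y y1 y2, cgrad y y1 y2 ->
    aform a (fun=> 0) (fun=> 1) (fun=> 1) w (wderiv (1, 0)%N w) (wderiv (0, 1)%N w) y y1 y2 =
    cform (fun=> 1) (fun x => lam * w x + conjc (z x)) y.
  move=> y y1 y2 gy; have [Ly _ _] := cgrad_cL2 gy.
  rewrite (cformDl w1 (cL2Z lam Lw) Lg Ly) (cformZl lam w1 Lw Ly).
  by have := Hw _ _ _ _ _ gw gy; rewrite (embed_cform eta2 G0 _ _ HD0) => <-; rewrite addrC subrK.
have [Wr Wi] := real_part_weak_sol gw LG weak_solG.
have nG : nsq (fun x => lam * w x + conjc (z x)) <= (2 + 2 * L ^+ 2 * (4 * K) ^+ 2) * n ^+ 2.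
  apply: le_trans (nsqD (cL2Z lam Lw) Lg) _; rewrite nsqZ//.
  have l2 : Normc.normc lam ^+ 2 <= L ^+ 2 by rewrite lerXn2r ?nnegrE ?normc_ge0.
  have w2 : nsq w <= (4 * n * K) ^+ 2 := le_trans (nsq_le_h1sq _ _ _) hw.
  have := ler_pM (sqr_ge0 _) (nsq_ge0 _) l2 w2 => h.
  have -> : (2 + 2 * L ^+ 2 * (4 * K) ^+ 2) * n ^+ 2 =
    2 * (L ^+ 2 * (4 * n * K) ^+ 2) + 2 * n ^+ 2 by ring.
  by apply: lerD; rewrite ler_wpM2l.
have gr : ip (Rp (fun x => lam * w x + conjc (z x))) (Rp (fun x => lam * w x + conjc (z x))) <=
    (2 + 2 * L ^+ 2 * (4 * K) ^+ 2) * n ^+ 2.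
  by apply: le_trans nG; rewrite lerDl ip_ge0.
have gi : ip (Ip (fun x => lam * w x + conjc (z x))) (Ip (fun x => lam * w x + conjc (z x))) <=
    (2 + 2 * L ^+ 2 * (4 * K) ^+ 2) * n ^+ 2.
  by apply: le_trans nG; rewrite lerDr ip_ge0.
have cr := Hc _ _ _ _ _ np LG.1 gr Wr; have ci := Hc _ _ _ _ _ np LG.2 gi Wi.
have wpD : wsq p (wderiv (1, 0)%N w) + wsq p (wderiv (0, 1)%N w) <= (2 * d * n) ^+ 2.
  have -> : (2 * d * n) ^+ 2 = d ^+ 2 * n ^+ 2 + d ^+ 2 * n ^+ 2 + 2 * (d ^+ 2 * n ^+ 2) by ring.
  have s0 : 0 <= d ^+ 2 * n ^+ 2 by rewrite mulr_ge0 ?sqr_ge0.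
  apply: ler_wpDr; first by rewrite mulr_ge0.
  by rewrite /wsq addrACA; exact: lerD.
have U0 : 0 <= c * K by rewrite mulr_ge0 ?(ltW c0) ?(ltW K0).
have W0 : 0 <= 4 * n * K by rewrite mulr_ge0 ?(ltW n40) ?(ltW K0).
have W0' : 0 < 4 * n * K by rewrite mulr_gt0.
have D0 : 0 <= 2 * d * n by rewrite !mulr_ge0 ?(ltW d0) ?(ltW np).
have df := aform_diff C0 eta2 G eta0 a0 gu gw U0 W0 D0 hu hw wpD.
have [wp wq wr _] := G; have [Lu Lu1 Lu2] := cgrad_cL2 gu; have [Lv Lv1 Lv2] := cgrad_cL2 gv.
have wq1 : weight (fun x => q x - 1) by apply: weightD => //; exact: weight_cst.
have nw2 : nsq w <= (4 * n * K) ^+ 2 := le_trans (nsq_le_h1sq _ _ _) hw.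
have nu2 : nsq u <= (c * K) ^+ 2 := le_trans (nsq_le_h1sq _ _ _) hu.
have eb := cform_le1 wq1 Lu Lw U0 (mulr_ge0 eta0 W0) nu2 (wsq_q1 G Lw W0 nw2).
have Fb := bd _ _ _ _ gw W0' hw.
have gz' := cgradD (cgradZ (-1) gv) gu.
have Ez (x y : R * R -> R[i]) : (fun s => -1 * y s + x s) = (fun s => x s - y s).
  by apply/funext => s; rewrite mulN1r addrC.
(* the equation for [w], tested with [z], is expanded by symmetry *)
have Ea : aform a (fun=> 0) (fun=> 1) (fun=> 1) w (wderiv (1, 0)%N w) (wderiv (0, 1)%N w)
    z (fun x => u1 x - v1 x) (fun x => u2 x - v2 x) =
  aform a (fun=> 0) (fun=> 1) (fun=> 1) u u1 u2 w (wderiv (1, 0)%N w) (wderiv (0, 1)%N w) -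
  aform a (fun=> 0) (fun=> 1) (fun=> 1) v v1 v2 w (wderiv (1, 0)%N w) (wderiv (0, 1)%N w).
  rewrite aformC /z -(Ez u v) -(Ez u1 v1) -(Ez u2 v2) (aformDZl a G0 (-1) gv gu gw).
  by rewrite mulN1r addrC.
have Ec : cform (fun=> 1) w z = cform (fun=> 1) u w - cform (fun=> 1) v w.
  rewrite cformC /z -(Ez u v) (cformDl w1 (cL2Z (-1) Lv) Lu Lw) (cformZl (-1) w1 Lv Lw).
  by rewrite mulN1r addrC.
have Eq := cform1D wq Lu Lw.
have fin : n ^+ 2 <= n * X.
  apply: (@le_trans _ _ (Normc.normc (cform (fun=> 1) (fun x => conjc (z x)) z))).
    apply: le_trans (Re_le_normc _); apply: le_trans (ler_norm _).
    rewrite cformC cformE//= Rp_conj Ip_conj nE /nsq.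
    have E1 (f : R * R -> R) : (fun x => f x * 1) = f by apply/funext => x; rewrite mulr1.
    rewrite !E1 (ipC _ (fun x => -1 * Ip z x)) ipZl//; [|exact: Lz.2|exact: Lz.2].
    by rewrite mulN1r opprK.
  have -> : cform (fun=> 1) (fun x => conjc (z x)) z =
    - (aform a p q r u u1 u2 w (wderiv (1, 0)%N w) (wderiv (0, 1)%N w) -
      aform a (fun=> 0) (fun=> 1) (fun=> 1) u u1 u2 w (wderiv (1, 0)%N w) (wderiv (0, 1)%N w))
    + (lam * cform (fun x => q x - 1) u w + (Fe w - F0 w)).
    rewrite -Ew -Eu -Ev Ea Ec Eq; move: (aform a p q r _ _ _ _ _ _) (cform (fun x => q x - 1) u w).
    move: (aform _ _ _ _ u u1 u2 _ _ _) (aform _ _ _ _ v v1 v2 _ _ _).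
    by move: (cform _ u w) (cform _ v w) => A1 A2 A3 A4 A5 A6; ring.
  apply: le_trans (normcD _ _) _; rewrite normcN.
  apply: le_trans (lerD df (le_trans (normcD _ _) (lerD (lexx _) Fb))) _.
  rewrite Normc.normcM.
  have h := ler_pM (normc_ge0 _) (normc_ge0 _) lamL eb.
  apply: le_trans (lerD (lexx _) (lerD h (lexx _))) _.
  by rewrite le_eqVlt /X; apply/orP; left; apply/eqP; ring.
rewrite -nE lerXn2r ?nnegrE ?(ltW np)//.
by rewrite -(ler_pM2l np) -expr2.
Qed.

End FixedEps.
End Comparison.

(** * The perturbed domains and the comparison of resolvents *)

Section Perturbation.
Variable R : realType.
Variables (phi : R -> R -> R) (eps0 : R).
Hypotheses (eps00 : 0 < eps0) (adm : admissible phi eps0).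

Lemma measurable_within01 (f : R -> R) : {within `[0%R, 1%R], continuous f} ->
  measurable_fun (`]0%R, 1%R[%classic : set (measurableTypeR R)) (f : measurableTypeR R -> measurableTypeR R).
Proof.
move=> cf; have m : measurable_fun (`[0%R, 1%R]%classic : set (measurableTypeR R)) (f : measurableTypeR R -> measurableTypeR R).
  by apply: subspace_continuous_measurable_fun => //; exact: measurable_itv.
by apply: measurable_funS m => //; exact: subset_itv_oo_cc.
Qed.

Lemma measurable_snd01 (f : R -> R) :
  measurable_fun (`]0%R, 1%R[%classic : set (measurableTypeR R)) (f : measurableTypeR R -> measurableTypeR R) ->
  measurable_fun (Omega : set (plane R)) (fun x : plane R => f x.2).
Proof.
move=> mf.
have m2 : measurable_fun setT (fun x : plane R => (f \_ `]0%R, 1%R[%classic) x.2).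
  apply: (@measurableT_comp _ _ _ _ _ _ (f \_ `]0%R, 1%R[%classic)); last exact: measurable_snd.
  apply/(measurable_restrictT (f : measurableTypeR R -> measurableTypeR R)) => //.
have := measurable_funTS (D := (Omega : set (plane R))) m2.
apply: eq_measurable_fun => x; rewrite inE => -[_ x2].
by rewrite patchE mem_set.
Qed.

Lemma measurable_trig (f : R -> R) (eps : R) : continuous f ->
  measurable_fun (Omega : set (plane R)) (fun x : plane R => f (x.1 / eps)).
Proof.
move=> cf; apply: measurable_funTS.
apply: (@measurableT_comp _ _ _ _ _ _ (f : measurableTypeR R -> measurableTypeR R)).
  exact: continuous_measurable_fun.
by apply: measurable_funM => //; exact: measurable_fst.
Qed.

(** On the square, the slope condition makes [q - 1] small and the boundedness
    of [phi / eps] bounds [p], while the fourth power of [p] is integrated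
    against the hypothesis on [phi^2 / eps^2]. *)
Lemma small_geometry : exists2 C : R, 0 <= C & forall eta tau : R, 0 < eta -> 0 < tau ->
  \forall eps \near 0^'+, exists p q r : R * R -> R,
    [/\ geometry C eta p q r,
        forall x, Omega x -> Dh phi eps x = lower2 (- p x) (q x) &
        ip (fun x => p x ^+ 2) (fun x => p x ^+ 2) <= tau].
Proof.
have [H1 [slope quart [B HB]]] := adm.
exists `|B| => // eta tau eta0 tau0.
have eta1 : 0 < Num.min eta 2^-1 by rewrite lt_min eta0 /=.
have st0 : 0 < Num.sqrt tau by rewrite sqrtr_gt0.
have Q : \forall eps \near 0^'+, (L2norm (fun x => (phi x.2 eps ^+ 2 / eps ^+ 2)%:C%C) <= (Num.sqrt tau)%:E)%E.
  have /fine_cvgP[fn /cvgrPdist_le /(_ _ st0) cv] := quart.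
  near=> eps.
  have f : L2norm (fun x => (phi x.2 eps ^+ 2 / eps ^+ 2)%:C%C) \is a fin_num by near: eps.
  rewrite -(fineK f) lee_fin.
  have : `|0 - fine (L2norm (fun x => (phi x.2 eps ^+ 2 / eps ^+ 2)%:C%C))| <= Num.sqrt tau by near: eps.
  by rewrite sub0r normrN; apply: le_trans; exact: ler_norm.
near=> eps.
have e0 : 0 < eps by near: eps; exact: nbhs_right_gt.
have e1 : eps <= eps0 by near: eps; exact: nbhs_right_le.
have e01 : 0 < eps <= eps0 by rewrite e0.
have [[cphi [f1 [f2 [cf1 _ der]]]] _ _ _] := H1 eps e01.
have sl : forall t : R, 0 < t < 1 -> `| derive1 (phi ^~ eps) t | <= Num.min eta 2^-1.
  by near: eps; exact: slope.
have q4 : (L2norm (fun x => (phi x.2 eps ^+ 2 / eps ^+ 2)%:C%C) <= (Num.sqrt tau)%:E)%E by near: eps.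
have O2 (x : R * R) : Omega x -> 0 < x.2 < 1 by move=> [_]; rewrite /= in_itv.
have d1 t : 0 < t < 1 -> derive1 (phi ^~ eps) t = f1 t.
  by move=> t01; rewrite derive1E; have [h _] := der t t01; exact: derive_val.
have mphi := measurable_snd01 (measurable_within01 cphi).
have mphi' : measurable_fun (Omega : set (plane R)) (fun x : plane R => derive1 (phi ^~ eps) x.2).
  have := measurable_snd01 (measurable_within01 cf1).
  by apply: eq_measurable_fun => x; rewrite inE => Ox; rewrite d1// O2.
have mp : measurable_fun (Omega : set (plane R)) (fun x : plane R => - pfun phi eps x).
  apply: measurable_funN; apply: measurable_funM; last exact: measurable_trig (@continuous_cos R).
  by apply: measurable_funM.
have mq : measurable_fun (Omega : set (plane R)) (fun x : plane R => qfun phi eps x - 1).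
  apply: measurable_funB => //; apply: measurable_funD => //.
  by apply: measurable_funM => //; exact: measurable_trig (@continuous_sin R).
pose p : R * R -> R := (fun x => - pfun phi eps x) \_ Omega.
pose s : R * R -> R := (fun x => qfun phi eps x - 1) \_ Omega.
pose q x := 1 + s x.
pose r x := (1 + p x ^+ 2) * (q x) `^ (-1).
have pE x : Omega x -> p x = - pfun phi eps x by move=> Ox; rewrite /p patchE mem_set.
have sE x : Omega x -> s x = qfun phi eps x - 1 by move=> Ox; rewrite /s patchE mem_set.
have mp' : measurable_fun setT (p : plane R -> R) by apply/measurable_onO.
have ms' : measurable_fun setT (s : plane R -> R) by apply/measurable_onO.
have mq' : measurable_fun setT (q : plane R -> R) by exact: measurable_funD.
have pB x : Omega x -> `|p x| <= `|B|.
  move=> Ox; rewrite pE// normrN /pfun normrM; have /andP[x0 x1] := O2 x Ox.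
  have h := HB eps x.2 e01; rewrite (ltW x0) (ltW x1) in h; have {}h := h isT.
  apply: le_trans (ler_norm B); apply: le_trans h; rewrite ler_piMr//.
  by rewrite ler_norml cos_geN1 cos_le1.
have sB x : Omega x -> `|s x| <= Num.min eta 2^-1.
  move=> Ox; rewrite sE// /qfun addrAC subrr add0r normrM.
  apply: le_trans (sl _ (O2 x Ox)); rewrite ler_piMr//.
  by rewrite ler_norml sin_geN1 sin_le1.
have qB x : Omega x -> 2^-1 <= q x <= 2.
  move=> Ox; have := sB x Ox; rewrite le_min => /andP[_].
  by rewrite /q ler_norml => /andP[h1 h2]; apply/andP; split; lra.
have wp : weight p by split => //; exists `|B|.
have wq : weight q.
  split => //; exists 2 => x Ox; have /andP[h1 h2] := qB x Ox.
  by rewrite ger0_norm//; lra.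
have wr : weight r.
  apply: weightM; first by apply: weightD; [exact: weight_cst|apply: weightM].
  split; first by apply: (measurableT_comp (measurable_powR (-1))).
  exists 2 => x Ox; have /andP[h1 h2] := qB x Ox.
  rewrite ger0_norm ?powR_ge0// powR_inv1; last lra.
  by rewrite -[leRHS]invrK lef_pV2// posrE; lra.
exists p, q, r; split.
- split => // x Ox; split; first exact: pB.
    by rewrite /q addrC addKr; apply: le_trans (sB x Ox) _; rewrite ge_min lexx.
  have /andP[h1 h2] := qB x Ox; have q0 : 0 < q x by lra.
  by rewrite /r powR_inv1 ?(ltW q0)// mulrCA divff ?gt_eqF// mulr1.
- move=> x Ox; rewrite DhE; last first.
    by right; have [[]] := der x.2 (O2 x Ox).
  by rewrite pE// opprK /q sE// addrC subrK.
- have Lp2 : rL2 (fun x => p x ^+ 2).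
    have w2 : weight (fun x => p x ^+ 2) := weightM wp wp.
    have -> : (fun x => p x ^+ 2) = (fun x => 1 * p x ^+ 2) by apply/funext => x; rewrite mul1r.
    exact: rL2_weight w2 (rL2_cst 1).
  rewrite -lee_fin -ipE//; move: q4; rewrite /L2norm.
  set I := (\int[leb2]_(x in Omega) _)%E => q4.
  have I0 : (0 <= I)%E by apply: integral_ge0 => x _; rewrite lee_fin sqr_ge0.
  have It : (I <= tau%:E)%E.
    have := sqr_sqrte I0 => <-.
    have <- : ((Num.sqrt tau)%:E ^+ 2 = tau%:E)%E by rewrite -EFin_expe sqr_sqrtr ?ltW.
    exact: (lee_pmul (sqrte_ge0 I) (sqrte_ge0 I) q4 q4).
  apply: le_trans It; apply: ge0_le_integral => //.
  - by move=> x _; rewrite lee_fin sqr_ge0.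
  - by apply/measurable_EFinP; apply: measurable_funX; exact: rL2_measurable.
  - apply/measurable_EFinP; apply: measurable_funX.
    have := measurable_funM (measurable_funX 2 mphi) (@measurable_cst _ _ (plane R) (measurableTypeR R) Omega (eps ^- 2)).
    by apply: eq_measurable_fun => x _; rewrite normc_real ger0_norm// divr_ge0 ?sqr_ge0.
  - move=> x Ox; rewrite lee_fin lerXn2r ?nnegrE ?sqr_ge0 ?normc_ge0//.
    rewrite normc_real ger0_norm ?divr_ge0 ?sqr_ge0// pE// sqrrN /pfun exprMn.
    rewrite [(phi x.2 eps / eps) ^+ 2]exprMn exprVn ler_piMr ?divr_ge0 ?sqr_ge0//.
Unshelve. all: by end_near. Qed.

End Perturbation.

Section Convergence.
Variable R : realType.
Local Open Scope complex_scope.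

Lemma h1sqB (u u1 u2 v v1 v2 : R * R -> R[i]) : cgrad u u1 u2 -> cgrad v v1 v2 ->
  h1sq (fun x => u x - v x) (fun x => u1 x - v1 x) (fun x => u2 x - v2 x) <=
  2 * h1sq u u1 u2 + 2 * h1sq v v1 v2.
Proof.
move=> gu gv; have E (f g : R * R -> R[i]) : (fun x => f x + -1 * g x) = (fun x => f x - g x).
  by apply/funext => x; rewrite mulN1r.
have := h1sqD gu (cgradZ (-1) gv).
by rewrite (h1sqZ (-1) gv) normcN Normc.normc1 expr1n mul1r (E u v) (E u1 v1) (E u2 v2).
Qed.

Lemma nsq_grad_le_h1sq (u u1 u2 : R * R -> R[i]) : nsq u1 + nsq u2 <= h1sq u u1 u2.
Proof. by rewrite /h1sq -(addrA (nsq u)) lerDr nsq_ge0. Qed.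

Implicit Types F : functional R.
Variables (a eps0 b M : R) (phi : R -> R -> R).
Hypotheses (a0 : 0 < a) (eps00 : 0 < eps0) (adm : admissible phi eps0).
Hypotheses (b0 : 0 < b) (hsect : sectorial a phi eps0 b M).

(** The vertex is positive, so [0] has argument [pi] seen from it. *)
Lemma sector0 : sector b (0 : R[i]).
Proof.
split; first by rewrite eq_sym fmorph_eq0 gt_eqF.
exists pi; split.
  by rewrite gtr0_norm ?pi_gt0// lexx andbT ler_pdivrMr// ler_peMr ?pi_ge0// ler1n.
rewrite cospi sinpi sub0r normcN normc_real gtr0_norm//.
by apply: complexP => /=; ring.
Qed.

(** The smallness parameters are chosen backwards: first the interpolation
    parameter from the H^1 bound, then the size [X] of the L^2 norm, then the
    three contributions to it, each at most [X / 3]. *)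
Lemma convergence_core (s : R) (hs : 0 <= s < 1) (c L mu : R) :
  0 < c -> 0 <= L -> 0 <= mu -> forall eta : R, 0 < eta ->
  exists2 k0 : R, 0 < k0 & \forall eps \near 0^'+,
    forall (lam : R[i]), sector b lam -> Normc.normc lam <= L ->
      M / Normc.normc (lam - b%:C) <= mu ->
    forall Fe F0 : functional R, hlin Fe -> hbound Fe c -> hlin F0 -> hbound F0 c ->
      hbound (fun w => Fe w - F0 w) k0 ->
      (Hnorm s (fun x => resolvent a phi eps lam Fe x - resolvent a phi 0 lam F0 x)%R <= eta%:E)%E.
Proof.
move=> c0 L0 mu0 eta eta0.
have [C C0 HC] := small_geometry eps00 adm.
have [K KE] : exists K, K = (1 + L * mu) / kappa C a by eexists.
have K0 : 0 < K by rewrite KE divr_gt0 ?(kappa_gt0 C a0)// ltr_wpDr// mulr_ge0.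
have cK0 : 0 < c * K by rewrite mulr_gt0.
(* the gradient of the difference is bounded by [4 (c K)^2] in square norm *)
have del0 : 0 < eta ^+ 2 / 2 / (4 * (c * K) ^+ 2).
  by apply: divr_gt0; [rewrite divr_gt0// exprn_gt0|rewrite mulr_gt0// exprn_gt0].
have [D D0 HD] := Hnorm_interpolation hs del0.
pose X := Num.sqrt (eta ^+ 2 / 2 / (D + 1)).
have D1 : 0 < D + 1 by rewrite ltr_wpDl.
have X0 : 0 < X by rewrite sqrtr_gt0 !divr_gt0// exprn_gt0.
pose k1 := X / 3 / (4 * (c * K) * ((4 + a + L) * (4 * K))).
have k10 : 0 < k1.
  by rewrite !divr_gt0// !mulr_gt0// ltr_wpDr// addr_gt0.
pose d := X / 3 / (4 * (c * K) * ((2 + 3 * C) * 2)).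
have C20 : 0 < 2 + 3 * C by rewrite ltr_wpDr// mulr_ge0.
have d0 : 0 < d by rewrite !divr_gt0// !mulr_gt0.
pose k0 := X / 3 / (4 * K).
have k00 : 0 < k0 by rewrite !divr_gt0// mulr_gt0.
exists k0 => //.
have e00 : 0 <= (0 : R) <= eps0 by rewrite lexx ltW.
have ex := weak_sol_exists (hsect e00 sector0).1.
have B0 : 0 <= 2 + 2 * L ^+ 2 * (4 * K) ^+ 2 by rewrite addr_ge0// mulr_ge0 ?sqr_ge0// mulr_ge0 ?sqr_ge0.
have [tau tau0 comp] := compact_resolvent_scaled a0 ex B0 C0 (exprn_gt0 2 d0).
have k1m : 0 < Num.min k1 2^-1 by rewrite lt_min k10 /=.
near=> eps.
have ep : 0 < eps by near: eps; exact: nbhs_right_gt.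
have el : eps <= eps0 by near: eps; exact: nbhs_right_le.
have [p [q [r [G HDh ptau]]]] : exists p q r : R * R -> R,
    [/\ geometry C (Num.min k1 2^-1) p q r,
        forall x, Omega x -> Dh phi eps x = lower2 (- p x) (q x) &
        ip (fun x => p x ^+ 2) (fun x => p x ^+ 2) <= tau].
  by near: eps; exact: HC.
move=> lam slam lamL lammu Fe F0 lFe bFe lF0 bF0 bd.
have ee : 0 <= eps <= eps0 by rewrite (ltW ep).
have [re ne] := hsect ee slam; have [r0 n0] := hsect e00 slam.
have {}ne : (resolvent_norm a phi eps lam <= mu%:E)%E by apply: le_trans ne _; rewrite lee_fin.
have {}n0 : (resolvent_norm a phi 0 lam <= mu%:E)%E by apply: le_trans n0 _; rewrite lee_fin.
have [exe _ _] := re; have [ex0 _ _] := r0.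
set u := resolvent a phi eps lam Fe; set v := resolvent a phi 0 lam F0.
have su : solves a phi eps lam Fe u by apply: resolvent_solves; apply: exe; exact: hbound_in_dual lFe bFe.
have sv : solves a phi 0 lam F0 v by apply: resolvent_solves; apply: ex0; exact: hbound_in_dual lF0 bF0.
have [u1 [u2 gu]] : exists u1 u2, cgrad u u1 u2 by do 2 eexists; exact: inH1_cgrad su.1.
have [v1 [v2 gv]] : exists v1 v2, cgrad v v1 v2 by do 2 eexists; exact: inH1_cgrad sv.1.
have h2 : Num.min k1 2^-1 <= 2^-1 by rewrite ge_min lexx orbT.
have h1 : Num.min k1 2^-1 <= k1 by rewrite ge_min lexx.
have G0 := geometry0 C0 (ltW k1m).
have hu := apriori a0 h2 G HDh re ne mu0 lamL lFe bFe c0 su gu.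
have hv := apriori a0 h2 G0 (fun x _ => Dh0 phi x) r0 n0 mu0 lamL lF0 bF0 c0 sv gv.
rewrite -KE in hu hv.
have [wp _ _ pB] := G.
have small := L2_difference a0 C0 (ltW k1m) h2 G HDh mu0 c0 lamL re r0 ne n0
  (ltW k00) d0 lFe bFe lF0 bF0 bd su sv gu gv.
rewrite -KE in small.
have {}small := small (comp p wp.1 (fun x Ox => let: And3 h _ _ := pB x Ox in h) ptau).
have gz := cgradB gu gv.
have [_ Hs] := HD _ _ _ gz.
have [iz _] := HD _ _ _ gz.
have nX : nsq (fun x => u x - v x) <= X ^+ 2.
  apply: le_trans small _; rewrite lerXn2r ?nnegrE ?(ltW X0)//.
    have nn (x y z : R) : 0 <= x -> 0 <= y -> 0 <= z ->
        0 <= 4 * (c * K) * ((4 + a + L) * x * (4 * K) + (2 + 3 * C) * (2 * y)) + 4 * K * z.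
      move: (ltW K0) (ltW c0) (ltW a0) => ? ? ? ? ? ?.
      by rewrite !(addr_ge0, mulr_ge0).
    exact: nn (ltW k1m) (ltW d0) (ltW k00).
  have t1 : 4 * (c * K) * ((4 + a + L) * Num.min k1 2^-1 * (4 * K)) <= X / 3.
    apply: (@le_trans _ _ (4 * (c * K) * ((4 + a + L) * (4 * K)) * k1)).
      rewrite -!mulrA ler_wpM2l// ler_wpM2l ?(ltW c0)// ler_wpM2l ?(ltW K0)//.
      rewrite ler_wpM2l ?addr_ge0 ?(ltW a0)// mulrC -!mulrA ler_wpM2l// ler_wpM2l ?(ltW K0)//.
    by rewrite /k1 mulrC divfK// gt_eqF// !mulr_gt0// ltr_wpDr// addr_gt0.
  have t2 : 4 * (c * K) * ((2 + 3 * C) * (2 * d)) = X / 3.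
    by rewrite [(2 + 3 * C) * _]mulrA [LHS]mulrA mulrC /d divfK// gt_eqF// !mulr_gt0.
  have t3 : 4 * K * k0 = X / 3 by rewrite mulrC /k0 divfK// gt_eqF// mulr_gt0.
  rewrite mulrDr t2 t3; apply: le_trans (lerD (lerD t1 (lexx _)) (lexx _)) _.
  by rewrite le_eqVlt; apply/orP; left; apply/eqP; field.
have ng : nsq (fun x => u1 x - v1 x) +
    nsq (fun x => u2 x - v2 x) <= 4 * (c * K) ^+ 2.
  apply: le_trans (nsq_grad_le_h1sq (fun x => u x - v x) _ _) _.
  apply: le_trans (h1sqB gu gv) _.
  apply: (@le_trans _ _ (2 * (c * K) ^+ 2 + 2 * (c * K) ^+ 2)).
    exact: lerD (ler_wpM2l (ler0n _ 2) hu) (ler_wpM2l (ler0n _ 2) hv).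
  by rewrite -mulrDl -natrD.
rewrite /Hnorm; case: asboolP => // _; apply: sqrte_le; first exact: ltW.
apply: le_trans Hs _; rewrite lee_fin [leRHS](splitr (eta ^+ 2)); apply: lerD.
  apply: le_trans (ler_wpM2l (ltW del0) ng) _.
  by rewrite divfK// gt_eqF// mulr_gt0// exprn_gt0.
apply: le_trans (ler_wpM2l D0 nX) _; rewrite sqr_sqrtr; last first.
  by rewrite !divr_ge0 ?sqr_ge0// ltW.
rewrite mulrA ler_pdivrMr// mulrC ler_wpM2l ?divr_ge0 ?sqr_ge0//.
by rewrite lerDl.
Unshelve. all: by end_near. Qed.

(** On a compact set that avoids the vertex, [lam] is bounded and stays away
    from [b]. *)
Lemma compact_sector (K : set R[i]) : compact (K : set R[i]^o) -> K `<=` sector b ->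
  exists L mu : R, [/\ 0 <= L, 0 <= mu & forall lam, K lam ->
    Normc.normc lam <= L /\ M / Normc.normc (lam - b%:C) <= mu].
Proof.
move=> cK Ks.
have /near_covering_withinP cov := (compact_near_coveringP (K : set R[i]^o)).1 cK.
have := cov nat \oo (fun n (lam : R[i]) => Normc.normc lam <= n%:R /\
  M / Normc.normc (lam - b%:C) <= n%:R).
case.
  move=> lam Kl; have [lb _] := Ks _ Kl.
  pose e := Normc.normc (lam - b%:C) / 2.
  have e0 : 0 < e.
    rewrite divr_gt0// lt_neqAle normc_ge0 andbT eq_sym; apply/eqP => /Normc.eq0_normc/eqP.
    by rewrite subr_eq0 (negbTE lb).
  have ec : 0 < e%:C by rewrite ltcR.
  have c1 : 0 < (1 : R[i]) by [].
  (* a bound valid on the ball of radius [min 1 e] around [lam] *)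
  pose N := (Num.truncn (Normc.normc lam + 1) + Num.truncn (`|M| / e)).+1.
  have N1 : Normc.normc lam + 1 <= N%:R.
    have /andP[_ /ltW h] := truncn_itv (addr_ge0 (normc_ge0 lam) ler01).
    by apply: le_trans h _; rewrite ler_nat ltnS leq_addr.
  have N2 : `|M| / e <= N%:R.
    have /andP[_ /ltW h] := truncn_itv (divr_ge0 (normr_ge0 M) (ltW e0)).
    by apply: le_trans h _; rewrite ler_nat ltnS leq_addl.
  near=> lam' n => _.
  have n1 : (N <= n)%N by near: n; exact: nbhs_infty_ge.
  have d1 : Normc.normc (lam - lam') < 1.
    rewrite -ltcR; near: lam'.
    exact: (@nbhsx_ballx R[i] R[i]^o lam 1 c1).
  have d2 : Normc.normc (lam - lam') < e.
    rewrite -ltcR; near: lam'.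
    exact: (@nbhsx_ballx R[i] R[i]^o lam e%:C ec).
  split.
    have := normcD lam (- (lam - lam')); rewrite normcN opprB addrC subrK => h.
    have nn : (N%:R : R) <= n%:R by rewrite ler_nat.
    by move: h d1 N1 nn; lra.
  have h : e <= Normc.normc (lam' - b%:C).
    have := normcD (lam' - b%:C) (lam - lam'); rewrite addrC addrA subrK.
    by move: d2; rewrite /e; lra.
  apply: (@le_trans _ _ (`|M| / e)); last by apply: le_trans N2 _; rewrite ler_nat.
  apply: (@le_trans _ _ (`|M| / Normc.normc (lam' - b%:C))).
    by rewrite ler_wpM2r ?invr_ge0 ?normc_ge0// ler_norm.
  by rewrite ler_wpM2l// lef_pV2// posrE// (lt_le_trans e0).
move=> N _ H; exists N%:R, N%:R; split => // lam Kl; exact: (H N (leqnn N)).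
Unshelve. all: by end_near. Qed.

End Convergence.

(** * Convergence of the resolvents *)

Section Vanishing.
Variable R : realType.
Local Open Scope complex_scope.

Lemma Hnorm_ge0 (r : R) (u : R * R -> R[i]) : (0 <= Hnorm r u)%E.
Proof. by rewrite /Hnorm; case: asboolP => // _; exact: sqrte_ge0. Qed.

Lemma dual_ball0 (r : R) : dual_ball r (fun=> 0 : R[i]).
Proof.
split; first split.
- by move=> c u v _ _; rewrite mulr0 addr0.
- by exists 0 => u _; rewrite Normc.normc0 mul0e.
apply: ub_ereal_sup => _ [u _ <-]; by rewrite Normc.normc0 lee_fin.
Qed.

Lemma Rp0 : Rp (fun=> 0 : R[i]) = fun=> 0 :> R.
Proof. by apply/funext => x; rewrite /Rp patchE; case: ifP. Qed.

Lemma Ip0 : Ip (fun=> 0 : R[i]) = fun=> 0 :> R.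
Proof. by apply/funext => x; rewrite /Ip patchE; case: ifP. Qed.

Lemma is_wderiv_0 al : is_wderiv al (fun=> 0 : R[i]) (fun=> 0 : R[i]).
Proof.
apply/is_wderivE; split; first by rewrite /cL2 Rp0 Ip0; split; exact: rL2_cst.
by move=> f _; rewrite Rp0 Ip0 !ip0l mulr0.
Qed.

(** The unit ball is inhabited for orders of any size, so that the operator
    norms are nonnegative; the derivatives of zero are zero only almost
    everywhere, as they are selected by a choice operator. *)
Lemma H_ball0 (r : R) : 0 <= r -> H_ball r (fun=> 0 : R[i]).
Proof.
move=> r0; have w0 al := is_wderiv_0 al.
have L0 : cL2 (fun=> 0 : R[i]) by have /is_wderivE[] := w0 (0, 0)%N.
have N0 : nsq (fun=> 0 : R[i]) = 0 by rewrite /nsq Rp0 Ip0 ip0l addr0.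
pose z : R * R -> R[i] := fun=> 0.
have nz al : (L2norm (wderiv al z) ^+ 2 = 0)%E.
  by rewrite (L2norm_wderiv (w0 al)) N0.
have E : Hnorm_sq r z = 0%E.
  rewrite /Hnorm_sq big1 ?add0e; last first.
    by move=> i _; rewrite big1// => j _; exact: nz.
  case: ifP => // sg; rewrite big1// => i _.
  set al := (nat_of_ord i, _).
  have dv := wderivP (ex_intro _ _ (w0 al)); have [Lw _] := (is_wderivE _ _ _).1 dv.
  have gw := ae_cgrad Lw (is_wderiv_uniq (w0 al) dv) (cgrad0 R).
  have sg1 : 0 < r - (Num.truncn r)%:R < 1.
    by rewrite sg ltrBlDr addrC; have /andP[_] := truncn_itv r0; rewrite -natr1.
  have [C C0 HC] := slobodeckij_weak sg1.
  have h1 := HC _ _ _ (rgrad_weak gw.1); have h2 := HC _ _ _ (rgrad_weak gw.2).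
  apply/eqP; rewrite eq_le slobodeckij_ge0 andbT.
  apply: le_trans (slobodeckij_le _ Lw) _; apply: le_trans (leeD h1 h2) _.
  by rewrite Rp0 Ip0 !ip0l addr0 mulr0 adde0.
have i0 : inH r (fun=> 0 : R[i]).
  split; [exact/inL2P|by move=> i j _; exists (fun=> 0); exact: w0|by rewrite E ltry].
by split => //; rewrite /Hnorm; case: asboolP => // _; rewrite E sqrte0.
Qed.

(** The uniform bounds on compact sets contain the pointwise limits, a point
    being compact. *)
Lemma vanishes_onP (M b : R) (dist : R -> R[i] -> \bar R) :
  (forall eps lam, (0 <= dist eps lam)%E) ->
  (forall L mu : R, 0 <= L -> 0 <= mu -> forall eta : R, 0 < eta ->
    \forall eps \near 0^'+, forall lam, sector b lam -> Normc.normc lam <= L ->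
      M / Normc.normc (lam - b%:C) <= mu -> (dist eps lam <= eta%:E)%E) ->
  vanishes_on (sector b) dist.
Proof.
move=> dist0 H.
have U (K : set R[i]) : compact (K : set R[i]^o) -> K `<=` sector b ->
    forall eta : R, 0 < eta ->
      \forall eps \near 0^'+, forall lam, K lam -> (dist eps lam <= eta%:E)%E.
  move=> cK Ks eta eta0; have [L [mu [L0 mu0 HK]]] := compact_sector M cK Ks.
  apply: filterS (H L mu L0 mu0 eta eta0) => eps He lam Kl.
  by have [h1 h2] := HK _ Kl; apply: He => //; exact: Ks.
split => // lam sl.
have U1 (eta : R) : 0 < eta -> \forall eps \near 0^'+, (dist eps lam <= eta%:E)%E.
  move=> eta0; have := U [set lam] (@compact_set1 R[i]^o lam).
  move=> /(_ _ eta eta0) H1; apply: filterS (H1 _) => [eps|]; first by apply.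
  by move=> _ ->.
apply/fine_cvgP; split.
  apply: filterS (U1 1 ltr01) => eps d1.
  by rewrite ge0_fin_numE//; apply: le_lt_trans d1 _; rewrite ltry.
apply/cvgrPdist_le => e e0; apply: filterS (U1 e e0) => eps de.
have f : dist eps lam \is a fin_num.
  by rewrite ge0_fin_numE//; apply: le_lt_trans de _; rewrite ltry.
rewrite sub0r normrN ger0_norm ?fine_ge0//.
by rewrite -lee_fin fineK.
Qed.

End Vanishing.

Theorem theorem5p4 (R : realType) (a eps0 b M : R) (phi : R -> R -> R)
    (ha : 0 < a) (heps0 : 0 < eps0) (hphi : admissible phi eps0)
    (hb : 0 < b) (hsect : sectorial a phi eps0 b M)
    (beta s : R) (hbeta : beta < 1) (hs : 0 <= s < 1) :
  (0 <= beta ->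
     vanishes_on (sector b) (resolvent_dist_dual a phi beta s)) /\
  (beta <= 0 ->
     vanishes_on (sector b) (resolvent_dist_fun a phi beta s)).
Proof.
split => b0.
  apply: (@vanishes_onP R M).
    move=> eps lam; apply: le_trans (Hnorm_ge0 s _) _; apply: ereal_sup_ubound.
    by exists (fun=> 0) => //; exact: dual_ball0.
  move=> L mu L0 mu0 eta eta0.
  have b01 : 0 <= beta < 1 by rewrite b0.
  have [c c0 Hc] := dual_ball_hbound b01.
  have [k0 k00 core] := convergence_core ha heps0 hphi hb hsect hs c0 L0 mu0 eta0.
  apply: filterS core => eps core lam sl lL lM; apply: ub_ereal_sup => _ [F BF <-].
  have [lF bF] := Hc F BF; apply: core => // w w1 w2 rho gw r0 _.
  by rewrite subrr Normc.normc0 mulr_ge0 ?ltW.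
apply: (@vanishes_onP R M).
  move=> eps lam; apply: le_trans (Hnorm_ge0 s _) _; apply: ereal_sup_ubound.
  by exists (fun=> 0) => //; apply: H_ball0; rewrite oppr_ge0.
move=> L mu L0 mu0 eta eta0.
(* the Jacobian is at most 2, whence the bound 8 for the functional of [f] *)
have c0 : (0 : R) < 4 * 1 * 2 by rewrite !mulr_gt0.
have [k0 k00 core] := convergence_core ha heps0 hphi hb hsect hs c0 L0 mu0 eta0.
have [C C0 geo] := small_geometry heps0 hphi.
have e0 : 0 < Num.min (k0 / 4) 2^-1 by rewrite lt_min divr_gt0 /=.
apply: filterS2 core (geo _ _ e0 ltr01) => eps core [p [q [r [G HD _]]]] lam sl lL lM.
apply: ub_ereal_sup => _ [f Bf <-].
have [Lf nf] := H_ball_L2 Bf.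
have h2 : Num.min (k0 / 4) 2^-1 <= 2^-1 by rewrite ge_min lexx orbT.
have hk : Num.min (k0 / 4) 2^-1 <= k0 / 4 by rewrite ge_min lexx.
have G0 := geometry0 C0 (ltW e0).
have HD0 x (Ox : Omega x) := @Dh0 R phi x.
have [_ wq _ qx] := G.
have nf1 : nsq f <= 1 ^+ 2 by rewrite expr1n.
have q2 x : Omega x -> `|q x| <= 2.
  move=> Ox; have /andP[q1 q2] := geometry_q h2 G Ox.
  by rewrite ger0_norm//; apply: le_trans q1; rewrite invr_ge0.
have w1 := @weight_cst R 1.
apply: core => //.
- have H := hlin_embed h2 G HD Lf; exact H.
- move=> w v1 v2 rho gw r0 hw; rewrite (embed_cform h2 G _ _ HD).
  exact: (hbound_cform wq Lf ler01 (ler0n _ 2) nf1 q2 gw r0 hw).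
- have H := hlin_embed h2 G0 HD0 Lf; exact H.
- move=> w v1 v2 rho gw r0 hw; rewrite (embed_cform h2 G0 _ _ HD0).
  apply: (hbound_cform w1 Lf ler01 (ler0n _ 2) nf1 _ gw r0 hw) => x _.
  by rewrite normr1 ler1n.
move=> w v1 v2 rho gw r0 hw; have [Lw _ _] := cgrad_cL2 gw.
rewrite (embed_cform h2 G _ _ HD) (embed_cform h2 G0 _ _ HD0) (cform1D wq Lf Lw).
rewrite [X in Normc.normc X]addrC addKr.
have wq1 : weight (fun x => q x - 1) by apply: weightD => //; exact: weight_cst.
have q1 x : Omega x -> `|q x - 1| <= k0 / 4.
  by move=> Ox; apply: le_trans hk; have [] := qx x Ox.
have k40 : 0 <= k0 / 4 by rewrite divr_ge0// ltW.
apply: le_trans (hbound_cform wq1 Lf ler01 k40 nf1 q1 gw r0 hw) _.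
by rewrite mulr1 (mulrC 4) divfK.
Qed.
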